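(* Fix $p\ge3$ and let $(\beta,h)\in\Theta$ be $p$-critical, with $h$ known and $\bm X\sim\mathbb P_{\beta,h,p}$. Let $m_1<\dots<m_K$ ($K\in\{2,3\}$) be the global maximizers of $H=H_{\beta,h,p}$ and $p_k=[(m_k^2-1)H''(m_k)]^{-1/2}/\sum_{i=1}^K[(m_i^2-1)H''(m_i)]^{-1/2}$. Write $\sigma_k^2=-H''(m_k)/(p^2m_k^{2p-2})$. As $N\to\infty$, in distribution: (1) If $p$ is odd, then $K=2$ and: if $(\beta,h)\ne(\tilde\beta_p,0)$, $N^{1/2}(\hat\beta_N-\beta)\to\frac{p_1}{2}N^-(0,\sigma_1^2)+\frac{1-p_1}{2}N^+(0,\sigma_2^2)+\frac12\delta_0$; if $(\beta,h)=(\tilde\beta_p,0)$, $N^{1/2}(\hat\beta_N-\beta)\to\frac{p_1}{2}\delta_{-\infty}+\frac{1-p_1}{2}N^+(0,\sigma_2^2)+\frac12\delta_0$. (2) If $p\ge4$ is even: if $h>0$, $N^{1/2}(\hat\beta_N-\beta)\to\frac{p_1}{2}N^-(0,\sigma_1^2)+\frac{1-p_1}{2}N^+(0,\sigma_2^2)+\frac12\delta_0$; if $h<0$, $N^{1/2}(\hat\beta_N-\beta)\to\frac{p_1}{2}N^+(0,\sigma_1^2)+\frac{1-p_1}{2}N^-(0,\sigma_2^2)+\frac12\delta_0$; if $h=0$ and $\beta>\tilde\beta_p$, then the maximizers are $\pm m_*$ with $m_*>0$ and $N^{1/2}(\hat\beta_N-\beta)\to N\big(0,-\frac{H''(m_*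 )}{p^2m_*^{2p-2}}\big)$; if $h=0$ and $\beta=\tilde\beta_p$, then the maximizers are $-m_*,0,m_*$ with $m_*>0$ and $N^{1/2}(\hat\beta_N-\beta)\to p_2\gamma_p\delta_{-\infty}+p_1N^+\big(0,-\frac{H''(m_* )}{p^2m_*^{2p-2}}\big)+(1-p_1-p_2\gamma_p)\delta_0$, where $\gamma_p=\mathbb P(Z^p\le\mathbb EZ^p)$, $Z\sim N(0,1)$.
   Context: The $p$-tensor Curie–Weiss model on $\{-1,1\}^N$: $\mathbb P_{\beta,h,p}(\bm X)=\frac{1}{2^NZ_N(\beta,h,p)}\exp\{N(\beta\bar X_N^p+h\bar X_N)\}$ with $\bar X_N=N^{-1}\sum_iX_i$, $(\beta,h)\in\mathbb R^2$; $\Theta=[0,\infty)\times\mathbb R$. $I(x)=\frac12[(1+x)\log(1+x)+(1-x)\log(1-x)]$, $H_{\beta,h,p}(x)=\beta x^p+hx-I(x)$ on $[-1,1]$. $(\beta,h)$ is $p$-critical if $H_{\beta,h,p}$ has more than one global maximizer (points attaining $\sup_{[-1,1]}H$); these lie in $(-1,1)$ with $H''<0$. $\tilde\beta_p=\sup\{\beta\ge0:\sup_{x\in[-1,1]}H_{\beta,0,p}(x)=0\}$. For known $h$, $\hat\beta_N$ is the maximum likelihood estimate of $\beta$ over $\mathbb R$, the solution of $\mathbb E_{\beta,h,p}(\bar X_N^p)=\bar X_N^p$. $N^+(0,\sigma^2)$, $N^-(0,\sigma^2)$ are the laws of $|Z|$, $-|Z|$ for $Z\sim N(0,\sigma^2)$;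 sums denote mixtures; convergence with atoms at $\pm\infty$ is weak convergence on $[-\infty,\infty]$. *)

(* Defs.v *)
From Stdlib Require Import Reals Lra List ClassicalEpsilon Arith.
From Coquelicot Require Import Coquelicot.
Open Scope R_scope.

(* I(x) = 1/2 [(1+x)log(1+x) + (1-x)log(1-x)]; at x = +-1 the term 0*log 0 is 0
   (Stdlib's ln is 0 on nonpositive arguments, so 0 * ln 0 = 0). *)
Definition Ifun (x : R) : R :=
  / 2 * ((1 + x) * ln (1 + x) + (1 - x) * ln (1 - x)).

Definition Hfun (p : nat) (beta h : R) (x : R) : R :=
  beta * x ^ p + h * x - Ifun x.

Definition H2 (p : nat) (beta h : R) (x : R) : R := Derive_n (Hfun p beta h) 2 x.

Definition is_global_max (p : nat) (beta h : R) (x : R) : Prop :=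
  -1 <= x <= 1 /\ forall y, -1 <= y <= 1 -> Hfun p beta h y <= Hfun p beta h x.

Definition p_critical (p : nat) (beta h : R) : Prop :=
  0 <= beta /\ exists x y, x <> y /\ is_global_max p beta h x /\ is_global_max p beta h y.

Definition supH0 (p : nat) (beta : R) : Rbar :=
  Lub_Rbar (fun v => exists x, -1 <= x <= 1 /\ v = Hfun p beta 0 x).

Definition beta_tilde (p : nat) : R :=
  real (Lub_Rbar (fun b => 0 <= b /\ supH0 p b = Finite 0)).

Fixpoint configs (N : nat) : list (list R) :=
  match N with
  | O => nil :: nil
  | S n => map (cons 1) (configs n) ++ map (cons (-1)) (configs n)
  end.

Definition sumR (l : list R) : R := fold_right Rplus 0 l.

Definition mean (N : nat) (s : list R) : R := sumR s / INR N.

Definition boltz (p : nat) (beta h : R) (N : nat) (s : list R) : R :=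
  exp (INR N * (beta * mean N s ^ p + h * mean N s)).

Definition ZN (p : nat) (beta h : R) (N : nat) : R :=
  / 2 ^ N * sumR (map (boltz p beta h N) (configs N)).

Definition prob (p : nat) (beta h : R) (N : nat) (s : list R) : R :=
  boltz p beta h N s / (2 ^ N * ZN p beta h N).

Definition Emodel (p : nat) (beta h : R) (N : nat) (F : list R -> R) : R :=
  sumR (map (fun s => prob p beta h N s * F s) (configs N)).

(* hat beta_N is the solution b in R of E_{b,h,p}(bar X^p) = bar X^p; when no
   real solution exists (bar X^p at an extreme value), the MLE is -oo / +oo. *)
Definition betahat (p : nat) (h : R) (N : nat) (s : list R) : Rbar :=
  let t := mean N s ^ p in
  match excluded_middle_informative
          (exists b, Emodel p b h N (fun s' => mean N s' ^ p) = t) with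
  | left H => Finite (proj1_sig (constructive_indefinite_description _ H))
  | right _ =>
      if Rle_dec t (Emodel p 0 h N (fun s' => mean N s' ^ p)) then m_infty
      else p_infty
  end.

Definition scaled_err (p : nat) (beta h : R) (N : nat) (s : list R) : Rbar :=
  Rbar_mult (sqrt (INR N)) (Rbar_minus (betahat p h N s) beta).

(* A continuous function on the compact [-oo,oo] is a continuous g : R -> R
   with finite limits lm at -oo and lp at +oo; its extension: *)
Definition ext (g : R -> R) (lm lp : R) (y : Rbar) : R :=
  match y with
  | Finite r => g r
  | p_infty => lp
  | m_infty => lm
  end.

Definition gauss_int (f : R -> R) : R :=
  RInt_gen (fun z => f z * (exp (- z ^ 2 / 2) / sqrt (2 * PI)))
           (Rbar_locally m_infty) (Rbar_locally p_infty).

Inductive comp : Type :=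
  | Dirac (a : Rbar)
  | Normal (s2 : R)
  | HalfPos (s2 : R)
  | HalfNeg (s2 : R).

Definition comp_int (c : comp) (g : R -> R) (lm lp : R) : R :=
  match c with
  | Dirac a => ext g lm lp a
  | Normal s2 => gauss_int (fun z => g (sqrt s2 * z))
  | HalfPos s2 => gauss_int (fun z => g (Rabs (sqrt s2 * z)))
  | HalfNeg s2 => gauss_int (fun z => g (- Rabs (sqrt s2 * z)))
  end.

Definition mix_int (mu : list (R * comp)) (g : R -> R) (lm lp : R) : R :=
  sumR (map (fun wc => fst wc * comp_int (snd wc) g lm lp) mu).

Definition converges_to (p : nat) (beta h : R) (mu : list (R * comp)) : Prop :=
  forall (g : R -> R) (lm lp : R),
    (forall x, continuous g x) ->
    is_lim g m_infty (Finite lm) -> is_lim g p_infty (Finite lp) ->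
    is_lim_seq
      (fun N => Emodel p beta h N (fun s => ext g lm lp (scaled_err p beta h N s)))
      (Finite (mix_int mu g lm lp)).

Definition cst (p : nat) (beta h : R) (m : R) : R :=
  / sqrt ((m ^ 2 - 1) * H2 p beta h m).

(* p_k (k is 1-based) for the maximizers list ms = [m_1; ...; m_K] *)
Definition pk (p : nat) (beta h : R) (ms : list R) (k : nat) : R :=
  cst p beta h (nth (k - 1) ms 0) / sumR (map (cst p beta h) ms).

Definition sigma2 (p : nat) (beta h : R) (m : R) : R :=
  - H2 p beta h m / (INR p ^ 2 * m ^ (2 * p - 2)).

Definition gamma_p (p : nat) : R :=
  gauss_int (fun z => if Rle_dec (z ^ p) (gauss_int (fun u => u ^ p)) then 1 else 0).

(* Main.v *)
Require Import Defs.
From Stdlib Require Import Reals List Arith Sorted.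
From Stdlib Require Import Lra Lia ClassicalEpsilon Classical.
From Coquelicot Require Import Coquelicot.
Open Scope R_scope.

(** The map b |-> E_{b,h}(Xbar^p) is continuous and strictly increasing for N >= 2, so
    sqrt N (betahat - beta) <= t iff Xbar^p <= a_N(t), where a_N(t) is the mean of Xbar^p
    at inverse temperature beta + t / sqrt N.  By Stirling's formula and Laplace's method,
    Xbar is asymptotically a mixture of Gaussians of scale 1 / sqrt N around the
    maximizers m_k with weights p_k.  A tilt t <> 0 selects the maximizers with the
    largest t m^p, so sqrt N (a_N(t) - m^p) -> t (p m^(p-1))^2 / (- H''(m)) for such m <> 0,
    while N^(p/2) a_N(t) -> E Z^p when 0 is selected.  Writing z for the normalised fluctuation of
    Xbar around m_k, the error sqrt N (betahat - beta) is thus asymptotically a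
    deterministic function of z on each well: a line, the positive or negative part of
    one, or, at 0, the value -oo or 0 according to whether z^p <= E Z^p.

    The binomial weights enter only through ratios, so the constant A in Stirling's
    formula is never evaluated.  The multiplicity of the maximizers is controlled by the
    sign of H'', governed by x^(p-2) (1 - x^2), which is unimodal on [0, 1]. *)

(** * Improper integrals over the line and the Gaussian integral *)

(** For each fixed t <> 0, the event [err_at <= t] near a maximizer is decided by comparing x^p with
    the level a_N(t). Nonzero t are dense, so this pins the error to a function of z without
    inverting the level; t = 0 is avoided because there no well is selected.

    The atoms come from jumps of the level. When t changes sign, a_N(t) leaves one p-th power for
    another; the points of a well lying on the side of the gap are squeezed between all t < 0 and
    all t > 0, so their error vanishes. They form half of a Gaussian, hence the mass 1/2. At m = 0
    the slope of x^p vanishes, the tilt t sqrt N x^p is negligible, the level is to leading order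
    the same for all t < 0, and the points below it are sent to -oo.

    The limit function can therefore jump, and sums are passed to the limit by a dominated
    convergence theorem for Riemann sums that tolerates two exceptional points. Its majorants are
    built on 1 / (1 + z^2), whose primitive is explicit. Dividing the entropy out of the binomial
    coefficient leaves weights of order 1 / sqrt N, the order of the mesh. *)

Definition is_RIntR (F : R -> R) (J : R) : Prop :=
  is_RInt_gen F (Rbar_locally m_infty) (Rbar_locally p_infty) J.

Lemma RInt_Chasles_R (F : R -> R) (a b c : R) :
  (forall u v, ex_RInt F u v) -> RInt F a b + RInt F b c = RInt F a c.
Proof. intros H. apply (RInt_Chasles F a b c); auto. Qed.

Lemma is_RIntR_of_limits (F : R -> R) (L1 L2 : R) :
  (forall a b, ex_RInt F a b) ->
  is_lim (fun b => RInt F 0 b) p_infty L1 ->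
  is_lim (fun a => RInt F 0 a) m_infty L2 ->
  is_RIntR F (L1 - L2).
Proof.
  intros Hex H1 H2.
  unfold is_RIntR, is_RInt_gen.
  apply filterlimi_lim_ext_loc with (f := fun ab => RInt F 0 (snd ab) - RInt F 0 (fst ab)).
  { apply filter_forall. intros [a b]; simpl.
    replace (RInt F 0 b - RInt F 0 a) with (RInt F a b).
    - apply (RInt_correct F a b), Hex.
    - rewrite <- (RInt_Chasles_R F 0 a b) by apply Hex. lra. }
  apply (filterlim_comp_2 (G := locally L1) (H := locally (opp L2))
     (fun ab => RInt F 0 (snd ab)) (fun ab => opp (RInt F 0 (fst ab))) plus).
  - eapply filterlim_comp. apply filterlim_snd. exact H1.
  - eapply filterlim_comp. eapply filterlim_comp. apply filterlim_fst. exact H2.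
    apply (filterlim_opp L2).
  - apply (filterlim_plus L1 (opp L2)).
Qed.

Lemma is_RIntR_lim_seq (F : R -> R) (J : R) (a b : nat -> R) :
  is_RIntR F J -> is_lim_seq a m_infty -> is_lim_seq b p_infty ->
  is_lim_seq (fun n => RInt F (a n) (b n)) J.
Proof.
  intros HF Ha Hb P HP.
  destruct (HF P HP) as [Q S HQ HS H].
  specialize (Ha Q HQ). specialize (Hb S HS).
  unfold filtermap in *. generalize (filter_and _ _ Ha Hb).
  apply filter_imp. intros n [h1 h2]. destruct (H _ _ h1 h2) as [y [Hy1 Hy2]].
  simpl in Hy1. rewrite (is_RInt_unique _ _ _ _ Hy1). exact Hy2.
Qed.

Lemma ex_RInt_cont (F : R -> R) (a b : R) : (forall x, continuous F x) -> ex_RInt F a b.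
Proof. intros H. apply (ex_RInt_continuous F). intros; apply H. Qed.

Lemma is_derive_atan_kernel (x : R) : is_derive atan x (/ (1 + x ^ 2)).
Proof. auto_derive; auto. field. nra. Qed.

Lemma continuous_kernel (x : R) : continuous (fun x => / (1 + x ^ 2)) x.
Proof. apply (ex_derive_continuous (fun x => / (1 + x ^ 2))). auto_derive. nra. Qed.

Lemma is_RInt_kernel (D a b : R) :
  is_RInt (fun x => D / (1 + x ^ 2)) a b (D * (atan b - atan a)).
Proof.
  apply (is_RInt_scal (fun x => / (1 + x ^ 2)) a b D (atan b - atan a)).
  apply (is_RInt_derive atan (fun x => / (1 + x ^ 2))).
  - intros; apply is_derive_atan_kernel.
  - intros; apply continuous_kernel.
Qed.

(** The majorant has the bounded primitive [D * atan], so tails of dominated integrals are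
    controlled by increments of atan. *)
Lemma RInt_kernel_le (F : R -> R) (D a b : R) :
  (forall u v, ex_RInt F u v) -> (forall x, Rabs (F x) <= D / (1 + x ^ 2)) -> a <= b ->
  Rabs (RInt F a b) <= D * (atan b - atan a).
Proof.
  intros Hc Hd Hab.
  rewrite <- (is_RInt_unique _ _ _ _ (is_RInt_kernel D a b)).
  apply Rle_trans with (RInt (fun x => Rabs (F x)) a b).
  - apply abs_RInt_le; auto.
  - apply RInt_le; auto.
    + apply (ex_RInt_norm F). auto.
    + exists (D * (atan b - atan a)). apply is_RInt_kernel.
Qed.

Lemma atan_lim_p : is_lim atan p_infty (PI / 2).
Proof.
  apply filterlim_locally. intros eps.
  pose proof PI_RGT_0 as Hpi.
  set (e := Rmin eps (PI/2)).
  assert (He : 0 < e) by (unfold e; apply Rmin_pos; [apply cond_pos|lra]).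
  assert (He2 : e <= PI/2) by (unfold e; apply Rmin_r).
  assert (He1 : e <= eps) by (unfold e; apply Rmin_l).
  exists (tan (PI/2 - e)). intros x Hx.
  pose proof (atan_bound x) as [_ Hb].
  assert (PI/2 - e < atan x).
  { rewrite <- (atan_tan (PI/2 - e)) by lra. apply atan_increasing, Hx. }
  change (Rabs (atan x - PI/2) < eps). apply Rabs_def1; lra.
Qed.

Lemma atan_lim_m : is_lim atan m_infty (- (PI / 2)).
Proof.
  apply is_lim_ext with (fun x => - atan (- x)).
  { intros; rewrite atan_opp; ring. }
  apply (is_lim_opp (fun x => atan (- x)) m_infty (PI/2)).
  apply is_lim_comp with p_infty.
  - apply atan_lim_p.
  - apply (is_lim_opp (fun x => x) m_infty m_infty). apply is_lim_id.
  - exists 0. intros; discriminate.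
Qed.

(** Cauchy's criterion: between two points where atan is close to its limit, the integral changes by
    at most [D] times a small increment. The end [L] is abstract to serve both infinities. *)
Lemma ex_lim_dominated (F : R -> R) (D : R) (L : Rbar) (l0 : R) :
  (forall a b, ex_RInt F a b) -> (forall x, Rabs (F x) <= D / (1 + x ^ 2)) ->
  is_lim atan L l0 ->
  exists J : R, is_lim (fun b => RInt F 0 b) L J.
Proof.
  intros Hc Hd Hl.
  apply (filterlim_locally_cauchy (F := Rbar_locally' L) (fun b => RInt F 0 b)).
  assert (D0 : 0 <= D).
  { specialize (Hd 0). pose proof (Rabs_pos (F 0)). replace (D / (1 + 0^2)) with D in Hd by field. lra. }
  intros eps.
  (* [D + 1] keeps the tolerance meaningful when [D = 0]. *)
  assert (He : 0 < eps / (2 * (D + 1))) by (apply Rdiv_lt_0_compat; [apply cond_pos|lra]).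
  exists (fun x => Rabs (atan x - l0) < eps / (2 * (D+1))). split.
  - apply (Hl (fun y => Rabs (y - l0) < eps / (2 * (D+1)))).
    exists (mkposreal _ He). intros y Hy. exact Hy.
  - assert (Hw : forall u v, u <= v -> Rabs (atan u - l0) < eps / (2 * (D+1)) ->
       Rabs (atan v - l0) < eps / (2 * (D+1)) -> Rabs (RInt F u v) < eps).
    { intros u v Huv Hu Hv.
      pose proof (RInt_kernel_le F D u v Hc Hd Huv).
      apply Rabs_def2 in Hu. apply Rabs_def2 in Hv.
      assert (atan v - atan u < 2 * (eps / (2 * (D+1)))) by lra.
      assert (D * (2 * (eps / (2 * (D+1)))) < eps).
      { replace (D * (2 * (eps / (2 * (D+1))))) with (eps - eps / (D+1)) by (field; lra).
        assert (0 < eps / (D+1)) by (apply Rdiv_lt_0_compat; [apply cond_pos|lra]). lra. }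
      nra. }
    intros u v Hu Hv.
    change (Rabs (RInt F 0 v - RInt F 0 u) < eps).
    destruct (Rle_dec u v) as [h|h].
    + replace (RInt F 0 v - RInt F 0 u) with (RInt F u v); [auto|].
      rewrite <- (RInt_Chasles_R F 0 u v) by apply Hc. lra.
    + replace (RInt F 0 v - RInt F 0 u) with (- RInt F v u).
      rewrite Rabs_Ropp. apply Hw; auto; lra.
      rewrite <- (RInt_Chasles_R F 0 v u) by apply Hc. lra.
Qed.

Lemma ex_RIntR_dominated (F : R -> R) (D : R) :
  (forall a b, ex_RInt F a b) -> (forall x, Rabs (F x) <= D / (1 + x ^ 2)) ->
  exists J, is_RIntR F J.
Proof.
  intros Hex Hd.
  destruct (ex_lim_dominated F D p_infty (PI/2) Hex Hd atan_lim_p) as [J1 H1].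
  destruct (ex_lim_dominated F D m_infty (-(PI/2)) Hex Hd atan_lim_m) as [J2 H2].
  exists (J1 - J2). apply is_RIntR_of_limits; auto.
Qed.

(** * The Gaussian integral *)

Definition gexp (x : R) : R := exp (- x ^ 2 / 2).

Lemma continuous_gexp (x : R) : continuous gexp x.
Proof. apply (ex_derive_continuous gexp). unfold gexp. auto_derive. auto. Qed.

Lemma exp_mono (x y : R) : x <= y -> exp x <= exp y.
Proof. intros [H| ->]. left; apply exp_increasing; auto. right; auto. Qed.

Lemma exp_le_inv (x : R) : 0 <= x -> exp (- x) <= / (1 + x).
Proof.
  intros H. rewrite exp_Ropp. apply Rinv_le_contravar; [lra|]. destruct (Req_dec x 0).
  - subst. rewrite exp_0. lra.
  - left. apply exp_ineq1; auto.
Qed.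

Lemma gexp_dom (x : R) : Rabs (gexp x) <= 2 / (1 + x ^ 2).
Proof.
  unfold gexp. rewrite Rabs_right by (left; apply exp_pos).
  replace (- x ^ 2 / 2) with (- (x ^ 2 / 2)) by field.
  eapply Rle_trans. apply exp_le_inv. nra.
  unfold Rdiv. apply Rmult_le_reg_r with ((1 + x^2/2) * (1 + x^2)). nra.
  replace (/ (1 + x ^ 2 * / 2) * ((1 + x ^ 2 / 2) * (1 + x ^ 2))) with (1 + x^2) by (field; nra).
  replace (2 * / (1 + x ^ 2) * ((1 + x ^ 2 / 2) * (1 + x ^ 2))) with (2 + x^2) by (field; nra).
  nra.
Qed.

(* The sum of [RInt gexp 0 t ^ 2] and the integral below has derivative 0 in [t]: this evaluates the Gaussian integral. *)
Lemma gauss_aux_const (t : R) :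
  (RInt gexp 0 t) ^ 2 + RInt (fun x => 2 * exp (- t ^ 2 * (1 + x ^ 2) / 2) / (1 + x ^ 2)) 0 1 = PI / 2.
Proof.
  set (h := fun t => RInt (fun x => 2 * exp (- t ^ 2 * (1 + x ^ 2) / 2) / (1 + x ^ 2)) 0 1).
  set (g := fun t => (RInt gexp 0 t) ^ 2 + h t).
  assert (Hh : forall t, is_derive h t (- 2 * t * exp (- t ^ 2 / 2) * RInt (fun x => gexp (t * x)) 0 1)).
  { intros y.
    assert (HD : forall z v, Derive (fun z : R => 2 * exp (- z ^ 2 * (1 + v ^ 2) / 2) / (1 + v ^ 2)) z
        = - 2 * z * exp (- z ^ 2 * (1 + v ^ 2) / 2)).
    { intros z v. apply is_derive_unique. auto_derive. nra. replace (- z ^ 2 * (1 + v ^ 2) / 2) with (- (z * (z * 1)) * (1 + v * (v * 1)) * / 2) by field. field. nra. }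
    assert (HcV : forall z, ex_RInt (fun x => 2 * exp (- z ^ 2 * (1 + x ^ 2) / 2) / (1 + x ^ 2)) 0 1).
    { intros z. apply ex_RInt_cont. intros x.
      apply (ex_derive_continuous (fun x => 2 * exp (- z ^ 2 * (1 + x ^ 2) / 2) / (1 + x ^ 2))).
      auto_derive. nra. }
    evar_last.
    - apply is_derive_RInt_param.
      + apply filter_forall. intros z v _. auto_derive. nra.
      + intros v _.
        apply continuity_2d_pt_ext with (fun u v => (- 2 * u) * exp (- u ^ 2 * (1 + v ^ 2) / 2)).
        { intros u w. rewrite HD. reflexivity. }
        apply continuity_2d_pt_mult.
        * apply continuity_2d_pt_mult. apply continuity_2d_pt_const. apply continuity_2d_pt_id1.
        * apply (continuity_1d_2d_pt_comp exp (fun u v => - u ^ 2 * (1 + v ^ 2) / 2)).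
          apply derivable_continuous_pt, derivable_pt_exp.
          apply continuity_2d_pt_mult.
          2: apply continuity_2d_pt_const.
          apply continuity_2d_pt_mult.
          -- apply continuity_2d_pt_opp. apply (continuity_1d_2d_pt_comp (fun u => u ^ 2) (fun u v => u)).
             apply derivable_continuous_pt, derivable_pt_pow. apply continuity_2d_pt_id1.
          -- apply continuity_2d_pt_plus. apply continuity_2d_pt_const.
             apply (continuity_1d_2d_pt_comp (fun u => u ^ 2) (fun u v => v)).
             apply derivable_continuous_pt, derivable_pt_pow. apply continuity_2d_pt_id2.
      + apply filter_forall. apply HcV.
    - etransitivity. 2: apply (RInt_scal (fun x => gexp (y * x)) 0 1 (-2 * y * exp (- y^2/2))).
      + apply RInt_ext. intros x _. rewrite HD. change (-2 * y * exp (- y ^ 2 * (1 + x ^ 2) / 2) = -2 * y * exp (- y ^ 2 / 2) * exp (- (y * x) ^ 2 / 2)).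
        replace (- y ^ 2 * (1 + x ^ 2) / 2) with (- y ^ 2 / 2 + - (y * x) ^ 2 / 2) by field.
        rewrite exp_plus. ring.
      + apply ex_RInt_cont. intros x. apply (ex_derive_continuous (fun x => gexp (y * x))).
        unfold gexp. auto_derive. auto. }
  assert (HG : forall t, is_derive (fun t => RInt gexp 0 t) t (gexp t)).
  { intros y. apply (is_derive_RInt gexp (fun t => RInt gexp 0 t) 0 y).
    - apply filter_forall. intros z. apply (RInt_correct gexp), ex_RInt_cont, continuous_gexp.
    - apply continuous_gexp. }
  (* The substitution x -> t x makes the derivative of the correction integral the exact opposite of
     that of the square. *)
  assert (Hs : forall t, t * RInt (fun x => gexp (t * x)) 0 1 = RInt gexp 0 t).
  { intros y.
    pose proof (RInt_comp_lin gexp y 0 0 1) as H.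
    rewrite Rmult_0_r, Rplus_0_r, Rmult_1_r, Rplus_0_r in H.
    rewrite <- H by (apply ex_RInt_cont, continuous_gexp).
    symmetry. etransitivity. 2: apply (RInt_scal (fun x => gexp (y * x)) 0 1 y).
    - apply RInt_ext. intros x _. rewrite Rplus_0_r. reflexivity.
    - apply ex_RInt_cont. intros x. apply (ex_derive_continuous (fun x => gexp (y * x))).
      unfold gexp. auto_derive. auto. }
  assert (Hg : forall t, is_derive g t 0).
  { intros y. unfold g.
    evar_last. apply (is_derive_plus (fun t => RInt gexp 0 t ^ 2) h).
    - apply (is_derive_pow (fun t => RInt gexp 0 t) 2). apply HG.
    - apply Hh.
    - unfold plus; simpl. fold (gexp y).
      rewrite <- (Hs y). unfold gexp; simpl. ring. }
  change (g t = PI/2).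
  (* At t = 0 only 2 / (1 + x^2) remains, whose integral over [0, 1] is 2 atan 1. *)
  assert (H0 : g 0 = PI / 2).
  { unfold g, h.
    replace (RInt gexp 0 0) with 0 by (symmetry; apply (RInt_point 0 gexp)).
    rewrite (RInt_ext _ (fun x => 2 / (1 + x^2))).
    - rewrite (is_RInt_unique _ _ _ _ (is_RInt_kernel 2 0 1)). rewrite atan_1, atan_0. field.
    - intros x _. replace (- 0 ^ 2 * (1 + x ^ 2) / 2) with 0 by field. rewrite exp_0.
      apply Rmult_eq_compat_r with (r := / (1 + x ^ 2)). ring. }
  rewrite <- H0.
  destruct (MVT_gen g 0 t (fun _ => 0)) as [c [_ Hc]].
  - intros; apply Hg.
  - intros x _. apply derivable_continuous_pt. exists 0. apply is_derive_Reals, Hg.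
  - rewrite Rmult_0_l in Hc. lra.
Qed.

Lemma RInt_gexp_pos (t : R) : 0 <= t -> 0 <= RInt gexp 0 t.
Proof.
  intros H. apply RInt_ge_0; auto. apply ex_RInt_cont, continuous_gexp.
  intros; left; apply exp_pos.
Qed.

(** Domination gives a limit [J]. The correction integral of [gauss_aux_const] is at most 4 / t for
    t > 1, because exp (- u) <= 1 / (1 + u), so J^2 = PI / 2, and positivity selects the root. *)
Lemma gexp_half_lim : is_lim (fun t => RInt gexp 0 t) p_infty (sqrt (PI / 2)).
Proof.
  assert (Hex : forall a b, ex_RInt gexp a b) by (intros; apply ex_RInt_cont, continuous_gexp).
  destruct (ex_lim_dominated gexp 2 p_infty (PI/2) Hex gexp_dom atan_lim_p) as [J HJ].
  assert (HJ2 : is_lim (fun t => RInt gexp 0 t ^ 2) p_infty (J ^ 2)).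
  { apply is_lim_ext with (fun t => RInt gexp 0 t * RInt gexp 0 t). intros; ring.
    replace (J^2) with (J * J) by ring.
    apply (is_lim_mult _ _ p_infty J J HJ HJ). reflexivity. }
  assert (H2 : is_lim (fun t => RInt gexp 0 t ^ 2) p_infty (PI / 2)).
  { apply is_lim_ext with (fun t => PI/2 - RInt (fun x => 2 * exp (- t ^ 2 * (1 + x ^ 2) / 2) / (1 + x ^ 2)) 0 1).
    { intros t. rewrite <- (gauss_aux_const t). ring. }
    replace (Finite (PI/2)) with (Finite (PI/2 - 0)) by (f_equal; ring).
    apply (is_lim_minus' (fun _ => PI/2)). apply is_lim_const.
    apply (is_lim_le_le_loc (fun _ => 0) (fun t => 2 * (2 * / t))).
    - exists 1. intros t Ht.
      assert (Hc : ex_RInt (fun x => 2 * exp (- t ^ 2 * (1 + x ^ 2) / 2) / (1 + x ^ 2)) 0 1).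
      { apply ex_RInt_cont. intros x.
        apply (ex_derive_continuous (fun x => 2 * exp (- t ^ 2 * (1 + x ^ 2) / 2) / (1 + x ^ 2))).
        auto_derive. nra. }
      assert (Hb : forall x, 0 <= 2 * exp (- t ^ 2 * (1 + x ^ 2) / 2) / (1 + x ^ 2) <= 2 * (2 * / t)).
      { intros x. split.
        - apply Rdiv_le_0_compat. pose proof (exp_pos (- t ^ 2 * (1 + x ^ 2) / 2)). lra. nra.
        - assert (exp (- t ^ 2 * (1 + x ^ 2) / 2) <= 2 * / t).
          { replace (- t ^ 2 * (1 + x ^ 2) / 2) with (- (t ^ 2 * (1 + x ^ 2) / 2)) by field.
            eapply Rle_trans. apply exp_le_inv. nra.
            replace (2 * / t) with (/ (t / 2)) by (field; lra).
            apply Rinv_le_contravar. lra. nra. }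
          pose proof (exp_pos (- t ^ 2 * (1 + x ^ 2) / 2)).
          apply Rmult_le_reg_r with (1 + x^2). nra.
          unfold Rdiv. rewrite Rmult_assoc, Rinv_l by nra.
          assert (0 <= / t) by (left; apply Rinv_0_lt_compat; lra). nra. }
      split.
      + apply RInt_ge_0; auto. lra. intros x _. apply Hb.
      + eapply Rle_trans. apply Rle_abs.
        eapply Rle_trans. apply (abs_RInt_le_const _ 0 1 (2 * (2 * / t))); auto. lra.
        intros x _. rewrite Rabs_right. apply Hb. apply Rle_ge, Hb. lra.
    - apply is_lim_const.
    - replace (Finite 0) with (Rbar_mult 2 (Rbar_mult 2 0)) by (simpl; f_equal; ring).
      apply is_lim_scal_l. apply is_lim_scal_l.
      apply (is_lim_inv (fun x => x) p_infty p_infty). apply is_lim_id. discriminate. }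
  assert (E : J ^ 2 = PI / 2).
  { apply is_lim_unique in HJ2. apply is_lim_unique in H2. congruence. }
  assert (0 <= J).
  { apply (is_lim_le_loc (fun _ => 0) (fun t => RInt gexp 0 t) p_infty 0 J); auto.
    - exists 0. intros; apply RInt_gexp_pos; lra.
    - apply is_lim_const. }
  rewrite <- E. rewrite sqrt_pow2; auto.
Qed.

Lemma is_RIntR_opp_arg (F : R -> R) (J : R) :
  is_RIntR F J -> is_RIntR (fun x => F (- x)) J.
Proof.
  intros H P HP. destruct (H P HP) as [Q S [q Hq] [s Hs] HQS].
  apply Filter_prod with (Q := fun x => S (- x)) (R := fun x => Q (- x)).
  - exists (- s). intros x Hx. apply Hs. lra.
  - exists (- q). intros x Hx. apply Hq. lra.
  - intros x y Hx Hy. destruct (HQS _ _ Hy Hx) as [z [Hz1 Hz2]]. exists z. split; auto.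
    simpl in *. apply is_RInt_swap in Hz1.
    apply is_RInt_comp_opp in Hz1. apply is_RInt_opp in Hz1.
    rewrite opp_opp in Hz1.
    eapply is_RInt_ext. 2: apply Hz1. intros; simpl. rewrite opp_opp. reflexivity.
Qed.

Lemma sqrt_half_pi : 2 * sqrt (PI / 2) = sqrt (2 * PI).
Proof.
  replace (2 * PI) with (4 * (PI / 2)) by field.
  pose proof PI_RGT_0.
  rewrite sqrt_mult by lra. replace 4 with (2 ^ 2) by ring. rewrite sqrt_pow2; lra.
Qed.

Lemma gexp_int : is_RIntR gexp (sqrt (2 * PI)).
Proof.
  replace (sqrt (2 * PI)) with (sqrt (PI/2) - (- sqrt (PI/2))) by (rewrite <- sqrt_half_pi; ring).
  apply is_RIntR_of_limits.
  - intros; apply ex_RInt_cont, continuous_gexp.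
  - apply gexp_half_lim.
  - apply is_lim_ext with (fun t => - RInt gexp 0 (- t)).
    + intros t.
      assert (H : is_RInt gexp 0 (- t) (- RInt gexp 0 t)).
      { assert (Hc : ex_RInt gexp 0 t) by apply ex_RInt_cont, continuous_gexp.
        apply (RInt_correct gexp) in Hc.
        rewrite <- Ropp_0 in Hc at 1. rewrite <- (Ropp_involutive t) in Hc at 1.
        apply is_RInt_comp_opp, is_RInt_opp in Hc.
        eapply is_RInt_ext. 2: apply Hc. intros; simpl. rewrite opp_opp.
        unfold gexp. f_equal. field. }
      rewrite (is_RInt_unique (V := R_CompleteNormedModule) gexp 0 (- t) _ H). ring.
    + apply (is_lim_opp (fun t => RInt gexp 0 (- t)) m_infty (sqrt (PI/2))).
      apply is_lim_comp with p_infty. apply gexp_half_lim.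
      * apply (is_lim_opp (fun x => x) m_infty m_infty). apply is_lim_id.
      * exists 0. intros; discriminate.
Qed.

(** * Riemann sums over the grid of magnetizations *)

(** Magnetization of a configuration with k plus spins among N. *)
Definition grid (N k : nat) : R := 2 * INR k / INR N - 1.
(** Fluctuation around [m] at scale 1 / sqrt N. The factor [s] is later sqrt (- H''(m)), which makes
    the limiting density standard Gaussian. *)
Definition zgrid (s m : R) (N k : nat) : R := s * sqrt (INR N) * (grid N k - m).

(** The joint limit N -> oo along grid points whose rescaled position approaches [z], encoded as a
    filter on pairs so that the limit calculus for products and continuous maps applies although k
    varies freely with N. *)
Definition grid_filter (s m z : R) (P : nat * nat -> Prop) : Prop :=
  exists d N0, 0 < d /\ forall N k, (N0 <= N)%nat -> (k <= N)%nat ->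
    Rabs (zgrid s m N k - z) < d -> P (N, k).

Global Instance grid_filter_filter (s m z : R) : Filter (grid_filter s m z).
Proof.
  split.
  - exists 1, 0%nat. split. lra. auto.
  - intros P Q [d [N0 [Hd H]]] [d' [N0' [Hd' H']]].
    exists (Rmin d d'), (max N0 N0'). split. apply Rmin_pos; auto.
    intros N k HN Hk Hz. split; [apply H|apply H']; auto; try lia.
    eapply Rlt_le_trans. apply Hz. apply Rmin_l.
    eapply Rlt_le_trans. apply Hz. apply Rmin_r.
  - intros P Q HPQ [d [N0 [Hd H]]]. exists d, N0. split; auto.
Qed.

Lemma is_lim_seq_inv_sqrt (c : R) : is_lim_seq (fun N => c / sqrt (INR N)) 0.
Proof.
  replace (Finite 0) with (Rbar_mult c 0) by (simpl; f_equal; ring).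
  apply is_lim_seq_scal_l.
  apply (is_lim_seq_inv (fun N => sqrt (INR N)) p_infty).
  - apply filterlim_comp with (Rbar_locally p_infty). apply is_lim_seq_INR. apply filterlim_sqrt_p.
  - discriminate.
Qed.

Lemma eventually_inv_sqrt (c e : R) : 0 < e ->
  exists N0, forall N, (N0 <= N)%nat -> Rabs (c / sqrt (INR N)) < e.
Proof.
  intros He.
  destruct (proj1 (filterlim_locally _ _) (is_lim_seq_inv_sqrt c) (mkposreal e He)) as [N0 H].
  exists N0. intros N HN. specialize (H N HN).
  change (Rabs (c / sqrt (INR N) - 0) < e) in H. rewrite Rminus_0_r in H. exact H.
Qed.

Lemma sqrt_INR_pos (N : nat) : (1 <= N)%nat -> 0 < sqrt (INR N).
Proof. intros H. apply sqrt_lt_R0, lt_0_INR. lia. Qed.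

Lemma zgrid_S (s m : R) (N k : nat) : (1 <= N)%nat ->
  zgrid s m N (S k) = zgrid s m N k + 2 * s / sqrt (INR N).
Proof.
  intros HN. pose proof (sqrt_INR_pos N HN) as H.
  assert (HI : 0 < INR N) by (apply lt_0_INR; lia).
  unfold zgrid, grid. rewrite S_INR.
  assert (E : INR N = sqrt (INR N) * sqrt (INR N)) by (rewrite sqrt_sqrt; lra).
  rewrite E at 2 4. field. lra.
Qed.

Lemma zgrid_lim_p (s m : R) : 0 < s -> m < 1 -> is_lim_seq (fun N => zgrid s m N N) p_infty.
Proof.
  intros Hs Hm.
  apply is_lim_seq_ext_loc with (fun N => (s * (1 - m)) * sqrt (INR N)).
  - exists 1%nat. intros N HN. unfold zgrid, grid. field. apply not_0_INR. lia.
  - replace p_infty with (Rbar_mult (s * (1 - m)) p_infty).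
    apply is_lim_seq_scal_l.
    apply filterlim_comp with (Rbar_locally p_infty). apply is_lim_seq_INR. apply filterlim_sqrt_p.
    apply is_Rbar_mult_unique. apply is_Rbar_mult_sym, is_Rbar_mult_p_infty_pos. simpl. nra.
Qed.

Lemma zgrid_lim_m (s m : R) : 0 < s -> -1 < m -> is_lim_seq (fun N => zgrid s m N 0) m_infty.
Proof.
  intros Hs Hm.
  apply is_lim_seq_ext_loc with (fun N => - ((s * (1 + m)) * sqrt (INR N))).
  - exists 1%nat. intros N HN. unfold zgrid, grid. simpl. field. apply not_0_INR. lia.
  - apply (is_lim_seq_opp _ p_infty).
    replace p_infty with (Rbar_mult (s * (1 + m)) p_infty).
    apply is_lim_seq_scal_l.
    apply filterlim_comp with (Rbar_locally p_infty). apply is_lim_seq_INR. apply filterlim_sqrt_p.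
    apply is_Rbar_mult_unique. apply is_Rbar_mult_sym, is_Rbar_mult_p_infty_pos. simpl. nra.
Qed.

(** Over a unit distance the kernel changes by at most a factor 3, so a bound at a grid point can be
    used throughout its cell. *)
Lemma kernel_shift (y z : R) : Rabs (z - y) <= 1 -> 1 + y ^ 2 <= 3 * (1 + z ^ 2).
Proof.
  intros H. apply Rabs_le_between in H.
  assert ((z - y) ^ 2 <= 1) by nra. pose proof (pow2_ge_0 (2 * z - y)). nra.
Qed.

(* Error density used to compare the grid sum with the integral cell by cell;
   its bumps at [r] and [- r] absorb the jumps of the limit function. *)
Definition cmp_density (e eta D r y : R) : R :=
  e / (1 + y ^ 2) + 20 * D * (eta ^ 2 / (eta ^ 2 + (y - r) ^ 2) + eta ^ 2 / (eta ^ 2 + (y + r) ^ 2)).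
Definition cmp_primitive (e eta D r y : R) : R :=
  e * atan y + 20 * D * eta * (atan ((y - r) / eta) + atan ((y + r) / eta)).

Lemma is_RInt_cmp_density (e eta D r a b : R) : 0 < eta ->
  is_RInt (cmp_density e eta D r) a b (cmp_primitive e eta D r b - cmp_primitive e eta D r a).
Proof.
  intros He.
  assert (P1 : forall x, 0 < 1 + x ^ 2) by (intros; nra).
  assert (P0 : 0 < eta ^ 2) by (apply pow_lt; auto).
  assert (P2 : forall x c, 0 < eta ^ 2 + (x + c) ^ 2).
  { intros x c. pose proof (pow2_ge_0 (x + c)). lra. }
  assert (P3 : forall x c, 0 < eta ^ 2 + (x - c) ^ 2).
  { intros x c. pose proof (pow2_ge_0 (x - c)). lra. }
  apply (is_RInt_derive (cmp_primitive e eta D r) (cmp_density e eta D r)).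
  - intros x _. unfold cmp_primitive, cmp_density. auto_derive; auto.
    specialize (P1 x). specialize (P2 x r). specialize (P3 x r).
    field. repeat split; nra.
  - intros x _. apply (ex_derive_continuous (cmp_density e eta D r)). unfold cmp_density. auto_derive.
    specialize (P1 x). specialize (P2 x r). specialize (P3 x r). simpl in *. repeat split; lra.
Qed.

Lemma cmp_primitive_osc (e eta D r a b : R) : 0 <= e -> 0 <= eta -> 0 <= D ->
  cmp_primitive e eta D r b - cmp_primitive e eta D r a <= (e + 40 * D * eta) * PI.
Proof.
  intros. unfold cmp_primitive.
  assert (0 <= D * eta) by nra.
  pose proof (atan_bound a). pose proof (atan_bound b).
  pose proof (atan_bound ((a-r)/eta)). pose proof (atan_bound ((b-r)/eta)).
  pose proof (atan_bound ((a+r)/eta)). pose proof (atan_bound ((b+r)/eta)).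
  assert (e * atan b <= e * (PI/2)) by nra.
  assert (e * atan a >= e * (- PI/2)) by nra.
  set (u1 := atan ((a-r)/eta)) in *. set (u2 := atan ((b-r)/eta)) in *.
  set (v1 := atan ((a+r)/eta)) in *. set (v2 := atan ((b+r)/eta)) in *.
  assert (D * eta * (u2 + v2 - u1 - v1) <= D * eta * (2 * PI)) by nra.
  nra.
Qed.

(** Three regimes: on [-M, M] away from the jumps, compactness makes the convergence uniform; beyond
    [M] the square in the majorant leaves a spare factor 1 / (1 + y^2); within [eta] of a jump the
    crude bound 10 D is absorbed by a bump. *)
Lemma grid_compare (s m r D : R) (f : nat -> nat -> R) (F : R -> R) (e eta : R) :
  0 < s -> 0 < e -> 0 < eta -> 0 <= D ->
  (forall z, z <> r -> z <> - r ->
     filterlim (fun q => f (fst q) (snd q)) (grid_filter s m z) (locally (F z))) ->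
  (forall z, z <> r -> z <> - r -> continuous F z) ->
  (forall N k, (1 <= N)%nat -> (k <= N)%nat -> Rabs (f N k) <= D / (1 + zgrid s m N k ^ 2) ^ 2) ->
  (forall z, Rabs (F z) <= D / (1 + z ^ 2) ^ 2) ->
  exists N0, (1 <= N0)%nat /\ forall N k y, (N0 <= N)%nat -> (k <= N)%nat ->
    Rabs (zgrid s m N k - y) <= 2 * s / sqrt (INR N) -> Rabs (f N k - F y) <= cmp_density e eta D r y.
Proof.
  intros Hs He Heta HD Hf HF Bf BF.
  (* Beyond this [M], 10 D / (1 + y^2)^2 is below e / (1 + y^2). *)
  set (M := 10 * D / e + 1).
  assert (HM : 1 <= M).
  { assert (0 <= 10 * D / e) by (apply Rdiv_le_0_compat; lra). unfold M; lra. }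
  (* The minimum of e / (1 + y^2) over [-M, M]. *)
  set (e' := e / (1 + M ^ 2)).
  assert (He' : 0 < e') by (apply Rdiv_lt_0_compat; nra).
  (* The radius [d] also encodes the threshold on [N], through 1 / d <= N, so a single compactness
     argument makes both uniform. *)
  set (Q := fun t d => forall N k y, 1 / d <= INR N -> (k <= N)%nat ->
     Rabs (y - t) < d -> Rabs (zgrid s m N k - y) < d ->
     Rabs (f N k - F y) < e' \/ Rabs (y - r) <= eta \/ Rabs (y + r) <= eta).
  assert (HQ : forall t, exists d : posreal, Q t d).
  { intros t. destruct (Req_dec t r) as [h1|h1]; [|destruct (Req_dec t (- r)) as [h2|h2]].
    - exists (mkposreal eta Heta). intros N k y _ _ Hy _. right; left. subst t. simpl in Hy. lra.
    - exists (mkposreal eta Heta). intros N k y _ _ Hy _. right; right. subst t. simpl in Hy.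
      replace (y + r) with (y - - r) by ring. lra.
    - assert (H2 : 0 < e' / 2) by lra.
      destruct (proj1 (filterlim_locally _ _) (Hf t h1 h2) (mkposreal _ H2)) as [d1 [N1 [Hd1 H1]]].
      destruct (proj1 (filterlim_locally _ _) (HF t h1 h2) (mkposreal _ H2)) as [d2 Hd2].
      set (d := Rmin (d1 / 2) (Rmin d2 (1 / (INR N1 + 1)))).
      pose proof (pos_INR N1) as HN1.
      assert (Hd : 0 < d).
      { unfold d. repeat apply Rmin_pos. lra. apply cond_pos. apply Rdiv_lt_0_compat; lra. }
      assert (A1 : d <= d1 / 2) by apply Rmin_l.
      assert (A2 : d <= d2) by (eapply Rle_trans; [apply Rmin_r|apply Rmin_l]).
      assert (A3 : d <= 1 / (INR N1 + 1)) by (eapply Rle_trans; [apply Rmin_r|apply Rmin_r]).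
      exists (mkposreal d Hd). intros N k y HN Hk Hy Hz. simpl in *. left.
      assert (HNN : (N1 <= N)%nat).
      { apply INR_le. assert (INR N1 + 1 <= 1 / d).
        { apply Rmult_le_reg_r with d; auto. replace (1 / d * d) with 1 by (field; lra).
          apply Rmult_le_reg_r with (/ (INR N1 + 1)). apply Rinv_0_lt_compat; lra.
          replace ((INR N1 + 1) * d * / (INR N1 + 1)) with d by (field; lra). lra. }
        lra. }
      assert (K1 : Rabs (f N k - F t) < e' / 2).
      { apply (H1 N k HNN Hk). replace (zgrid s m N k - t) with ((zgrid s m N k - y) + (y - t)) by ring.
        eapply Rle_lt_trans. apply Rabs_triang. lra. }
      assert (K2 : Rabs (F y - F t) < e' / 2).
      { apply Hd2. change (Rabs (y - t) < d2). lra. }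
      replace (f N k - F y) with ((f N k - F t) - (F y - F t)) by ring.
      eapply Rle_lt_trans. apply Rabs_triang. rewrite Rabs_Ropp. lra. }
  set (delta := fun t => proj1_sig (constructive_indefinite_description _ (HQ t))).
  assert (Hdel : forall t, Q t (delta t)).
  { intros t. unfold delta. destruct (constructive_indefinite_description _ (HQ t)); auto. }
  (* Each y in [-M, M] lies in a ball of the gauge whose radius is at least the common [d]. *)
  destruct (compactness_value_1d (- M) M delta) as [d Hd].
  pose proof (cond_pos d) as Hdpos.
  assert (Hmin : 0 < Rmin d 1) by (apply Rmin_pos; lra).
  destruct (eventually_inv_sqrt (2 * s) (Rmin d 1) Hmin) as [N1 HN1].
  destruct (nfloor_ex (1 / d)) as [N2 [_ HN2]].
  { left. apply Rdiv_lt_0_compat; lra. }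
  exists (max 1 (max N1 (S N2))). split. lia.
  intros N k y HN Hk Hzy.
  assert (H1N : (1 <= N)%nat) by lia.
  pose proof (sqrt_INR_pos N H1N) as Hsq.
  assert (Hdl : 2 * s / sqrt (INR N) < Rmin d 1).
  { eapply Rle_lt_trans. apply Rle_abs. apply HN1. lia. }
  assert (Hz1 : Rabs (zgrid s m N k - y) < d).
  { eapply Rle_lt_trans. apply Hzy. eapply Rlt_le_trans. apply Hdl. apply Rmin_l. }
  assert (Hz2 : Rabs (zgrid s m N k - y) <= 1).
  { eapply Rle_trans. apply Hzy. left. eapply Rlt_le_trans. apply Hdl. apply Rmin_r. }
  set (z := zgrid s m N k) in *.
  assert (Hy1 : 1 <= 1 + y ^ 2) by nra.
  assert (HfF : Rabs (f N k - F y) <= 10 * D / (1 + y ^ 2) ^ 2).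
  { eapply Rle_trans. apply Rabs_triang. rewrite Rabs_Ropp.
    specialize (Bf N k H1N Hk). specialize (BF y). fold z in Bf.
    (* The square of the factor 3 of [kernel_shift]; adding the bound on [F] itself gives the
       constant 10. *)
    assert (D / (1 + z ^ 2) ^ 2 <= 9 * D / (1 + y ^ 2) ^ 2).
    { pose proof (kernel_shift y z Hz2) as Hsh.
      replace (9 * D / (1 + y ^ 2) ^ 2) with (D / ((1 + y ^ 2) / 3) ^ 2) by (field; nra).
      apply Rmult_le_compat_l; auto. apply Rinv_le_contravar.
      apply pow_lt. lra. apply pow_incr. lra. }
    replace (10 * D / (1 + y^2)^2) with (9 * D / (1 + y^2)^2 + D / (1 + y^2)^2) by (field; nra).
    lra. }
  assert (B1 : forall c, 0 <= 20 * D * (eta ^ 2 / (eta ^ 2 + c ^ 2))).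
  { intros c. apply Rmult_le_pos. lra. apply Rdiv_le_0_compat; nra. }
  (* A bump is at least 1/2 within distance [eta] of its centre, hence the 20 in [cmp_density]. *)
  assert (B2 : forall c, Rabs c <= eta -> 10 * D <= 20 * D * (eta ^ 2 / (eta ^ 2 + c ^ 2))).
  { intros c Hc. assert (c ^ 2 <= eta ^ 2).
    { rewrite <- (pow2_abs c). apply pow_incr. split; [apply Rabs_pos|auto]. }
    assert (1 / 2 <= eta ^ 2 / (eta ^ 2 + c ^ 2)).
    { apply Rmult_le_reg_r with (eta ^ 2 + c ^ 2). nra.
      unfold Rdiv at 2. rewrite Rmult_assoc, Rinv_l by nra. nra. }
    nra. }
  assert (B0 : 0 < e / (1 + y ^ 2)) by (apply Rdiv_lt_0_compat; lra).
  assert (HfF2 : Rabs (f N k - F y) <= 10 * D).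
  { eapply Rle_trans. apply HfF. apply Rmult_le_reg_r with ((1 + y^2)^2). nra.
    unfold Rdiv. rewrite Rmult_assoc, Rinv_l by nra.
    apply Rmult_le_compat_l. lra. apply (pow_R1_Rle (1 + y ^ 2) 2). lra. }
  unfold cmp_density. rewrite Rmult_plus_distr_l.
  pose proof (B1 (y - r)). pose proof (B1 (y + r)).
  destruct (Rle_dec (Rabs y) M) as [hM|hM].
  - apply Rabs_le_between in hM.
    destruct (NNPP _ (Hd y hM)) as [t [Ht [Hyt Hdt]]].
    assert (Hinv : 1 / delta t <= INR N).
    { pose proof (cond_pos (delta t)).
      apply Rle_trans with (1 / d).
      - unfold Rdiv. rewrite !Rmult_1_l. apply Rinv_le_contravar; auto.
      - left. eapply Rlt_le_trans. apply HN2. rewrite <- S_INR. apply le_INR. lia. }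
    destruct (Hdel t N k y Hinv Hk Hyt) as [h|[h|h]].
    + fold z. lra.
    + assert (e' <= e / (1 + y ^ 2)).
      { unfold e'. apply Rmult_le_compat_l. lra. apply Rinv_le_contravar. lra. nra. }
      lra.
    + specialize (B2 _ h). lra.
    + specialize (B2 _ h). lra.
  - assert (10 * D / (1 + y ^ 2) ^ 2 <= e / (1 + y ^ 2)).
    { replace (10 * D / (1 + y ^ 2) ^ 2) with (10 * D / (1 + y^2) / (1 + y^2)) by (field; nra).
      apply Rmult_le_compat_r. left. apply Rinv_0_lt_compat. lra.
      assert (10 * D <= e * (1 + y ^ 2)).
      { assert (M * M <= y ^ 2). { rewrite <- (pow2_abs y). nra. }
        assert (e * M = 10 * D + e) by (unfold M; field; lra). nra. }
      apply Rmult_le_reg_r with (1 + y ^ 2). lra.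
      unfold Rdiv. rewrite Rmult_assoc, Rinv_l by nra. lra. }
    lra.
Qed.

(** Dominated convergence on a shrinking grid: the error of each cell is the increment of
    [cmp_primitive], and these increments telescope to a total that is small uniformly in N. *)
Lemma grid_dct (s m r D J : R) (f : nat -> nat -> R) (F : R -> R) :
  0 < s -> -1 < m < 1 ->
  (forall z, z <> r -> z <> - r ->
     filterlim (fun q => f (fst q) (snd q)) (grid_filter s m z) (locally (F z))) ->
  (forall z, z <> r -> z <> - r -> continuous F z) ->
  (forall a b, ex_RInt F a b) ->
  (forall N k, (1 <= N)%nat -> (k <= N)%nat -> Rabs (f N k) <= D / (1 + zgrid s m N k ^ 2) ^ 2) ->
  (forall z, Rabs (F z) <= D / (1 + z ^ 2) ^ 2) ->
  is_RIntR F J ->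
  is_lim_seq (fun N => sum_f_R0 (fun k => 2 * s / sqrt (INR N) * f N k) N) J.
Proof.
  intros Hs Hm Hf HF Hex Bf BF HJ.
  assert (HD : 0 <= D).
  { specialize (BF 0). pose proof (Rabs_pos (F 0)).
    replace (D / (1 + 0 ^ 2) ^ 2) with D in BF by field. lra. }
  assert (HL : is_lim_seq (fun N => RInt F (zgrid s m N 0) (zgrid s m N N)) J).
  { apply is_RIntR_lim_seq; auto. apply zgrid_lim_m; lra. apply zgrid_lim_p; lra. }
  apply is_lim_seq_spec. intros eps.
  pose proof (cond_pos eps) as Heps. pose proof PI_RGT_0 as Hpi.
  apply is_lim_seq_spec in HL.
  assert (H3 : 0 < eps / 3) by lra.
  destruct (HL (mkposreal _ H3)) as [N1 HN1]. simpl in HN1.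
  (* Used for both the accuracy and the bump width: the oscillation bound (e + 40 D e) PI is then
     eps / 3. *)
  set (e := eps / (3 * (1 + 40 * D) * PI)).
  assert (He : 0 < e).
  { apply Rdiv_lt_0_compat; auto. apply Rmult_lt_0_compat; lra. }
  destruct (grid_compare s m r D f F e e Hs He He HD Hf HF Bf BF) as [N2 [H21 HN2]].
  destruct (eventually_inv_sqrt (2 * s * D) _ H3) as [N3 HN3].
  exists (max N1 (max N2 N3)). intros N HN.
  set (dl := 2 * s / sqrt (INR N)).
  assert (HN' : (1 <= N)%nat) by lia.
  pose proof (sqrt_INR_pos N HN') as Hsq.
  assert (Hdl : 0 < dl) by (apply Rdiv_lt_0_compat; lra).
  (* Term k is compared with the cell on its left. Term 0 has no such cell and costs [dl * D], which
     vanishes with the mesh. *)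
  assert (Hind : forall n, (n <= N)%nat ->
     Rabs (sum_f_R0 (fun k => dl * f N k) n - RInt F (zgrid s m N 0) (zgrid s m N n))
       <= dl * D + (cmp_primitive e e D r (zgrid s m N n) - cmp_primitive e e D r (zgrid s m N 0))).
  { induction n as [|n IH]; intros Hn.
    - replace (RInt F (zgrid s m N 0) (zgrid s m N 0)) with 0 by (symmetry; apply (RInt_point _ F)).
      simpl. rewrite !Rminus_0_r, Rminus_diag, Rplus_0_r, Rabs_mult, (Rabs_right dl) by lra.
      apply Rmult_le_compat_l. lra. eapply Rle_trans. apply Bf; lia.
      apply Rmult_le_reg_r with ((1 + zgrid s m N 0 ^ 2) ^ 2). nra.
      unfold Rdiv. rewrite Rmult_assoc, Rinv_l by nra.
      assert (1 <= (1 + zgrid s m N 0 ^ 2) ^ 2) by nra. nra.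
    - specialize (IH ltac:(lia)).
      rewrite <- (RInt_Chasles_R F _ (zgrid s m N n)) by auto.
      assert (Hz : zgrid s m N (S n) = zgrid s m N n + dl) by (apply zgrid_S; auto).
      set (a := zgrid s m N n) in *. set (b := zgrid s m N (S n)) in *.
      assert (HC : Rabs (dl * f N (S n) - RInt F a b) <= cmp_primitive e e D r b - cmp_primitive e e D r a).
      { replace (dl * f N (S n)) with (RInt (fun _ => f N (S n)) a b).
        2:{ rewrite RInt_const. unfold scal; simpl; unfold mult; simpl. rewrite Hz. ring. }
        assert (Hexc : ex_RInt (fun _ : R => f N (S n)) a b) by apply ex_RInt_const.
        assert (Hexm : ex_RInt (fun y => minus (f N (S n)) (F y)) a b)
          by (apply (ex_RInt_minus (fun _ => f N (S n)) F); auto).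
        replace (RInt (fun _ => f N (S n)) a b - RInt F a b)
          with (RInt (fun y => minus (f N (S n)) (F y)) a b)
          by (apply (RInt_minus (fun _ => f N (S n)) F); auto).
        rewrite <- (is_RInt_unique _ _ _ _ (is_RInt_cmp_density e e D r a b He)).
        eapply Rle_trans. apply abs_RInt_le; auto. lra.
        apply RInt_le. lra. apply (ex_RInt_norm (fun y => minus (f N (S n)) (F y))); auto.
        exists (cmp_primitive e e D r b - cmp_primitive e e D r a). apply is_RInt_cmp_density; auto.
        intros y Hy. apply HN2; [lia|lia|]. fold b dl.
        rewrite Rabs_right by lra. lra. }
      simpl.
      replace (sum_f_R0 (fun k => dl * f N k) n + dl * f N (S n) - (RInt F (zgrid s m N 0) a + RInt F a b))
        with ((sum_f_R0 (fun k => dl * f N k) n - RInt F (zgrid s m N 0) a) + (dl * f N (S n) - RInt F a b)) by ring.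
      eapply Rle_trans. apply Rabs_triang. lra. }
  specialize (Hind N ltac:(lia)).
  specialize (HN1 N ltac:(lia)). specialize (HN3 N ltac:(lia)).
  assert (dl * D < eps / 3).
  { eapply Rle_lt_trans. 2: apply HN3. eapply Rle_trans. 2: apply Rle_abs.
    unfold dl. right. field. lra. }
  pose proof (cmp_primitive_osc e e D r (zgrid s m N 0) (zgrid s m N N) ltac:(lra) ltac:(lra) HD) as Ho.
  assert ((e + 40 * D * e) * PI = eps / 3) by (unfold e; field; lra).
  replace (sum_f_R0 (fun k => dl * f N k) N - J) with
   ((sum_f_R0 (fun k => dl * f N k) N - RInt F (zgrid s m N 0) (zgrid s m N N))
    + (RInt F (zgrid s m N 0) (zgrid s m N N) - J)) by ring.
  eapply Rle_lt_trans. apply Rabs_triang. lra.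
Qed.

(** * Stirling and binomial weights *)

Lemma nonneg_of_derive_nonneg (f df : R -> R) (x : R) :
  0 <= x -> f 0 = 0 ->
  (forall y, 0 <= y -> is_derive f y (df y)) -> (forall y, 0 <= y -> 0 <= df y) -> 0 <= f x.
Proof.
  intros Hx H0 Hd Hp.
  destruct (MVT_gen f 0 x df) as [c [Hc E]].
  - intros y Hy. rewrite Rmin_left, Rmax_right in Hy by lra. apply Hd; lra.
  - intros y Hy. rewrite Rmin_left, Rmax_right in Hy by lra.
    apply derivable_continuous_pt. exists (df y). apply is_derive_Reals, Hd; lra.
  - rewrite Rmin_left, Rmax_right in Hc by lra. specialize (Hp c (proj1 Hc)). nra.
Qed.

(** Both rational bounds differ from the logarithm only at third order; the numerator of the
    derivative of each difference is x^2. At x = 1 / n they give the two sides of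
    [ln_stirling_step]. *)
Lemma ln_1p_bounds (x : R) : 0 <= x ->
  2 * x / (2 + x) <= ln (1 + x) <= x * (2 + x) / (2 * (1 + x)).
Proof.
  intros Hx. split.
  - enough (0 <= ln (1 + x) - 2 * x / (2 + x)) by lra.
    apply (nonneg_of_derive_nonneg (fun x => ln (1 + x) - 2 * x / (2 + x))
       (fun x => x ^ 2 / ((1 + x) * (2 + x) ^ 2))); auto.
    + replace (1 + 0) with 1 by ring. rewrite ln_1. field.
    + intros y Hy. auto_derive. repeat split; lra. field. lra.
    + intros y Hy. apply Rdiv_le_0_compat; nra.
  - enough (0 <= x * (2 + x) / (2 * (1 + x)) - ln (1 + x)) by lra.
    apply (nonneg_of_derive_nonneg (fun x => x * (2 + x) / (2 * (1 + x)) - ln (1 + x))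
       (fun x => x ^ 2 / (2 * (1 + x) ^ 2))); auto.
    + replace (1 + 0) with 1 by ring. rewrite ln_1. field.
    + intros y Hy. auto_derive. repeat split; lra. field. lra.
    + intros y Hy. apply Rdiv_le_0_compat; nra.
Qed.

(** The logarithm of n! / (sqrt n (n / e)^n). *)
Definition ln_stirling (n : nat) : R := ln (INR (fact n)) - (INR n + / 2) * ln (INR n) + INR n.
Definition stirling (n : nat) : R := exp (ln_stirling n).

(** (n + 1/2) ln (1 + 1/n) lies between 1 and 1 + (1/n - 1/(n+1)) / 4. The right-hand excess
    telescopes, which yields a decreasing sequence and an increasing companion. *)
Lemma ln_stirling_step (n : nat) : (1 <= n)%nat ->
  ln_stirling (S n) <= ln_stirling n /\ ln_stirling n - / 4 * / INR n <= ln_stirling (S n) - / 4 * / INR (S n).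
Proof.
  intros Hn.
  assert (HI : 0 < INR n) by (apply lt_0_INR; lia).
  assert (E : ln_stirling (S n) = ln_stirling n + 1 - (INR n + / 2) * ln (1 + / INR n)).
  { unfold ln_stirling. rewrite fact_simpl, mult_INR, S_INR.
    assert (0 < INR (fact n)) by (apply lt_0_INR, lt_O_fact).
    rewrite ln_mult by lra.
    replace (1 + / INR n) with ((INR n + 1) * / INR n) by (field; lra).
    rewrite ln_mult, ln_Rinv; try lra. apply Rinv_0_lt_compat; lra. }
  rewrite E, S_INR.
  destruct (ln_1p_bounds (/ INR n)) as [h1 h2].
  { left. apply Rinv_0_lt_compat; lra. }
  replace (2 * / INR n / (2 + / INR n)) with (/ (INR n + / 2)) in h1 by (field; lra).
  assert (h1' : 1 <= (INR n + / 2) * ln (1 + / INR n)).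
  { apply Rmult_le_compat_l with (r := INR n + / 2) in h1; [|lra].
    rewrite Rinv_r in h1 by lra. exact h1. }
  assert (h2' : (INR n + / 2) * ln (1 + / INR n) <= 1 + / 4 * (/ INR n - / (INR n + 1))).
  { apply Rmult_le_compat_l with (r := INR n + / 2) in h2; [|lra].
    eapply Rle_trans. apply h2. right. field. lra. }
  lra.
Qed.

(** The decreasing sequence starts at 1 and its increasing companion at 1 - 1/4, hence the two
    constants. *)
Lemma ln_stirling_bounds (n : nat) : (1 <= n)%nat -> 3 / 4 <= ln_stirling n <= 1.
Proof.
  intros Hn.
  assert (E1 : ln_stirling 1 = 1) by (unfold ln_stirling; simpl; rewrite ln_1; ring).
  assert (3 / 4 + / 4 * / INR n <= ln_stirling n <= 1).
  { induction Hn as [|n Hn [IH1 IH2]].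
    - rewrite E1. simpl. lra.
    - destruct (ln_stirling_step n Hn). lra. }
  assert (0 < / INR n) by (apply Rinv_0_lt_compat, lt_0_INR; lia). lra.
Qed.

Lemma stirling_lim : exists A, 0 < A /\ is_lim_seq stirling A.
Proof.
  destruct (ex_finite_lim_seq_decr (fun n => ln_stirling (S n)) (3/4)) as [l Hl].
  - intros n. apply ln_stirling_step. lia.
  - intros n. apply ln_stirling_bounds. lia.
  - exists (exp l). split. apply exp_pos.
    apply is_lim_seq_incr_1. unfold stirling.
    apply (is_lim_seq_continuous exp (fun n => ln_stirling (S n)) l); auto.
    apply derivable_continuous_pt, derivable_pt_exp.
Qed.

Lemma stirling_bounds (n : nat) : (1 <= n)%nat -> 1 <= stirling n <= 3.
Proof.
  intros Hn. destruct (ln_stirling_bounds n Hn). unfold stirling. split.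
  - rewrite <- exp_0. apply exp_mono; lra.
  - eapply Rle_trans. apply exp_mono. apply H0. apply exp_le_3.
Qed.

Lemma ln_sqrt (x : R) : 0 < x -> ln (sqrt x) = / 2 * ln x.
Proof.
  intros H. pose proof (sqrt_lt_R0 x H).
  rewrite <- (sqrt_sqrt x) at 2 by lra. rewrite ln_mult by auto. field.
Qed.

Lemma fact_stirling (n : nat) : (1 <= n)%nat ->
  INR (fact n) = stirling n * sqrt (INR n) * exp (INR n * ln (INR n) - INR n).
Proof.
  intros Hn.
  assert (HI : 0 < INR n) by (apply lt_0_INR; lia).
  assert (0 < INR (fact n)) by (apply lt_0_INR, lt_O_fact).
  rewrite <- (exp_ln (sqrt (INR n))) by (apply sqrt_lt_R0; auto).
  unfold stirling. rewrite <- !exp_plus. rewrite <- (exp_ln (INR (fact n))) at 1 by auto.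
  f_equal. rewrite ln_sqrt by auto. unfold ln_stirling. field.
Qed.

(** The binomial probability with its exponential rate, the entropy [Ifun], divided out. What
    remains is of order 1 / sqrt N away from the endpoints, and the Gibbs weight becomes [binw]
    times exp (N H). *)
Definition binw (N k : nat) : R := Binomial.C N k / 2 ^ N * exp (INR N * Ifun (grid N k)).

Lemma two_pow_exp (N : nat) : 2 ^ N = exp (INR N * ln 2).
Proof. rewrite <- Rpower_pow by lra. unfold Rpower. reflexivity. Qed.

(** The exponential parts of the three factorials cancel exactly against 2^N and the entropy, so all
    the approximation is confined to the ratio of [stirling] factors. *)
Lemma binw_eq (N k : nat) : (0 < k)%nat -> (k < N)%nat ->
  binw N k = stirling N / (stirling k * stirling (N - k)) * (sqrt (INR N) / (sqrt (INR k) * sqrt (INR (N - k)))).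
Proof.
  intros H1 H2.
  assert (a1 : 0 < INR k) by (apply lt_0_INR; lia).
  assert (a2 : 0 < INR (N - k)) by (apply lt_0_INR; lia).
  assert (a3 : INR N = INR k + INR (N - k)) by (rewrite <- plus_INR; f_equal; lia).
  assert (s1 : 0 < sqrt (INR k)) by (apply sqrt_lt_R0; auto).
  assert (s2 : 0 < sqrt (INR (N - k))) by (apply sqrt_lt_R0; auto).
  assert (t1 : 0 < stirling k) by apply exp_pos.
  assert (t2 : 0 < stirling (N - k)) by apply exp_pos.
  unfold binw, Binomial.C. rewrite !fact_stirling by lia.
  rewrite two_pow_exp.
  set (eN := INR N * ln (INR N) - INR N). set (ek := INR k * ln (INR k) - INR k).
  set (er := INR (N-k) * ln (INR (N-k)) - INR (N-k)).
  assert (E : exp eN * exp (INR N * Ifun (grid N k)) = exp ek * exp er * exp (INR N * ln 2)).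
  { rewrite <- !exp_plus. f_equal. unfold Ifun, eN, ek, er.
    replace (1 + grid N k) with (2 * (INR k * / INR N)) by (unfold grid; field; lra).
    replace (1 - grid N k) with (2 * (INR (N - k) * / INR N)).
    2:{ unfold grid. rewrite a3. field. lra. }
    assert (0 < / INR N) by (apply Rinv_0_lt_compat; lra).
    rewrite !ln_mult, ln_Rinv; try lra; try (apply Rmult_lt_0_compat; lra).
    rewrite a3. field. lra. }
  pose proof (exp_pos ek). pose proof (exp_pos er). pose proof (exp_pos (INR N * ln 2)).
  replace (stirling N * sqrt (INR N) * exp eN /
    (stirling k * sqrt (INR k) * exp ek * (stirling (N - k) * sqrt (INR (N - k)) * exp er)) /
    exp (INR N * ln 2) * exp (INR N * Ifun (grid N k)))
  with (stirling N * sqrt (INR N) * (exp eN * exp (INR N * Ifun (grid N k))) /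
    (stirling k * sqrt (INR k) * exp ek * (stirling (N - k) * sqrt (INR (N - k)) * exp er)) /
    exp (INR N * ln 2)) by (field; repeat split; lra).
  rewrite E. field. repeat split; lra.
Qed.

Lemma grid_bounds (N k : nat) : (1 <= N)%nat -> (k <= N)%nat -> -1 <= grid N k <= 1.
Proof.
  intros HN Hk.
  assert (0 < INR N) by (apply lt_0_INR; lia).
  assert (0 <= INR k) by apply pos_INR.
  apply le_INR in Hk.
  assert (0 <= INR k / INR N <= 1).
  { split. apply Rdiv_le_0_compat; lra. apply Rmult_le_reg_r with (INR N); auto.
    unfold Rdiv. rewrite Rmult_assoc, Rinv_l by lra. lra. }
  unfold grid. replace (2 * INR k / INR N) with (2 * (INR k / INR N)) by (field; lra). lra.
Qed.

Lemma binw_pos (N k : nat) : 0 < binw N k.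
Proof.
  unfold binw, Binomial.C. apply Rmult_lt_0_compat. 2: apply exp_pos.
  apply Rdiv_lt_0_compat. 2: apply pow_lt; lra.
  apply Rdiv_lt_0_compat. apply lt_0_INR, lt_O_fact.
  apply Rmult_lt_0_compat; apply lt_0_INR, lt_O_fact.
Qed.

Lemma stirling_ratio_bound (N k : nat) : (0 < k)%nat -> (k < N)%nat ->
  0 <= stirling N / (stirling k * stirling (N - k)) <= 3.
Proof.
  intros H1 H2. destruct (stirling_bounds N ltac:(lia)).
  destruct (stirling_bounds k ltac:(lia)). destruct (stirling_bounds (N-k) ltac:(lia)).
  assert (1 <= stirling k * stirling (N - k)) by nra.
  split. apply Rdiv_le_0_compat; lra.
  apply Rmult_le_reg_r with (stirling k * stirling (N - k)). lra.
  unfold Rdiv. rewrite Rmult_assoc, Rinv_l by lra. nra.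
Qed.

Lemma binw_bound (N k : nat) : (1 <= N)%nat -> (k <= N)%nat -> binw N k <= 6.
Proof.
  intros HN Hk.
  assert (HI : 0 < INR N) by (apply lt_0_INR; lia).
  destruct (Nat.eq_dec k 0) as [->|h0]; [|destruct (Nat.eq_dec k N) as [->|h1]].
  - assert (E : grid N 0 = -1) by (unfold grid; simpl; field; lra).
    unfold binw. rewrite E. unfold Ifun.
    replace (1 + -1) with 0 by ring. replace (1 - -1) with 2 by ring.
    rewrite two_pow_exp. replace (INR N * (/ 2 * (0 * ln 0 + 2 * ln 2))) with (INR N * ln 2) by field.
    pose proof (exp_pos (INR N * ln 2)). rewrite C_n_0.
    replace (1 / exp (INR N * ln 2) * exp (INR N * ln 2)) with 1 by (field; lra). lra.
  - assert (E : grid N N = 1) by (unfold grid; simpl; field; lra).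
    unfold binw. rewrite E. unfold Ifun.
    replace (1 + 1) with 2 by ring. replace (1 - 1) with 0 by ring.
    rewrite two_pow_exp. replace (INR N * (/ 2 * (2 * ln 2 + 0 * ln 0))) with (INR N * ln 2) by field.
    pose proof (exp_pos (INR N * ln 2)). rewrite C_n_n.
    replace (1 / exp (INR N * ln 2) * exp (INR N * ln 2)) with 1 by (field; lra). lra.
  - rewrite binw_eq by lia.
    destruct (stirling_ratio_bound N k ltac:(lia) ltac:(lia)) as [b1 b2].
    assert (c1 : 1 <= INR k) by (apply (le_INR 1); lia).
    assert (c2 : 1 <= INR (N-k)) by (apply (le_INR 1); lia).
    assert (c3 : INR N = INR k + INR (N - k)) by (rewrite <- plus_INR; f_equal; lia).
    assert (0 <= sqrt (INR N) / (sqrt (INR k) * sqrt (INR (N - k))) <= 2).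
    { rewrite <- sqrt_mult by lra.
      assert (0 < sqrt (INR k * INR (N-k))) by (apply sqrt_lt_R0; nra).
      split. apply Rdiv_le_0_compat; auto. apply sqrt_pos.
      apply Rmult_le_reg_r with (sqrt (INR k * INR (N-k))); auto.
      unfold Rdiv. rewrite Rmult_assoc, Rinv_l by lra. rewrite Rmult_1_r.
      replace 2 with (sqrt 4) by (replace 4 with (2^2) by ring; rewrite sqrt_pow2; lra).
      rewrite <- sqrt_mult by nra. apply sqrt_le_1; nra. }
    nra.
Qed.

Lemma binw_sqrt (N k : nat) : (0 < k)%nat -> (k < N)%nat ->
  sqrt (INR N) * binw N k = stirling N / (stirling k * stirling (N - k)) * (2 / sqrt (1 - grid N k ^ 2)).
Proof.
  intros H1 H2. rewrite binw_eq by lia.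
  assert (c1 : 1 <= INR k) by (apply (le_INR 1); lia).
  assert (c2 : 1 <= INR (N-k)) by (apply (le_INR 1); lia).
  assert (c3 : INR N = INR k + INR (N - k)) by (rewrite <- plus_INR; f_equal; lia).
  assert (E : 1 - grid N k ^ 2 = (2 / INR N) ^ 2 * (INR k * INR (N - k))).
  { unfold grid. rewrite c3. field. lra. }
  assert (0 < 2 / INR N) by (apply Rdiv_lt_0_compat; lra).
  rewrite E, sqrt_mult by nra. rewrite sqrt_pow2 by lra. rewrite sqrt_mult by lra.
  assert (s1 : 0 < sqrt (INR k)) by (apply sqrt_lt_R0; lra).
  assert (s2 : 0 < sqrt (INR (N - k))) by (apply sqrt_lt_R0; lra).
  assert (t1 : 0 < stirling k) by apply exp_pos.
  assert (t2 : 0 < stirling (N - k)) by apply exp_pos.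
  replace (2 / (2 / INR N * (sqrt (INR k) * sqrt (INR (N - k)))))
    with (INR N / (sqrt (INR k) * sqrt (INR (N - k)))) by (field; lra).
  replace (INR N) with (sqrt (INR N) * sqrt (INR N)) at 3 by (apply sqrt_sqrt; lra).
  field. lra.
Qed.

Lemma grid_filter_grid (s m z : R) : 0 < s ->
  filterlim (fun q => grid (fst q) (snd q)) (grid_filter s m z) (locally m).
Proof.
  intros Hs. apply filterlim_locally. intros eps.
  destruct (eventually_inv_sqrt ((Rabs z + 1) / s) eps (cond_pos eps)) as [N0 H0].
  exists 1, (max 1 N0). split. lra. intros N k HN Hk Hz.
  change (Rabs (grid N k - m) < eps). simpl.
  pose proof (sqrt_INR_pos N ltac:(lia)) as Hq.
  eapply Rle_lt_trans. 2: apply (H0 N); lia.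
  rewrite (Rabs_right ((Rabs z + 1) / s / sqrt (INR N))).
  2:{ apply Rle_ge. apply Rdiv_le_0_compat; auto. apply Rdiv_le_0_compat; auto.
      pose proof (Rabs_pos z); lra. }
  replace (grid N k - m) with (zgrid s m N k / (s * sqrt (INR N))) by (unfold zgrid; field; lra).
  unfold Rdiv. rewrite Rabs_mult, (Rabs_right (/ _)).
  2:{ apply Rle_ge. left. apply Rinv_0_lt_compat. nra. }
  rewrite Rinv_mult. rewrite Rmult_assoc.
  apply Rmult_le_compat_r. left. apply Rmult_lt_0_compat; apply Rinv_0_lt_compat; auto.
  replace (zgrid s m N k) with ((zgrid s m N k - z) + z) by ring.
  eapply Rle_trans. apply Rabs_triang. lra.
Qed.

Lemma grid_filter_zgrid (s m z : R) :
  filterlim (fun q => zgrid s m (fst q) (snd q)) (grid_filter s m z) (locally z).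
Proof.
  apply filterlim_locally. intros eps. exists eps, 0%nat. split. apply cond_pos. auto.
Qed.

Lemma grid_filter_fst (s m z : R) : filterlim fst (grid_filter s m z) eventually.
Proof. intros P [N0 H]. exists 1, N0. split. lra. intros; apply H; auto. Qed.

Lemma grid_filter_range (s m z : R) : grid_filter s m z (fun q => (1 <= fst q)%nat /\ (snd q <= fst q)%nat).
Proof. exists 1, 1%nat. split. lra. auto. Qed.

(** Since [m] is interior, k and N - k both grow linearly in N, so Stirling's limit applies to each
    factorial. *)
Lemma grid_filter_snd (s m z : R) : 0 < s -> -1 < m < 1 ->
  filterlim snd (grid_filter s m z) eventually /\
  filterlim (fun q => (fst q - snd q)%nat) (grid_filter s m z) eventually.
Proof.
  intros Hs Hm.
  set (e := Rmin (1 + m) (1 - m) / 2).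
  assert (He : 0 < e) by (unfold e; apply Rdiv_lt_0_compat; [apply Rmin_pos|]; lra).
  assert (e1 : 2 * e <= 1 + m) by (unfold e; pose proof (Rmin_l (1+m) (1-m)); lra).
  assert (e2 : 2 * e <= 1 - m) by (unfold e; pose proof (Rmin_r (1+m) (1-m)); lra).
  pose proof (proj1 (filterlim_locally _ _) (grid_filter_grid s m z Hs) (mkposreal e He)) as Hx.
  assert (Hk : forall n0, grid_filter s m z (fun q => (n0 <= snd q)%nat /\ (n0 <= fst q - snd q)%nat)).
  { intros n0.
    destruct (nfloor_ex (2 * INR n0 / e)) as [N1 [_ HN1]].
    { apply Rdiv_le_0_compat; auto. pose proof (pos_INR n0); lra. }
    assert (HN : grid_filter s m z (fun q => (max 1 (S N1) <= fst q)%nat)).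
    { apply (grid_filter_fst s m z). exists (max 1 (S N1)). auto. }
    generalize (filter_and _ _ (grid_filter_range s m z) (filter_and _ _ HN Hx)).
    apply filter_imp. intros [N k] [[h1 h2] [h3 h4]]. simpl in *.
    change (Rabs (grid N k - m) < e) in h4. apply Rabs_def2 in h4.
    assert (HI : 0 < INR N) by (apply lt_0_INR; lia).
    assert (Hb : 2 * INR n0 < e * INR N).
    { assert (2 * INR n0 / e < INR N).
      { eapply Rlt_le_trans. apply HN1. rewrite <- S_INR. apply le_INR. lia. }
      apply Rmult_lt_compat_r with (r := e) in H; auto.
      replace (2 * INR n0 / e * e) with (2 * INR n0) in H by (field; lra). lra. }
    assert (E1 : 2 * INR k = INR N * (1 + grid N k)) by (unfold grid; field; lra).
    assert (E2 : 2 * INR (N - k) = INR N * (1 - grid N k)).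
    { rewrite minus_INR by auto. unfold grid. field. lra. }
    split; apply INR_le.
    - assert (e * INR N <= INR N * (1 + grid N k)) by nra. lra.
    - assert (e * INR N <= INR N * (1 - grid N k)) by nra. lra. }
  split; intros P [n0 HP]; unfold filtermap; generalize (Hk n0); apply filter_imp; intros q [h1 h2]; apply HP; auto.
Qed.

Lemma binw_lim (s m z A : R) : 0 < s -> -1 < m < 1 -> 0 < A -> is_lim_seq stirling A ->
  filterlim (fun q => sqrt (INR (fst q)) * binw (fst q) (snd q)) (grid_filter s m z)
    (locally (2 / (A * sqrt (1 - m ^ 2)))).
Proof.
  intros Hs Hm HA Hst.
  destruct (grid_filter_snd s m z Hs Hm) as [L1 L2].
  assert (Hm2 : 0 < 1 - m ^ 2) by nra.
  assert (Hs2 : 0 < sqrt (1 - m ^ 2)) by (apply sqrt_lt_R0; auto).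
  apply filterlim_ext_loc with (fun q => stirling (fst q) * / (stirling (snd q) * stirling (fst q - snd q))
     * (2 * / sqrt (1 - grid (fst q) (snd q) ^ 2))).
  - assert (H1 : grid_filter s m z (fun q => (1 <= snd q)%nat)) by (apply L1; exists 1%nat; auto).
    assert (H2 : grid_filter s m z (fun q => (1 <= fst q - snd q)%nat))
      by (apply (L2 (fun n => (1 <= n)%nat)); exists 1%nat; auto).
    generalize (filter_and _ _ H1 H2). apply filter_imp. intros [N k] [h1 h2]. simpl in *.
    rewrite binw_sqrt by lia. reflexivity.
  - replace (2 / (A * sqrt (1 - m ^ 2))) with ((A * / (A * A)) * (2 * / sqrt (1 - m ^ 2))) by (field; lra).
    apply (filterlim_comp_2 (G := locally (A * / (A * A))) (H := locally (2 * / sqrt (1 - m^2))) _ _ Rmult).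
    3: apply (filterlim_mult (A * / (A * A)) (2 * / sqrt (1 - m^2))).
    + apply (filterlim_comp_2 (G := locally A) (H := locally (/ (A * A))) _ _ Rmult).
      3: apply (filterlim_mult A (/ (A * A))).
      * eapply filterlim_comp. apply grid_filter_fst. exact Hst.
      * apply (filterlim_comp _ _ _ (fun q => stirling (snd q) * stirling (fst q - snd q)) Rinv _ (locally (A * A))).
        2:{ apply (continuous_Rinv (A * A)). nra. }
        apply (filterlim_comp_2 (G := locally A) (H := locally A) _ _ Rmult).
        3: apply (filterlim_mult A A).
        -- eapply filterlim_comp. apply L1. exact Hst.
        -- apply (filterlim_comp _ _ _ (fun q => (fst q - snd q)%nat) stirling _ eventually). apply L2. exact Hst.
    + apply (filterlim_comp _ _ _ (fun q => grid (fst q) (snd q)) (fun x => 2 * / sqrt (1 - x ^ 2)) _ (locally m)).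
      apply grid_filter_grid; auto.
      apply (ex_derive_continuous (fun x => 2 * / sqrt (1 - x ^ 2))).
      auto_derive. repeat split; try apply Rgt_not_eq, sqrt_lt_R0; nra.
Qed.

Lemma binw_window_bound (N k : nat) (e : R) : (1 <= N)%nat -> (k <= N)%nat ->
  0 < e -> Rabs (grid N k) <= 1 - e -> sqrt (INR N) * binw N k <= 6 / e.
Proof.
  intros HN Hk He Hx.
  assert (HI : 0 < INR N) by (apply lt_0_INR; lia).
  assert (k <> 0)%nat.
  { intros ->. replace (grid N 0) with (-1) in Hx by (unfold grid; simpl; field; lra).
    rewrite Rabs_left in Hx; lra. }
  assert (k <> N)%nat.
  { intros ->. replace (grid N N) with 1 in Hx by (unfold grid; simpl; field; lra).
    rewrite Rabs_right in Hx; lra. }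
  rewrite binw_sqrt by lia.
  destruct (stirling_ratio_bound N k ltac:(lia) ltac:(lia)) as [b1 b2].
  assert (e <= sqrt (1 - grid N k ^ 2)).
  { rewrite <- (sqrt_pow2 e) by lra. rewrite <- (pow2_abs (grid N k)).
    pose proof (Rabs_pos (grid N k)). apply sqrt_le_1; nra. }
  assert (0 <= 2 / sqrt (1 - grid N k ^ 2) <= 2 / e).
  { split. apply Rdiv_le_0_compat; lra. apply Rmult_le_compat_l. lra. apply Rinv_le_contravar; lra. }
  replace (6 / e) with (3 * (2 / e)) by (field; lra).
  apply Rmult_le_compat; lra.
Qed.

(** * The free energy function and its maximizers *)

Lemma ln_nonpos (y : R) : y <= 0 -> ln y = 0.
Proof. intros H. unfold ln. destruct (Rlt_dec 0 y); [exfalso; lra|reflexivity]. Qed.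

Lemma abs_xlnx_le (t : R) : 0 < t <= 1 -> Rabs (t * ln t) <= 2 * sqrt t.
Proof.
  intros [H0 H1].
  assert (Hs : 0 < sqrt t) by (apply sqrt_lt_R0; auto).
  assert (Hl : ln t <= 0).
  { rewrite <- ln_1. destruct H1 as [H1| ->]; [left; apply ln_increasing|right]; auto. }
  rewrite Rabs_left1 by nra.
  assert (E : ln t = 2 * ln (sqrt t)) by (rewrite ln_sqrt by auto; field).
  assert (B : - ln (sqrt t) <= / sqrt t).
  { rewrite <- ln_Rinv by auto.
    assert (0 < / sqrt t) by (apply Rinv_0_lt_compat; auto).
    left. apply exp_lt_inv. rewrite exp_ln by auto.
    apply Rlt_trans with (1 + / sqrt t). lra. apply exp_ineq1. lra. }
  assert (E2 : t = sqrt t * sqrt t) by (rewrite sqrt_sqrt; lra).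
  rewrite E. rewrite E2 at 1.
  apply Rle_trans with (sqrt t * sqrt t * (2 * / sqrt t)).
  nra. right. field. lra.
Qed.

(** The default value 0 of [ln] on nonpositive arguments makes this continuous across 0. Hence
    [Hfun] is continuous up to the endpoints and beyond, and compactness arguments on [-1, 1] need
    no special care. *)
Lemma continuous_xlnx (t : R) : continuous (fun t => t * ln t) t.
Proof.
  destruct (total_order_T t 0) as [[H|H]|H].
  - apply continuous_ext_loc with (fun _ => 0).
    + exists (mkposreal (- t) ltac:(lra)). intros y Hy. change (Rabs (y - t) < - t) in Hy.
      apply Rabs_def2 in Hy.
      change (0 = y * ln y). rewrite ln_nonpos by lra. ring.
    + apply continuous_const.
  - subst t. apply filterlim_locally. intros eps. rewrite Rmult_0_l.
    set (e := eps / 2).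
    assert (He : 0 < e) by (unfold e; pose proof (cond_pos eps); lra).
    assert (Hm : 0 < Rmin 1 (e ^ 2)) by (apply Rmin_pos; nra).
    exists (mkposreal _ Hm). intros y Hy. change (Rabs (y - 0) < Rmin 1 (e ^ 2)) in Hy.
    rewrite Rminus_0_r in Hy.
    assert (Rabs y < 1) by (eapply Rlt_le_trans; [apply Hy|apply Rmin_l]).
    assert (Rabs y < e ^ 2) by (eapply Rlt_le_trans; [apply Hy|apply Rmin_r]).
    change (Rabs (y * ln y - 0) < eps). rewrite Rminus_0_r.
    destruct (Rlt_dec 0 y) as [hy|hy].
    + rewrite Rabs_right in H, H0 by lra.
      eapply Rle_lt_trans. apply abs_xlnx_le; lra.
      assert (sqrt y < e). { rewrite <- (sqrt_pow2 e) by lra. apply sqrt_lt_1; nra. }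
      unfold e in *. lra.
    + rewrite ln_nonpos, Rmult_0_r, Rabs_R0 by lra. apply cond_pos.
  - apply (ex_derive_continuous (fun t => t * ln t)). auto_derive. auto.
Qed.

Lemma continuous_Ifun (x : R) : continuous Ifun x.
Proof.
  unfold Ifun. apply (continuous_scal_r (/2) (fun x => (1 + x) * ln (1 + x) + (1 - x) * ln (1 - x))).
  apply (continuous_plus (fun x => (1 + x) * ln (1 + x)) (fun x => (1 - x) * ln (1 - x))).
  - apply (continuous_comp (fun x => 1 + x) (fun t => t * ln t)).
    apply (ex_derive_continuous (fun x => 1 + x)). auto_derive; auto. apply continuous_xlnx.
  - apply (continuous_comp (fun x => 1 - x) (fun t => t * ln t)).
    apply (ex_derive_continuous (fun x => 1 - x)). auto_derive; auto. apply continuous_xlnx.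
Qed.

Lemma continuous_Hfun (p : nat) (beta h x : R) : continuous (Hfun p beta h) x.
Proof.
  unfold Hfun. apply (continuous_minus (fun x => beta * x ^ p + h * x) Ifun).
  - apply (ex_derive_continuous (fun x => beta * x ^ p + h * x)). auto_derive; auto.
  - apply continuous_Ifun.
Qed.

Definition H1f (p : nat) (beta h x : R) : R :=
  beta * (INR p * x ^ (p - 1)) + h - / 2 * (ln (1 + x) - ln (1 - x)).

Definition H2f (p : nat) (beta x : R) : R :=
  beta * (INR p * INR (p - 1) * x ^ (p - 2)) - / (1 - x ^ 2).

Lemma is_derive_Hfun (p : nat) (beta h x : R) : -1 < x < 1 ->
  is_derive (Hfun p beta h) x (H1f p beta h x).
Proof.
  intros Hx. unfold Hfun, Ifun, H1f. auto_derive. repeat split; lra.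
  replace (Init.Nat.pred p) with (p - 1)%nat by lia.
  unfold Rminus. field. split; lra.
Qed.

Lemma is_derive_H1f (p : nat) (beta h x : R) : (2 <= p)%nat -> -1 < x < 1 ->
  is_derive (H1f p beta h) x (H2f p beta x).
Proof.
  intros Hp Hx. unfold H1f, H2f. auto_derive. repeat split; lra.
  replace (Init.Nat.pred (p - 1)) with (p - 2)%nat by lia.
  field. repeat split; nra.
Qed.

Lemma H2_eq (p : nat) (beta h x : R) : (2 <= p)%nat -> -1 < x < 1 ->
  H2 p beta h x = H2f p beta x.
Proof.
  intros Hp Hx. unfold H2. change (Derive (Derive (Hfun p beta h)) x = H2f p beta x).
  apply is_derive_unique.
  apply is_derive_ext_loc with (H1f p beta h).
  2: apply is_derive_H1f; auto.
  assert (Hd : 0 < Rmin (1 + x) (1 - x)) by (apply Rmin_pos; lra).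
  exists (mkposreal _ Hd). intros y Hy. change (Rabs (y - x) < Rmin (1 + x) (1 - x)) in Hy.
  pose proof (Rmin_l (1 + x) (1 - x)). pose proof (Rmin_r (1 + x) (1 - x)).
  apply Rabs_def2 in Hy.
  symmetry. apply is_derive_unique. apply is_derive_Hfun. lra.
Qed.

Lemma MVT_Hfun (p : nat) (beta h a b : R) : -1 < a -> a < b -> b < 1 ->
  exists c, Hfun p beta h b - Hfun p beta h a = H1f p beta h c * (b - a) /\ a < c < b.
Proof.
  intros Ha Hab Hb.
  apply (MVT_cor2 (Hfun p beta h) (H1f p beta h) a b Hab).
  intros c Hc. apply is_derive_Reals, is_derive_Hfun. lra.
Qed.

Lemma MVT_H1f (p : nat) (beta h a b : R) : (2 <= p)%nat -> -1 < a -> a < b -> b < 1 ->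
  exists c, H1f p beta h b - H1f p beta h a = H2f p beta c * (b - a) /\ a < c < b.
Proof.
  intros Hp Ha Hab Hb.
  apply (MVT_cor2 (H1f p beta h) (H2f p beta) a b Hab).
  intros c Hc. apply is_derive_Reals, is_derive_H1f; auto. lra.
Qed.

Lemma H1f_max (p : nat) (beta h m : R) : -1 < m < 1 -> is_global_max p beta h m ->
  H1f p beta h m = 0.
Proof.
  intros Hm [_ Hmax].
  pose proof (is_derive_Hfun p beta h m Hm) as Hd.
  apply is_derive_Reals in Hd.
  assert (pr : derivable_pt (Hfun p beta h) m) by (exists (H1f p beta h m); exact Hd).
  rewrite <- (derive_pt_eq_0 _ _ _ pr Hd).
  apply (deriv_maximum _ (-1) 1 m pr); try lra.
  intros x H1 H2. apply Hmax. lra.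
Qed.

(** Otherwise H', which vanishes at [m], would be positive just to its right and H would increase
    there. *)
Lemma H2f_max (p : nat) (beta h m : R) : (2 <= p)%nat -> -1 < m < 1 -> is_global_max p beta h m ->
  H2f p beta m <= 0.
Proof.
  intros Hp Hm Hmax.
  pose proof (H1f_max p beta h m Hm Hmax) as H1.
  apply Rnot_lt_le. intros Hpos.
  pose proof (is_derive_H1f p beta h m Hp Hm) as Hd. apply is_derive_Reals in Hd.
  assert (He : 0 < H2f p beta m / 2) by lra.
  destruct (Hd _ He) as [d Hd']. pose proof (cond_pos d) as Hdp.
  set (y := m + Rmin (d / 2) ((1 - m) / 2)).
  assert (Hy0 : 0 < Rmin (d / 2) ((1 - m) / 2)) by (apply Rmin_pos; lra).
  pose proof (Rmin_l (d / 2) ((1 - m) / 2)). pose proof (Rmin_r (d / 2) ((1 - m) / 2)).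
  destruct (MVT_Hfun p beta h m y) as [c [Hc1 Hc2]]; try (unfold y; lra).
  assert (Hc3 : Rabs ((H1f p beta h (m + (c - m)) - H1f p beta h m) / (c - m) - H2f p beta m) < H2f p beta m / 2).
  { apply Hd'. lra. rewrite Rabs_right; unfold y in *; lra. }
  replace (m + (c - m)) with c in Hc3 by ring. rewrite H1, Rminus_0_r in Hc3.
  apply Rabs_def2 in Hc3.
  assert (0 < H1f p beta h c).
  { assert (0 < H1f p beta h c / (c - m)) by lra.
    replace (H1f p beta h c) with (H1f p beta h c / (c - m) * (c - m)) by (field; lra).
    apply Rmult_lt_0_compat; lra. }
  destruct Hmax as [_ Hmax]. specialize (Hmax y ltac:(unfold y; lra)).
  assert (0 < H1f p beta h c * (y - m)) by (apply Rmult_lt_0_compat; unfold y; lra). lra.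
Qed.

Lemma one_minus_pow (p : nat) (e : R) : 0 <= e <= 1 -> 0 <= 1 - (1 - e) ^ p <= INR p * e.
Proof.
  intros He. induction p as [|p IH].
  - simpl. lra.
  - rewrite S_INR. simpl. assert (0 <= (1 - e) ^ p) by (apply pow_le; lra).
    split; nra.
Qed.

(* The slope of [I] is infinite at the endpoint. *)
Lemma endpoint_not_max (p : nat) (beta h : R) :
  exists x, -1 < x < 1 /\ Hfun p beta h 1 < Hfun p beta h x.
Proof.
  set (c := Rabs beta * INR p + Rabs h + 1).
  assert (Hc : 1 <= c).
  { unfold c. pose proof (Rabs_pos beta). pose proof (pos_INR p). pose proof (Rabs_pos h). nra. }
  (* Moving from 1 to 1 - e, the term - (e ln e) / 2 gains c e, while the polynomial part loses at
     most (c - 1) e. *)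
  set (e := exp (- (2 * c))).
  assert (He0 : 0 < e) by apply exp_pos.
  assert (He1 : e < 1) by (rewrite <- exp_0; apply exp_increasing; lra).
  exists (1 - e). split. lra.
  unfold Hfun, Ifun. rewrite pow1.
  replace (1 + 1) with 2 by ring. replace (1 - 1) with 0 by ring.
  replace (1 - (1 - e)) with e by ring. replace (1 + (1 - e)) with (2 - e) by ring.
  assert (Hle : ln e = - (2 * c)) by (unfold e; apply ln_exp).
  assert (H2 : ln (2 - e) <= ln 2) by (left; apply ln_increasing; lra).
  assert (Hl2 : 0 < ln 2) by (rewrite <- ln_1; apply ln_increasing; lra).
  destruct (one_minus_pow p e ltac:(lra)) as [q1 q2].
  assert (B1 : beta * (1 - (1 - e) ^ p) <= Rabs beta * (INR p * e)).
  { pose proof (Rle_abs beta). pose proof (Rabs_pos beta).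
    apply Rle_trans with (Rabs beta * (1 - (1 - e) ^ p)); nra. }
  assert (B2 : h * e <= Rabs h * e) by (pose proof (Rle_abs h); nra).
  rewrite Hle.
  assert ((2 - e) * ln (2 - e) <= (2 - e) * ln 2) by nra.
  assert (0 < e * ln 2) by nra.
  assert (E : Rabs beta * (INR p * e) + Rabs h * e = e * c - e) by (unfold c; ring).
  nra.
Qed.

Lemma Ifun_opp (x : R) : Ifun (- x) = Ifun x.
Proof. unfold Ifun. replace (1 + - x) with (1 - x) by ring. replace (1 - - x) with (1 + x) by ring. ring. Qed.

Lemma Hfun_opp (p : nat) (beta h x : R) :
  Hfun p beta h (- x) = Hfun p ((-1) ^ p * beta) (- h) x.
Proof.
  unfold Hfun. rewrite Ifun_opp.
  replace (- x) with (-1 * x) at 1 by ring. rewrite Rpow_mult_distr. ring.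
Qed.

(** Reflection reduces -1 to 1 but turns beta into (-1)^p beta, which is why [endpoint_not_max]
    assumes no sign for beta. *)
Lemma global_max_interior (p : nat) (beta h m : R) : is_global_max p beta h m -> -1 < m < 1.
Proof.
  intros [Hm Hmax].
  destruct (Req_dec m 1) as [->|h1].
  - destruct (endpoint_not_max p beta h) as [x [Hx1 Hx2]]. specialize (Hmax x ltac:(lra)). lra.
  - destruct (Req_dec m (-1)) as [->|h2]; [|lra].
    destruct (endpoint_not_max p ((-1) ^ p * beta) (- h)) as [x [Hx1 Hx2]].
    specialize (Hmax (- x) ltac:(lra)).
    rewrite <- !Hfun_opp in Hx2. replace (- (1)) with (-1) in Hx2 by ring. lra.
Qed.

(** * Sign of the second derivative and count of the critical points *)

Definition qf (p : nat) (x : R) : R := x ^ (p - 2) * (1 - x ^ 2).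

(** Unimodality in the form of strict quasi-concavity. With p = n + 3 the derivative has the sign of
    (n + 1) - (n + 3) x^2, so the side of the peak on which [x] lies decides the alternative. *)
Lemma qf_unimodal (p : nat) (a x b : R) : (3 <= p)%nat -> 0 <= a -> a < x -> x < b -> b < 1 ->
  qf p a < qf p x \/ qf p b < qf p x.
Proof.
  intros Hp Ha Hax Hxb Hb.
  destruct (Nat.le_exists_sub 3 p Hp) as [n [E _]].
  assert (Hd : forall y, is_derive (qf p) y (y ^ n * ((INR n + 1) - (INR n + 3) * y ^ 2))).
  { intros y. unfold qf. replace (p - 2)%nat with (n + 1)%nat by lia.
    auto_derive; auto. rewrite plus_INR. replace (Init.Nat.pred (n + 1)) with n by lia.
    rewrite pow_add. simpl. ring. }
  pose proof (pos_INR n) as Hn.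
  destruct (Rle_dec ((INR n + 3) * x ^ 2) (INR n + 1)) as [h|h].
  - left. destruct (MVT_cor2 (qf p) _ a x Hax (fun c _ => proj1 (is_derive_Reals _ _ _) (Hd c)))
      as [c [Hc1 Hc2]].
    assert (0 < c ^ n) by (apply pow_lt; lra).
    assert (c ^ 2 < x ^ 2) by nra.
    assert (0 < (INR n + 1) - (INR n + 3) * c ^ 2) by nra.
    assert (0 < c ^ n * ((INR n + 1) - (INR n + 3) * c ^ 2)) by (apply Rmult_lt_0_compat; lra).
    nra.
  - right. destruct (MVT_cor2 (qf p) _ x b Hxb (fun c _ => proj1 (is_derive_Reals _ _ _) (Hd c)))
      as [c [Hc1 Hc2]].
    assert (0 < c ^ n) by (apply pow_lt; lra).
    assert (x ^ 2 < c ^ 2) by nra.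
    assert (0 < (INR n + 3) * c ^ 2 - (INR n + 1)) by nra.
    assert (0 < c ^ n * ((INR n + 3) * c ^ 2 - (INR n + 1))) by (apply Rmult_lt_0_compat; lra).
    nra.
Qed.

Lemma H2f_qf (p : nat) (beta x : R) : -1 < x < 1 ->
  H2f p beta x * (1 - x ^ 2) = beta * INR p * INR (p - 1) * qf p x - 1.
Proof. intros Hx. unfold H2f, qf. field. nra. Qed.

(* Region in which [H2f] can be positive only on an interval; for even [p] the two half-lines are mirror images. *)
Definition dom (p : nat) (x : R) : Prop := -1 < x < 1 /\ (Nat.Odd p \/ 0 <= x).

Lemma pow_odd_nonpos (n : nat) (x : R) : Nat.Odd n -> x <= 0 -> x ^ n <= 0.
Proof.
  intros [k ->] Hx. rewrite Nat.add_1_r. rewrite <- tech_pow_Rmult, pow_mult.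
  assert (0 <= (x ^ 2) ^ k) by (apply pow_le; nra). nra.
Qed.

Lemma H2f_neg_left (p : nat) (beta x : R) : (3 <= p)%nat -> 0 <= beta -> -1 < x <= 0 -> dom p x ->
  H2f p beta x < 0.
Proof.
  intros Hp Hb Hx [_ Hd].
  assert (Hq : x ^ (p - 2) <= 0).
  { destruct Hd as [Ho|H0].
    - apply pow_odd_nonpos; [|lra]. destruct Ho as [k ->]. exists (k - 1)%nat. lia.
    - replace x with 0 by lra. rewrite pow_i by lia. lra. }
  unfold H2f. assert (0 < / (1 - x ^ 2)) by (apply Rinv_0_lt_compat; nra).
  assert (0 <= beta * (INR p * INR (p - 1))).
  { apply Rmult_le_pos; auto. apply Rmult_le_pos; apply pos_INR. }
  nra.
Qed.

(** In [dom] the points with H'' >= 0 form an interval, with strict sign inside. Nonnegativity at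
    [a] already forces a > 0, where [qf_unimodal] applies. *)
Lemma H2f_pos_between (p : nat) (beta a x b : R) : (3 <= p)%nat -> 0 <= beta ->
  dom p a -> dom p b -> a < x -> x < b ->
  0 <= H2f p beta a -> 0 <= H2f p beta b -> 0 < H2f p beta x.
Proof.
  intros Hp Hb Da Db Hax Hxb Ha' Hb'.
  assert (Ha : 0 < a).
  { apply Rnot_le_lt. intros Hle. pose proof (H2f_neg_left p beta a Hp Hb (conj (proj1 (proj1 Da)) Hle) Da). lra. }
  destruct Db as [Db _].
  assert (Ka : 1 <= beta * INR p * INR (p - 1) * qf p a).
  { pose proof (H2f_qf p beta a ltac:(lra)). assert (0 < 1 - a ^ 2) by nra. nra. }
  assert (Kb : 1 <= beta * INR p * INR (p - 1) * qf p b).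
  { pose proof (H2f_qf p beta b ltac:(lra)). assert (0 < 1 - b ^ 2) by nra. nra. }
  assert (HK : 0 < beta * INR p * INR (p - 1)).
  { assert (0 <= beta * INR p * INR (p - 1)) by (repeat apply Rmult_le_pos; auto; apply pos_INR).
    destruct H as [H|H]; auto. rewrite <- H in Ka. lra. }
  assert (Kx : 1 < beta * INR p * INR (p - 1) * qf p x).
  { destruct (qf_unimodal p a x b Hp) as [h|h]; try lra; nra. }
  pose proof (H2f_qf p beta x ltac:(lra)). assert (0 < 1 - x ^ 2) by nra.
  apply Rnot_le_lt. intros Hle. nra.
Qed.

Lemma dom_between (p : nat) (a x b : R) : dom p a -> dom p b -> a <= x <= b -> dom p x.
Proof. intros [h1 h2] [h3 h4] Hx. split. lra. destruct h2; auto. right; lra. Qed.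

(** If H'' were nowhere positive in between, H' would be monotone with equal end values, hence zero
    throughout. Mean value points c0 < c1 < c2 with H'' = 0 at c0 and c2 then force H''(c1) > 0. *)
Lemma critical_pair (p : nat) (beta h a b : R) : (3 <= p)%nat -> 0 <= beta ->
  dom p a -> dom p b -> a < b -> H1f p beta h a = 0 -> H1f p beta h b = 0 ->
  exists u, a < u < b /\ 0 < H2f p beta u.
Proof.
  intros Hp Hb Da Db Hab H1a H1b.
  apply NNPP. intros Hn.
  assert (Hle : forall u, a < u < b -> H2f p beta u <= 0).
  { intros u Hu. apply Rnot_lt_le. intros Hpos. apply Hn. exists u. auto. }
  pose proof (proj1 Da). pose proof (proj1 Db).
  assert (Hz : forall x, a < x < b -> H1f p beta h x = 0).
  { intros x Hx.
    destruct (MVT_H1f p beta h a x) as [c [Hc1 Hc2]]; try lra; try lia.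
    destruct (MVT_H1f p beta h x b) as [d [Hd1 Hd2]]; try lra; try lia.
    pose proof (Hle c ltac:(lra)). pose proof (Hle d ltac:(lra)). nra. }
  set (x := (a + b) / 2).
  assert (Hx : a < x < b) by (unfold x; lra).
  pose proof (Hz x Hx) as Hzx.
  destruct (MVT_H1f p beta h x b) as [c2 [Hc2 Hc2']]; try lra; try lia.
  destruct (MVT_H1f p beta h a x) as [c1 [Hc1 Hc1']]; try lra; try lia.
  pose proof (Hz c1 ltac:(lra)) as Hzc.
  destruct (MVT_H1f p beta h a c1) as [c0 [Hc0 Hc0']]; try lra; try lia.
  assert (0 < H2f p beta c1).
  { apply (H2f_pos_between p beta c0 c1 c2); auto; try lra.
    apply (dom_between p a c0 b); auto; lra. apply (dom_between p a c2 b); auto; lra.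
    apply Rnot_lt_le; intros; nra. apply Rnot_lt_le; intros; nra. }
  specialize (Hle c1 ltac:(lra)). lra.
Qed.

(** Each neighbouring pair encloses a point with H'' > 0, and such points form an interval, so the
    middle critical point would be strictly convex. This caps the number of maximizers in [dom] at
    two. *)
Lemma no_three_critical (p : nat) (beta h a b c : R) : (3 <= p)%nat -> 0 <= beta ->
  dom p a -> dom p b -> dom p c -> a < b -> b < c ->
  H1f p beta h a = 0 -> H1f p beta h b = 0 -> H1f p beta h c = 0 -> H2f p beta b <= 0 -> False.
Proof.
  intros Hp Hb Da Db Dc Hab Hbc Ha1 Hb1 Hc1 H2.
  destruct (critical_pair p beta h a b) as [u [Hu Hu']]; auto.
  destruct (critical_pair p beta h b c) as [v [Hv Hv']]; auto.
  assert (0 < H2f p beta b).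
  { apply (H2f_pos_between p beta u b v); auto; try lra.
    apply (dom_between p a u b); auto; lra. apply (dom_between p b v c); auto; lra. }
  lra.
Qed.

(** If H''(m) = 0, then H'' > 0 from [m] up to a point in the direction of [m'], so H would increase
    away from its maximizer. The second point is only critical so that m' = 0 can serve when p is
    even and h = 0. *)
Lemma H2f_neg_of_two (p : nat) (beta h m m' : R) : (3 <= p)%nat -> 0 <= beta ->
  dom p m -> dom p m' -> m <> m' -> is_global_max p beta h m -> H1f p beta h m' = 0 ->
  H2f p beta m < 0.
Proof.
  intros Hp Hb Dm Dm' Hne Hmax H1'.
  pose proof (global_max_interior _ _ _ _ Hmax) as Hint.
  pose proof (H1f_max _ _ _ _ Hint Hmax) as H1.
  destruct (H2f_max p beta h m ltac:(lia) Hint Hmax) as [|H2]; auto. exfalso.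
  pose proof (proj1 Dm'). destruct Hmax as [_ Hmax].
  destruct (Rdichotomy _ _ Hne) as [hlt|hgt].
  - destruct (critical_pair p beta h m m') as [y [Hy Hy']]; auto.
    assert (Dy : dom p y) by (apply (dom_between p m y m'); auto; lra).
    destruct (MVT_Hfun p beta h m y) as [c [Hc1 Hc2]]; try lra.
    destruct (MVT_H1f p beta h m c) as [d [Hd1 Hd2]]; try lra; try lia.
    assert (0 < H2f p beta d) by (apply (H2f_pos_between p beta m d y); auto; lra).
    specialize (Hmax y ltac:(lra)).
    assert (0 < H1f p beta h c) by nra. nra.
  - destruct (critical_pair p beta h m' m) as [y [Hy Hy']]; auto.
    assert (Dy : dom p y) by (apply (dom_between p m' y m); auto; lra).
    destruct (MVT_Hfun p beta h y m) as [c [Hc1 Hc2]]; try lra.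
    destruct (MVT_H1f p beta h c m) as [d [Hd1 Hd2]]; try lra; try lia.
    assert (0 < H2f p beta d) by (apply (H2f_pos_between p beta y d m); auto; lra).
    specialize (Hmax y ltac:(lra)).
    assert (H1f p beta h c < 0) by nra. nra.
Qed.

(** * The threshold [beta_tilde] at zero field *)

Lemma Ifun_0 : Ifun 0 = 0.
Proof. unfold Ifun. rewrite Rplus_0_r, Rminus_0_r, ln_1. ring. Qed.

Lemma Ifun_nonneg (x : R) : -1 <= x <= 1 -> 0 <= Ifun x.
Proof.
  intros Hx.
  assert (Hpos : forall y, 0 <= y <= 1 -> 0 <= Ifun y).
  { intros y Hy. destruct (Req_dec y 1) as [->|h1].
    - unfold Ifun. replace (1 - 1) with 0 by ring. replace (1 + 1) with 2 by ring.
      assert (0 < ln 2) by (rewrite <- ln_1; apply ln_increasing; lra). lra.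
    - destruct (Req_dec y 0) as [->|h0]. rewrite Ifun_0; lra.
      destruct (MVT_Hfun 0 0 0 0 y) as [c [Hc1 Hc2]]; try lra.
      unfold Hfun in Hc1. rewrite Ifun_0 in Hc1. unfold H1f in Hc1. simpl in Hc1.
      assert (ln (1 - c) < ln (1 + c)) by (apply ln_increasing; lra). nra. }
  destruct (Rle_dec 0 x). apply Hpos; lra.
  rewrite <- Ifun_opp. apply Hpos. lra.
Qed.

Lemma Hfun_0 (p : nat) (beta h : R) : (1 <= p)%nat -> Hfun p beta h 0 = 0.
Proof. intros Hp. unfold Hfun. rewrite Ifun_0, pow_i by lia. ring. Qed.

Lemma supH0_iff (p : nat) (b : R) : (1 <= p)%nat ->
  supH0 p b = Finite 0 <-> is_global_max p b 0 0.
Proof.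
  intros Hp. unfold supH0, is_global_max. rewrite Hfun_0 by auto.
  set (E := fun v => exists x, -1 <= x <= 1 /\ v = Hfun p b 0 x).
  pose proof (Lub_Rbar_correct E) as [Hub Hl].
  split.
  - intros H0. split. lra. intros y Hy. rewrite H0 in Hub.
    apply (Hub (Hfun p b 0 y)). exists y. auto.
  - intros [_ Hmax]. apply is_lub_Rbar_unique. split.
    + intros v [x [Hx ->]]. simpl. apply Hmax; auto.
    + intros v Hv. apply (Hv 0). exists 0. split. lra. rewrite Hfun_0; auto.
Qed.

(** Evaluating H at x = 1 bounds the admissible parameters by ln 2, so the supremum is finite and
    [real] does not return its default value. *)
Lemma beta_tilde_spec (p : nat) : (1 <= p)%nat ->
  (forall b, 0 <= b -> is_global_max p b 0 0 -> b <= beta_tilde p) /\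
  (forall b, b < beta_tilde p -> exists b', b < b' /\ 0 <= b' /\ is_global_max p b' 0 0).
Proof.
  intros Hp. unfold beta_tilde.
  set (S := fun b => 0 <= b /\ supH0 p b = Finite 0).
  pose proof (Lub_Rbar_correct S) as [Hub Hl].
  assert (HS0 : S 0).
  { split. lra. apply supH0_iff; auto. split. lra. intros y Hy. rewrite Hfun_0 by auto.
    unfold Hfun. pose proof (Ifun_nonneg y Hy). lra. }
  assert (HB : Rbar_le (Lub_Rbar S) 1).
  { apply Hl. intros b [Hb1 Hb2]. apply supH0_iff in Hb2; auto. destruct Hb2 as [_ Hm].
    specialize (Hm 1 ltac:(lra)). rewrite Hfun_0 in Hm by auto.
    unfold Hfun, Ifun in Hm. rewrite pow1 in Hm. replace (1 - 1) with 0 in Hm by ring.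
    replace (1 + 1) with 2 in Hm by ring. simpl.
    assert (ln 2 <= 1).
    { left. apply exp_lt_inv. rewrite exp_ln by lra. apply (exp_ineq1 1). lra. }
    lra. }
  pose proof (Hub 0 HS0) as H0. destruct (Lub_Rbar S) as [l| |] eqn:El; simpl in *; try tauto.
  split.
  - intros b Hb Hm. apply (Hub b). split; auto. apply supH0_iff; auto.
  - intros b Hb. apply NNPP. intros Hn.
    assert (Rbar_le l b); [|simpl in *; lra].
    apply (Hl (Finite b)). intros b' [Hb1 Hb2]. simpl. apply Rnot_lt_le. intros Hlt.
    apply Hn. exists b'. split; [auto|split; [auto|]]. apply supH0_iff; auto.
Qed.

(** The supremum is attained: if H(y) > 0 at the threshold, it would remain positive for slightly
    smaller parameters, against the definition of the supremum. *)
Lemma beta_tilde_max (p : nat) (b : R) : (1 <= p)%nat -> 0 <= b -> b = beta_tilde p ->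
  is_global_max p b 0 0.
Proof.
  intros Hp Hb E. split. lra. intros y Hy. rewrite Hfun_0 by auto.
  apply Rnot_lt_le. intros Hpos. unfold Hfun in Hpos.
  pose proof (Ifun_nonneg y Hy) as HI.
  assert (Hyp : 0 < y ^ p) by nra.
  (* The parameter I(y) / y^p, at which H(y) vanishes. *)
  destruct (proj2 (beta_tilde_spec p Hp) (b - (b * y ^ p - Ifun y) / y ^ p)) as [b' [h1 [h2 [_ h3]]]].
  - rewrite <- E. assert (0 < (b * y ^ p - Ifun y) / y ^ p) by (apply Rdiv_lt_0_compat; lra). lra.
  - specialize (h3 y Hy). rewrite Hfun_0 in h3 by auto. unfold Hfun in h3.
    apply Rmult_lt_compat_r with (r := y ^ p) in h1; auto.
    replace ((b - (b * y ^ p - Ifun y) / y ^ p) * y ^ p) with (Ifun y) in h1 by (field; lra). lra.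
Qed.

(** * The list of maximizers in each regime *)

Lemma sorted_ext (l1 l2 : list R) :
  StronglySorted Rlt l1 -> StronglySorted Rlt l2 -> (forall x, In x l1 <-> In x l2) -> l1 = l2.
Proof.
  revert l2. induction l1 as [|a l1 IH]; intros [|b l2] S1 S2 H.
  - reflexivity.
  - exfalso. apply (H b). left; auto.
  - exfalso. apply (H a). left; auto.
  - apply StronglySorted_inv in S1. apply StronglySorted_inv in S2.
    destruct S1 as [S1 F1], S2 as [S2 F2]. rewrite Forall_forall in F1, F2.
    assert (a = b).
    { destruct (proj1 (H a) (or_introl eq_refl)) as [h|h]; auto.
      destruct (proj2 (H b) (or_introl eq_refl)) as [h'|h']; auto.
      specialize (F1 _ h'). specialize (F2 _ h). lra. }
    subst b. f_equal. apply IH; auto. intros x. split; intros Hx.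
    + destruct (proj1 (H x) (or_intror Hx)) as [<-|h]; auto. specialize (F1 _ Hx). lra.
    + destruct (proj2 (H x) (or_intror Hx)) as [<-|h]; auto. specialize (F2 _ Hx). lra.
Qed.

Lemma sorted2 (a b : R) : a < b -> StronglySorted Rlt (a :: b :: nil).
Proof. intros. repeat constructor; auto. Qed.

Lemma sorted3 (a b c : R) : a < b -> b < c -> StronglySorted Rlt (a :: b :: c :: nil).
Proof. intros. repeat constructor; lra. Qed.

Lemma H2f_0 (p : nat) (beta : R) : (3 <= p)%nat -> H2f p beta 0 = -1.
Proof. intros Hp. unfold H2f. rewrite pow_i by lia. field. Qed.

Lemma H1f_0 (p : nat) (beta h : R) : (3 <= p)%nat -> H1f p beta h 0 = h.
Proof.
  intros Hp. unfold H1f. rewrite pow_i by lia. rewrite Rplus_0_r, Rminus_0_r, ln_1. ring.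
Qed.

Definition nondeg_max (p : nat) (beta h m : R) : Prop :=
  -1 < m < 1 /\ H1f p beta h m = 0 /\ H2f p beta m < 0 /\ is_global_max p beta h m.

Lemma two_maximizers (p : nat) (beta h x y : R) : (3 <= p)%nat -> 0 <= beta -> x < y ->
  is_global_max p beta h x -> is_global_max p beta h y ->
  (forall z, is_global_max p beta h z -> dom p z) ->
  nondeg_max p beta h x /\ nondeg_max p beta h y /\
  (forall z, is_global_max p beta h z -> z = x \/ z = y).
Proof.
  intros Hp Hb Hxy Mx My HD.
  pose proof (global_max_interior _ _ _ _ Mx). pose proof (global_max_interior _ _ _ _ My).
  pose proof (H1f_max _ _ _ _ H Mx) as Cx. pose proof (H1f_max _ _ _ _ H0 My) as Cy.
  split; [|split].
  - split; [auto|split; [auto|split; auto]].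
    apply (H2f_neg_of_two p beta h x y); auto; lra.
  - split; [auto|split; [auto|split; auto]].
    apply (H2f_neg_of_two p beta h y x); auto; lra.
  - intros z Mz. pose proof (global_max_interior _ _ _ _ Mz) as Iz.
    pose proof (H1f_max _ _ _ _ Iz Mz) as Cz.
    destruct (total_order_T z x) as [[h1|h1]|h1]; auto.
    + exfalso. apply (no_three_critical p beta h z x y); auto. apply H2f_max with h; auto; lia.
    + destruct (total_order_T z y) as [[h2|h2]|h2]; auto.
      * exfalso. apply (no_three_critical p beta h x z y); auto. apply H2f_max with h; auto; lia.
      * exfalso. apply (no_three_critical p beta h x y z); auto. apply H2f_max with h; auto; lia.
Qed.

Lemma pcrit_lt (p : nat) (beta h : R) : p_critical p beta h ->
  0 <= beta /\ exists x y, x < y /\ is_global_max p beta h x /\ is_global_max p beta h y.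
Proof.
  intros [Hb [x [y [Hne [Hx Hy]]]]]. split; auto.
  destruct (Rdichotomy _ _ Hne). exists x, y; auto. exists y, x; auto.
Qed.

Lemma list_of_two (p : nat) (beta h x y : R) (ms : list R) :
  StronglySorted Rlt ms -> (forall z, In z ms <-> is_global_max p beta h z) -> x < y ->
  is_global_max p beta h x -> is_global_max p beta h y ->
  (forall z, is_global_max p beta h z -> z = x \/ z = y) -> ms = x :: y :: nil.
Proof.
  intros HS Hin Hxy Mx My Hall. apply sorted_ext; auto. apply sorted2; auto.
  intros z. rewrite Hin. simpl. split.
  - intros Hz. destruct (Hall z Hz); auto.
  - intros [<-|[<- | [] ]]; auto.
Qed.

Lemma structure_odd (p : nat) (beta h : R) (ms : list R) : (3 <= p)%nat -> Nat.Odd p ->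
  p_critical p beta h -> StronglySorted Rlt ms -> (forall x, In x ms <-> is_global_max p beta h x) ->
  exists a b, ms = a :: b :: nil /\ a < b /\ nondeg_max p beta h a /\ nondeg_max p beta h b /\
    (~ (beta = beta_tilde p /\ h = 0) -> a <> 0 /\ b <> 0) /\
    (beta = beta_tilde p /\ h = 0 -> a = 0).
Proof.
  intros Hp Ho Hc HS Hin. destruct (pcrit_lt _ _ _ Hc) as [Hb [x [y [Hxy [Mx My]]]]].
  assert (HD : forall z, is_global_max p beta h z -> dom p z).
  { intros z Hz. split. apply (global_max_interior _ _ _ _ Hz). auto. }
  destruct (two_maximizers p beta h x y) as [Gx [Gy Hall]]; auto.
  exists x, y. split. apply (list_of_two p beta h); auto. split; auto. split; auto. split; auto.
  assert (D0 : dom p 0) by (split; [lra|auto]).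
  (* At h = 0 the origin is critical. If x < 0, H'' would be positive somewhere on the negative
     half-line; if x > 0, then 0 < x < y would be three critical points. *)
  assert (K : h = 0 -> x = 0).
  { intros ->. pose proof (H1f_0 p beta 0 Hp) as C0.
    destruct Gx as [Ix [Cx [Nx _]]], Gy as [Iy [Cy [Ny _]]].
    destruct (total_order_T x 0) as [[h1|h1]|h1]; auto; exfalso.
    - destruct (critical_pair p beta 0 x 0) as [u [Hu1 Hu2]]; auto.
      pose proof (H2f_neg_left p beta u Hp Hb ltac:(lra) (dom_between p x u 0 (HD _ Mx) D0 ltac:(lra))). lra.
    - apply (no_three_critical p beta 0 0 x y); auto. lra. }
  split.
  - intros Hn. split; intros E.
    + apply Hn. subst x.
      assert (h = 0) by (destruct Gx as [_ [Cx _]]; rewrite H1f_0 in Cx; auto).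
      split; auto. subst h.
      (* Were beta below the threshold, 0 would also be a maximizer at some larger b'; but raising
         the parameter strictly raises H at y > 0, where it is already nonnegative. *)
      destruct (beta_tilde_spec p ltac:(lia)) as [B1 B2].
      pose proof (B1 beta Hb Mx) as [h1|h1]; auto.
      destruct (B2 beta h1) as [b' [g1 [g2 [_ g3]]]].
      specialize (g3 y ltac:(destruct Gy; lra)). rewrite Hfun_0 in g3 by lia.
      destruct My as [_ My]. specialize (My 0 ltac:(lra)). rewrite Hfun_0 in My by lia.
      assert (0 < y ^ p) by (apply pow_lt; auto). unfold Hfun in *. nra.
    + subst y. assert (h = 0) by (destruct Gy as [_ [Cy _]]; rewrite H1f_0 in Cy; auto).
      specialize (K H). lra.
  - intros [_ H0]. auto.
Qed.

Lemma pow_m1_even (p : nat) : Nat.Even p -> (-1) ^ p = 1.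
Proof. intros [k ->]. apply pow_1_even. Qed.

Lemma Hfun_opp_even (p : nat) (beta h x : R) : Nat.Even p ->
  Hfun p beta h (- x) = Hfun p beta (- h) x.
Proof. intros He. rewrite Hfun_opp, pow_m1_even, Rmult_1_l; auto. Qed.

Lemma global_max_opp (p : nat) (beta h x : R) : Nat.Even p ->
  is_global_max p beta h x -> is_global_max p beta (- h) (- x).
Proof.
  intros He [Hx Hm]. split. lra. intros y Hy.
  rewrite Hfun_opp_even, Ropp_involutive by auto.
  rewrite <- (Ropp_involutive y), Hfun_opp_even, Ropp_involutive by auto. apply Hm. lra.
Qed.

Lemma pow_opp_even (n : nat) (x : R) : Nat.Even n -> (- x) ^ n = x ^ n.
Proof.
  intros He. replace (- x) with (-1 * x) by ring. rewrite Rpow_mult_distr, pow_m1_even by auto. ring.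
Qed.

Lemma H2f_opp (p : nat) (beta x : R) : Nat.Even p -> (2 <= p)%nat -> H2f p beta (- x) = H2f p beta x.
Proof.
  intros [k ->] H2. unfold H2f. rewrite !pow_opp_even; auto.
  exists 1%nat; auto. exists (k - 1)%nat. lia.
Qed.

Lemma nondeg_max_opp (p : nat) (beta h x : R) : Nat.Even p -> (2 <= p)%nat ->
  nondeg_max p beta h x -> nondeg_max p beta (- h) (- x).
Proof.
  intros He H2 [Ix [Cx [Nx Mx]]].
  pose proof (global_max_opp _ _ _ _ He Mx) as M'.
  assert (-1 < - x < 1) by lra.
  split; auto. split. apply H1f_max; auto. split; auto. rewrite H2f_opp; auto.
Qed.

(** Reflecting a point on the side opposite to the field raises H by 2 h |z|, and 0 is not critical
    because H'(0) = h. *)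
Lemma max_pos (p : nat) (beta h z : R) : Nat.Even p -> (3 <= p)%nat -> 0 < h ->
  is_global_max p beta h z -> 0 < z.
Proof.
  intros He Hp Hh Mz.
  destruct (total_order_T z 0) as [[h1|h1]|h1]; auto; exfalso.
  - destruct Mz as [Iz Mz]. specialize (Mz (- z) ltac:(lra)).
    rewrite Hfun_opp_even in Mz by auto. unfold Hfun in Mz. nra.
  - subst z. pose proof (H1f_max _ _ _ _ (global_max_interior _ _ _ _ Mz) Mz) as C.
    rewrite H1f_0 in C by auto. lra.
Qed.

Lemma structure_even_pos (p : nat) (beta h : R) (ms : list R) : (3 <= p)%nat -> Nat.Even p -> 0 < h ->
  p_critical p beta h -> StronglySorted Rlt ms -> (forall x, In x ms <-> is_global_max p beta h x) ->
  exists a b, ms = a :: b :: nil /\ 0 < a < b /\ nondeg_max p beta h a /\ nondeg_max p beta h b.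
Proof.
  intros Hp He Hh Hc HS Hin. destruct (pcrit_lt _ _ _ Hc) as [Hb [x [y [Hxy [Mx My]]]]].
  assert (HD : forall z, is_global_max p beta h z -> dom p z).
  { intros z Hz. split. apply (global_max_interior _ _ _ _ Hz). right. left. apply (max_pos p beta h z); auto. }
  destruct (two_maximizers p beta h x y) as [Gx [Gy Hall]]; auto.
  exists x, y. split. apply (list_of_two p beta h); auto. split; auto. split; auto.
  apply (max_pos p beta h x); auto.
Qed.

Lemma structure_even_neg (p : nat) (beta h : R) (ms : list R) : (3 <= p)%nat -> Nat.Even p -> h < 0 ->
  p_critical p beta h -> StronglySorted Rlt ms -> (forall x, In x ms <-> is_global_max p beta h x) ->
  exists a b, ms = a :: b :: nil /\ a < b < 0 /\ nondeg_max p beta h a /\ nondeg_max p beta h b.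
Proof.
  intros Hp He Hh Hc HS Hin. destruct (pcrit_lt _ _ _ Hc) as [Hb [x [y [Hxy [Mx My]]]]].
  assert (HD : forall z, is_global_max p beta (- h) z -> dom p z).
  { intros z Hz. split. apply (global_max_interior _ _ _ _ Hz). right. left. apply (max_pos p beta (- h) z); auto; lra. }
  destruct (two_maximizers p beta (- h) (- y) (- x)) as [Gx [Gy Hall]]; auto; try lra;
    try (apply global_max_opp; auto).
  apply nondeg_max_opp in Gx, Gy; auto; try lia. rewrite !Ropp_involutive in *.
  exists x, y. split; [|split; auto].
  - apply (list_of_two p beta h); auto. intros z Mz.
    apply global_max_opp in Mz; auto. destruct (Hall _ Mz); [right|left]; lra.
  - split; auto. apply global_max_opp in My; auto. apply max_pos in My; auto; lra.
Qed.

(** The origin is always critical here, so a second positive maximizer would give three critical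
    points in [dom]. By symmetry the only possibilities left are -m, m and perhaps 0. *)
Lemma structure_even_zero (p : nat) (beta : R) (ms : list R) : (3 <= p)%nat -> Nat.Even p ->
  p_critical p beta 0 -> StronglySorted Rlt ms -> (forall x, In x ms <-> is_global_max p beta 0 x) ->
  exists m, 0 < m /\ nondeg_max p beta 0 (- m) /\ nondeg_max p beta 0 m /\
   ((ms = (- m) :: m :: nil /\ ~ is_global_max p beta 0 0) \/
    (ms = (- m) :: 0 :: m :: nil /\ nondeg_max p beta 0 0)).
Proof.
  intros Hp He Hc HS Hin. destruct (pcrit_lt _ _ _ Hc) as [Hb [x [y [Hxy [Mx My]]]]].
  assert (Hopp : forall z, is_global_max p beta 0 z -> is_global_max p beta 0 (- z)).
  { intros z Mz. apply global_max_opp in Mz; auto. rewrite Ropp_0 in Mz. auto. }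
  assert (C0 : H1f p beta 0 0 = 0) by (apply H1f_0; auto).
  assert (D0 : dom p 0) by (split; [lra|right; lra]).
  assert (HD : forall z, 0 < z -> is_global_max p beta 0 z -> dom p z).
  { intros z Hz Mz. split. apply (global_max_interior _ _ _ _ Mz). right. lra. }
  assert (HG : forall z, 0 < z -> is_global_max p beta 0 z -> nondeg_max p beta 0 z).
  { intros z Hz Mz. pose proof (global_max_interior _ _ _ _ Mz).
    split; auto. split. apply H1f_max; auto. split; auto.
    apply (H2f_neg_of_two p beta 0 z 0); auto. lra. }
  assert (Hm : exists m, 0 < m /\ is_global_max p beta 0 m).
  { destruct (Rlt_dec 0 y) as [h1|h1]. exists y; auto. exists (- x). split. lra. auto. }
  destruct Hm as [m [Hm Mm]]. exists m. split; auto.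
  assert (Huniq : forall z, 0 < z -> is_global_max p beta 0 z -> z = m).
  { intros z Hz Mz. destruct (HG z Hz Mz) as [_ [Cz [Nz _]]]. destruct (HG m Hm Mm) as [_ [Cm [Nm _]]].
    destruct (total_order_T z m) as [[h1|h1]|h1]; auto; exfalso.
    - apply (no_three_critical p beta 0 0 z m); auto. lra.
    - apply (no_three_critical p beta 0 0 m z); auto. lra. }
  assert (Hall : forall z, is_global_max p beta 0 z -> z = - m \/ z = 0 \/ z = m).
  { intros z Mz. destruct (total_order_T z 0) as [[h1|h1]|h1]; auto.
    left. rewrite <- (Huniq (- z)); auto; lra. }
  split; [|split].
  - rewrite <- Ropp_0 at 1. apply nondeg_max_opp; auto. lia.
  - auto.
  - destruct (classic (is_global_max p beta 0 0)) as [h0|h0]; [right|left]; split; try (auto; fail).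
    + apply sorted_ext; auto. apply sorted3; lra. intros z. rewrite Hin. simpl. split.
      * intros Hz. destruct (Hall z Hz) as [-> | [-> | ->]]; auto.
      * intros [<-|[<-|[<- | [] ]]]; auto.
    + split; [lra|split; [auto|split; auto]]. rewrite H2f_0; auto; lra.
    + apply sorted_ext; auto. apply sorted2; lra. intros z. rewrite Hin. simpl. split.
      * intros Hz. destruct (Hall z Hz) as [-> | [-> | ->]]; auto; contradiction.
      * intros [<-|[<- | [] ]]; auto.
Qed.

(** * The model as a sum over magnetizations, and the estimator *)

Lemma sumR_app (l1 l2 : list R) : sumR (l1 ++ l2) = sumR l1 + sumR l2.
Proof. induction l1 as [|a l IH]; simpl. ring. unfold sumR in *. simpl. rewrite IH. ring. Qed.

Lemma sumR_map_scal {T : Type} (c : R) (f : T -> R) (l : list T) :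
  sumR (map (fun s => f s * c) l) = sumR (map f l) * c.
Proof. induction l as [|a l IH]; unfold sumR in *; simpl. ring. rewrite IH. ring. Qed.

Lemma sum_pascal (a : nat -> R) (n : nat) :
  sum_f_R0 (fun k => Binomial.C (S n) k * a k) (S n) =
  sum_f_R0 (fun k => Binomial.C n k * a (S k)) n + sum_f_R0 (fun k => Binomial.C n k * a k) n.
Proof.
  rewrite decomp_sum by lia. change (Init.Nat.pred (S n)) with n. rewrite C_n_0.
  destruct n as [|m].
  - simpl. rewrite !C_n_n. ring.
  - rewrite (decomp_sum (fun k => Binomial.C (S m) k * a k)) by lia. simpl pred.
    rewrite C_n_0. rewrite 2!tech5. cbv beta. rewrite !C_n_n.
    rewrite (sum_eq (fun i => Binomial.C (S (S m)) (S i) * a (S i))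
       (fun i => Binomial.C (S m) i * a (S i) + Binomial.C (S m) (S i) * a (S i))).
    + rewrite plus_sum. ring.
    + intros i Hi. rewrite <- pascal by lia. ring.
Qed.

(** Configurations are grouped by their number of plus spins. The induction is general in [f]
    because splitting off one spin shifts the argument by 1 or -1; Pascal's rule recombines the two
    halves. *)
Lemma sum_configs (N : nat) (f : R -> R) :
  sumR (map (fun s => f (sumR s)) (configs N)) =
  sum_f_R0 (fun k => Binomial.C N k * f (2 * INR k - INR N)) N.
Proof.
  revert f. induction N as [|n IH]; intros f.
  - simpl. unfold sumR; simpl. rewrite C_n_0. replace (2 * 0 - 0) with 0 by ring. ring.
  - simpl configs. rewrite map_app, sumR_app, !map_map.
    pose proof (IH (fun y => f (1 + y))) as I1. pose proof (IH (fun y => f (-1 + y))) as I2.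
    cbv beta in I1, I2.
    change (sumR (map (fun s => f (1 + sumR s)) (configs n))
      + sumR (map (fun s => f (-1 + sumR s)) (configs n))
      = sum_f_R0 (fun k => Binomial.C (S n) k * f (2 * INR k - INR (S n))) (S n)).
    rewrite I1, I2, sum_pascal. f_equal; apply sum_eq; intros i _; do 2 f_equal; rewrite !S_INR; ring.
Qed.

Definition gibbs_weight (p : nat) (b h : R) (N k : nat) : R :=
  Binomial.C N k / 2 ^ N * exp (INR N * (b * grid N k ^ p + h * grid N k)).

Definition model_mean (p : nat) (b h : R) (N : nat) (phi : nat -> R) : R :=
  sum_f_R0 (fun k => gibbs_weight p b h N k * phi k) N / sum_f_R0 (gibbs_weight p b h N) N.

Lemma gibbs_weight_pos (p : nat) (b h : R) (N k : nat) : 0 < gibbs_weight p b h N k.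
Proof.
  unfold gibbs_weight. apply Rmult_lt_0_compat. 2: apply exp_pos.
  apply Rdiv_lt_0_compat. 2: apply pow_lt; lra. unfold Binomial.C.
  apply Rdiv_lt_0_compat. apply lt_0_INR, lt_O_fact.
  apply Rmult_lt_0_compat; apply lt_0_INR, lt_O_fact.
Qed.

Lemma sum_pos (f : nat -> R) (n : nat) : (forall k, (k <= n)%nat -> 0 < f k) -> 0 < sum_f_R0 f n.
Proof.
  intros H. induction n as [|n IH]; simpl. auto.
  assert (0 < sum_f_R0 f n) by auto. assert (0 < f (S n)) by auto. lra.
Qed.

Lemma gibbs_weight_sum_pos (p : nat) (b h : R) (N : nat) : 0 < sum_f_R0 (gibbs_weight p b h N) N.
Proof. apply sum_pos. intros; apply gibbs_weight_pos. Qed.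

Lemma Emodel_model_mean (p : nat) (b h : R) (N : nat) (F : R -> R) : (1 <= N)%nat ->
  Emodel p b h N (fun s => F (mean N s)) = model_mean p b h N (fun k => F (grid N k)).
Proof.
  intros HN. assert (HI : 0 < INR N) by (apply lt_0_INR; lia).
  assert (H2 : 0 < 2 ^ N) by (apply pow_lt; lra).
  assert (HS : forall G : R -> R, sumR (map (fun s => exp (INR N * (b * mean N s ^ p + h * mean N s)) * G (mean N s)) (configs N))
     = 2 ^ N * sum_f_R0 (fun k => gibbs_weight p b h N k * G (grid N k)) N).
  { intros G.
    pose proof (sum_configs N (fun y => exp (INR N * (b * (y / INR N) ^ p + h * (y / INR N))) * G (y / INR N))) as HC.
    cbv beta in HC. unfold mean. rewrite HC.
    rewrite scal_sum. apply sum_eq. intros k _. unfold gibbs_weight.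
    replace ((2 * INR k - INR N) / INR N) with (grid N k) by (unfold grid; field; lra).
    field. lra. }
  unfold Emodel.
  assert (HZ : 2 ^ N * ZN p b h N = 2 ^ N * sum_f_R0 (gibbs_weight p b h N) N).
  { unfold ZN. rewrite <- Rmult_assoc, Rinv_r, Rmult_1_l by lra.
    pose proof (HS (fun _ => 1)) as H1. cbv beta in H1.
    rewrite (sum_eq (fun k => gibbs_weight p b h N k * 1) (gibbs_weight p b h N)) in H1 by (intros; ring).
    rewrite <- H1. f_equal. apply map_ext. intros s. unfold boltz. ring. }
  unfold prob. rewrite HZ.
  pose proof (gibbs_weight_sum_pos p b h N) as HW.
  rewrite (map_ext _ (fun s => (exp (INR N * (b * mean N s ^ p + h * mean N s)) * F (mean N s)) * (/ (2 ^ N * sum_f_R0 (gibbs_weight p b h N) N)))).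
  - rewrite sumR_map_scal, HS. unfold model_mean. field. lra.
  - intros s. unfold boltz. field. lra.
Qed.

Definition mean_p (p : nat) (b h : R) (N : nat) : R := model_mean p b h N (fun k => grid N k ^ p).

Lemma model_mean_weighted (p : nat) (b h : R) (N : nat) (phi : nat -> R) (c : R) :
  sum_f_R0 (fun k => gibbs_weight p b h N k * (phi k - c)) N =
  (model_mean p b h N phi - c) * sum_f_R0 (gibbs_weight p b h N) N.
Proof.
  pose proof (gibbs_weight_sum_pos p b h N) as HW. unfold model_mean.
  rewrite (sum_eq _ (fun k => gibbs_weight p b h N k * phi k - gibbs_weight p b h N k * c)).
  - rewrite minus_sum. rewrite <- (scal_sum (gibbs_weight p b h N) N c). field. lra.
  - intros; ring.
Qed.

Lemma gibbs_weight_shift (p : nat) (b d h : R) (N k : nat) :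
  gibbs_weight p (b + d) h N k = gibbs_weight p b h N k * exp (INR N * d * grid N k ^ p).
Proof.
  unfold gibbs_weight. rewrite Rmult_assoc, <- exp_plus. do 2 f_equal. ring.
Qed.

Lemma sum_nonneg_pos (f : nat -> R) (n j : nat) :
  (forall k, (k <= n)%nat -> 0 <= f k) -> (j <= n)%nat -> 0 < f j -> 0 < sum_f_R0 f n.
Proof.
  intros H Hj Hp. induction n as [|n IH].
  - replace j with 0%nat in Hp by lia. auto.
  - simpl. destruct (Nat.eq_dec j (S n)) as [->|h].
    + assert (0 <= sum_f_R0 f n) by (clear -H; induction n; simpl; [auto|apply Rplus_le_le_0_compat; auto]). lra.
    + assert (0 < sum_f_R0 f n) by (apply IH; [auto|lia]). assert (0 <= f (S n)) by auto. lra.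
Qed.

(** Source of strictness in the monotonicity of the mean. For N = 1 and p even the grid {-1, 1}
    yields the single value 1, hence N >= 2. *)
Lemma grid_pow_nonconstant (p N : nat) (c : R) : (1 <= p)%nat -> (2 <= N)%nat ->
  exists j, (j <= N)%nat /\ grid N j ^ p <> c.
Proof.
  intros Hp HN. assert (HI : 2 <= INR N) by (apply (le_INR 2); lia).
  destruct (Req_dec c 1) as [->|h].
  - exists (N - 1)%nat. split. lia.
    assert (E : grid N (N - 1) = 1 - 2 / INR N).
    { unfold grid. rewrite minus_INR by lia. simpl. field. lra. }
    rewrite E.
    assert (0 < 2 / INR N <= 1).
    { split. apply Rdiv_lt_0_compat; lra. apply Rmult_le_reg_r with (INR N). lra.
      unfold Rdiv. rewrite Rmult_assoc, Rinv_l by lra. lra. }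
    destruct p as [|q]; [lia|]. simpl.
    assert (0 <= (1 - 2 / INR N) ^ q <= 1).
    { split. apply pow_le; lra.
      pose proof (pow_incr (1 - 2 / INR N) 1 q ltac:(lra)) as Hq. rewrite pow1 in Hq. auto. }
    nra.
  - exists N. split. lia. replace (grid N N) with 1 by (unfold grid; field; lra). rewrite pow1. auto.
Qed.

(* Subtracting [exp (N d y0)] inside the weighted sum, with [y0] the mean, makes every term nonnegative. *)
Lemma mean_p_increasing (p : nat) (b b' h : R) (N : nat) : (1 <= p)%nat -> (2 <= N)%nat -> b < b' ->
  mean_p p b h N < mean_p p b' h N.
Proof.
  intros Hp HN Hb.
  set (d := b' - b). replace b' with (b + d) by (unfold d; ring).
  assert (Hd : 0 < d) by (unfold d; lra).
  set (y0 := mean_p p b h N).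
  assert (HI : 0 < INR N) by (apply lt_0_INR; lia).
  enough (0 < (mean_p p (b + d) h N - y0) * sum_f_R0 (gibbs_weight p (b + d) h N) N).
  { pose proof (gibbs_weight_sum_pos p (b + d) h N). apply Rnot_le_lt. intros Hle. nra. }
  unfold mean_p at 1. rewrite <- model_mean_weighted.
  assert (E0 : sum_f_R0 (fun k => gibbs_weight p b h N k * (grid N k ^ p - y0)) N = 0).
  { rewrite model_mean_weighted. unfold y0, mean_p. ring. }
  replace (sum_f_R0 (fun k => gibbs_weight p (b + d) h N k * (grid N k ^ p - y0)) N)
    with (sum_f_R0 (fun k => gibbs_weight p b h N k * ((exp (INR N * d * grid N k ^ p) - exp (INR N * d * y0)) * (grid N k ^ p - y0))) N).
  2:{ rewrite (sum_eq _ (fun k => gibbs_weight p (b + d) h N k * (grid N k ^ p - y0)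
        - gibbs_weight p b h N k * (grid N k ^ p - y0) * exp (INR N * d * y0))).
      - rewrite minus_sum.
        rewrite <- (scal_sum (fun k => gibbs_weight p b h N k * (grid N k ^ p - y0)) N (exp (INR N * d * y0))).
        rewrite E0. ring.
      - intros k _. rewrite gibbs_weight_shift. ring. }
  assert (HNd : 0 < INR N * d) by nra.
  assert (Hs : forall x, x <> y0 -> 0 < (exp (INR N * d * x) - exp (INR N * d * y0)) * (x - y0)).
  { intros x Hx. destruct (Rdichotomy _ _ Hx) as [h1|h1].
    - assert (exp (INR N * d * x) < exp (INR N * d * y0)) by (apply exp_increasing; nra). nra.
    - assert (exp (INR N * d * y0) < exp (INR N * d * x)) by (apply exp_increasing; nra). nra. }
  destruct (grid_pow_nonconstant p N y0 Hp HN) as [j [Hj1 Hj2]].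
  apply sum_nonneg_pos with j; auto.
  - intros k Hk. apply Rmult_le_pos. left; apply gibbs_weight_pos.
    destruct (Req_dec (grid N k ^ p) y0) as [->|hk]. right; ring. left; auto.
  - apply Rmult_lt_0_compat. apply gibbs_weight_pos. auto.
Qed.

Lemma continuous_sum_f_R0 (f : R -> nat -> R) (n : nat) (b : R) :
  (forall k, continuous (fun b => f b k) b) -> continuous (fun b => sum_f_R0 (f b) n) b.
Proof.
  intros H. induction n as [|n IH]; simpl. auto.
  apply (continuous_plus (fun b => sum_f_R0 (f b) n) (fun b => f b (S n))); auto.
Qed.

Lemma continuous_gibbs_weight (p : nat) (h b : R) (N k : nat) : continuous (fun b => gibbs_weight p b h N k) b.
Proof.
  apply (ex_derive_continuous (fun b => gibbs_weight p b h N k)). unfold gibbs_weight. auto_derive. auto.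
Qed.

Lemma continuous_mean_p (p : nat) (h b : R) (N : nat) : continuous (fun b => mean_p p b h N) b.
Proof.
  unfold mean_p, model_mean.
  apply (continuous_mult (fun b => sum_f_R0 (fun k => gibbs_weight p b h N k * grid N k ^ p) N)
     (fun b => / sum_f_R0 (gibbs_weight p b h N) N)).
  - apply (continuous_sum_f_R0 (fun b k => gibbs_weight p b h N k * grid N k ^ p)). intros k.
    apply (continuous_mult (fun b => gibbs_weight p b h N k) (fun _ => grid N k ^ p)).
    apply continuous_gibbs_weight. apply continuous_const.
  - apply continuous_Rinv_comp. apply (continuous_sum_f_R0 (fun b => gibbs_weight p b h N)).
    intros; apply continuous_gibbs_weight. pose proof (gibbs_weight_sum_pos p b h N). lra.
Qed.

Lemma mean_p_ivt (p : nat) (h b1 b2 t : R) (N : nat) :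
  mean_p p b1 h N <= t <= mean_p p b2 h N -> exists b, mean_p p b h N = t.
Proof.
  intros Ht.
  destruct (IVT_gen (fun b => mean_p p b h N) b1 b2 t) as [b [_ Hb]].
  - intros x. apply continuity_pt_filterlim. apply continuous_mean_p.
  - rewrite Rmin_left, Rmax_right by lra. lra.
  - exists b; auto.
Qed.

(** [betahat] sees a configuration only through its mean; with the mean made a variable,
    [betahat p h N s] is [mle_at p h N (mean N s)] by conversion. *)
Definition mle_at (p : nat) (h : R) (N : nat) (x : R) : Rbar :=
  let t := x ^ p in
  match excluded_middle_informative
          (exists b, Emodel p b h N (fun s' => mean N s' ^ p) = t) with
  | left H => Finite (proj1_sig (constructive_indefinite_description _ H))
  | right _ =>
      if Rle_dec t (Emodel p 0 h N (fun s' => mean N s' ^ p)) then m_infty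
      else p_infty
  end.

(** The infinite values obey the same rule: if x^p is not attained, the intermediate value theorem
    puts it entirely below or entirely above the range of the mean, and the comparison at parameter
    0 tells which. *)
Lemma mle_at_le (p : nat) (h : R) (N : nat) (x b : R) : (1 <= p)%nat -> (2 <= N)%nat ->
  Rbar_le (mle_at p h N x) b <-> x ^ p <= mean_p p b h N.
Proof.
  intros Hp HN.
  assert (HE : forall b, Emodel p b h N (fun s' => mean N s' ^ p) = mean_p p b h N).
  { intros b'. apply (Emodel_model_mean p b' h N (fun y => y ^ p)). lia. }
  unfold mle_at. destruct (excluded_middle_informative _) as [Hex|Hnex].
  - destruct (constructive_indefinite_description _ Hex) as [b0 Hb0]. simpl.
    rewrite HE in Hb0. rewrite <- Hb0. split.
    + intros [h1| ->]; [left; apply mean_p_increasing; auto|lra].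
    + intros Hle. apply Rnot_lt_le. intros Hlt.
      pose proof (mean_p_increasing p b b0 h N Hp HN Hlt). lra.
  - rewrite HE.
    assert (Hn : forall b1 b2, ~ (mean_p p b1 h N <= x ^ p <= mean_p p b2 h N)).
    { intros b1 b2 Hc. apply Hnex. destruct (mean_p_ivt _ _ _ _ _ _ Hc) as [b' Hb'].
      exists b'. rewrite HE. auto. }
    destruct (Rle_dec (x ^ p) (mean_p p 0 h N)) as [h0|h0]; simpl.
    + split; auto. intros _. apply Rnot_lt_le. intros Hlt. apply (Hn b 0). lra.
    + split; [tauto|]. intros Hle. apply (Hn 0 b). lra.
Qed.

Definition err_at (p : nat) (beta h : R) (N : nat) (x : R) : Rbar :=
  Rbar_mult (sqrt (INR N)) (Rbar_minus (mle_at p h N x) beta).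

Lemma Rbar_affine_le (y : Rbar) (beta r t : R) : 0 < r ->
  Rbar_le (Rbar_mult r (Rbar_minus y beta)) t <-> Rbar_le y (beta + t / r).
Proof.
  intros Hr. destruct y as [y| |].
  - simpl. assert (0 < / r) by (apply Rinv_0_lt_compat; auto).
    split; intros H1.
    + apply Rmult_le_compat_r with (r := / r) in H1; [|lra].
      replace (r * (y + - beta) * / r) with (y - beta) in H1 by (field; lra).
      unfold Rdiv. lra.
    + apply Rmult_le_compat_l with (r := r) in H1; [|lra].
      replace (r * (beta + t / r)) with (r * beta + t) in H1 by (field; lra). lra.
  - replace (Rbar_mult r (Rbar_minus p_infty beta)) with p_infty. simpl; tauto.
    simpl. destruct (Rle_dec 0 r) as [h1|h1]; [|lra].
    destruct (Rle_lt_or_eq_dec 0 r h1); auto; lra.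
  - replace (Rbar_mult r (Rbar_minus m_infty beta)) with m_infty. simpl; tauto.
    simpl. destruct (Rle_dec 0 r) as [h1|h1]; [|lra].
    destruct (Rle_lt_or_eq_dec 0 r h1); auto; lra.
Qed.

Lemma err_at_le (p : nat) (beta h : R) (N : nat) (x t : R) : (1 <= p)%nat -> (2 <= N)%nat ->
  Rbar_le (err_at p beta h N x) t <-> x ^ p <= mean_p p (beta + t / sqrt (INR N)) h N.
Proof.
  intros Hp HN. unfold err_at. rewrite Rbar_affine_le by (apply sqrt_INR_pos; lia).
  apply mle_at_le; auto.
Qed.

(** * Laplace asymptotics *)

(** Difference quotients of first and second order, filled in at [m] by their expected limit. Taylor
    expansions thereby become exact identities with a factor that converges, and no remainder term
    is carried. *)
Definition quot1 (f : R -> R) (m l x : R) : R :=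
  if Req_EM_T x m then l else (f x - f m) / (x - m).
Definition quot2 (f : R -> R) (m l x : R) : R :=
  if Req_EM_T x m then l else (f x - f m) / (x - m) ^ 2.

Lemma quot1_eq (f : R -> R) (m l x : R) : f x - f m = (x - m) * quot1 f m l x.
Proof. unfold quot1. destruct (Req_EM_T x m) as [->|h]. ring. field. lra. Qed.

Lemma quot2_eq (f : R -> R) (m l x : R) : f x - f m = (x - m) ^ 2 * quot2 f m l x.
Proof. unfold quot2. destruct (Req_EM_T x m) as [->|h]. ring. field. lra. Qed.

Lemma quot1_lim (f : R -> R) (m l : R) : is_derive f m l ->
  filterlim (quot1 f m l) (locally m) (locally l).
Proof.
  intros Hd. apply is_derive_Reals in Hd. apply filterlim_locally. intros eps.
  destruct (Hd eps (cond_pos eps)) as [d Hd'].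
  exists d. intros y Hy. change (Rabs (y - m) < d) in Hy.
  change (Rabs (quot1 f m l y - l) < eps). unfold quot1.
  destruct (Req_EM_T y m) as [->|h].
  - rewrite Rminus_diag, Rabs_R0. apply cond_pos.
  - specialize (Hd' (y - m) ltac:(lra) Hy). rewrite Rplus_minus in Hd'. auto.
Qed.

Lemma quot2_lim (p : nat) (beta h m : R) : (2 <= p)%nat -> -1 < m < 1 -> H1f p beta h m = 0 ->
  filterlim (quot2 (Hfun p beta h) m (H2f p beta m / 2)) (locally m) (locally (H2f p beta m / 2)).
Proof.
  intros Hp Hm H1.
  pose proof (is_derive_H1f p beta h m Hp Hm) as Hd. apply is_derive_Reals in Hd.
  set (l := H2f p beta m) in *.
  apply filterlim_locally. intros eps.
  assert (He : 0 < eps / 2) by (pose proof (cond_pos eps); lra).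
  destruct (Hd _ He) as [d Hd']. pose proof (cond_pos d) as Hdp.
  assert (Hr : 0 < Rmin d (Rmin (1 + m) (1 - m))) by (repeat apply Rmin_pos; lra).
  exists (mkposreal _ Hr). intros y Hy.
  change (Rabs (y - m) < Rmin d (Rmin (1 + m) (1 - m))) in Hy.
  change (Rabs (quot2 (Hfun p beta h) m (l / 2) y - l / 2) < eps). unfold quot2.
  destruct (Req_EM_T y m) as [->|h0].
  { rewrite Rminus_diag, Rabs_R0. apply cond_pos. }
  assert (B1 : Rabs (y - m) < d) by (eapply Rlt_le_trans; [apply Hy|apply Rmin_l]).
  assert (B2 : Rabs (y - m) < 1 + m).
  { eapply Rlt_le_trans; [apply Hy|]. eapply Rle_trans; [apply Rmin_r|apply Rmin_l]. }
  assert (B3 : Rabs (y - m) < 1 - m).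
  { eapply Rlt_le_trans; [apply Hy|]. eapply Rle_trans; [apply Rmin_r|apply Rmin_r]. }
  (* The mean value theorem for H minus its quadratic part: the derivative H'(c) - l (c - m) is o(c
     - m) from differentiability of H' at [m] alone. *)
  destruct (MVT_gen (fun x => Hfun p beta h x - l / 2 * (x - m) ^ 2) m y
     (fun x => H1f p beta h x - l * (x - m))) as [c [Hc1 Hc2]].
  - intros x Hx. apply Rabs_def2 in B2, B3.
    assert (-1 < x < 1) by (destruct (Rle_dec m y); [rewrite Rmin_left, Rmax_right in Hx by lra|rewrite Rmin_right, Rmax_left in Hx by lra]; lra).
    replace (l * (x - m)) with (l / 2 * (2 * (x - m))) by field.
    apply (is_derive_minus (Hfun p beta h) (fun x => l / 2 * (x - m) ^ 2)).
    apply is_derive_Hfun; auto. auto_derive; auto. field.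
  - intros x _. apply continuity_pt_filterlim.
    apply (continuous_minus (Hfun p beta h) (fun x => l / 2 * (x - m) ^ 2)).
    apply continuous_Hfun. apply (ex_derive_continuous (fun x => l / 2 * (x - m) ^ 2)). auto_derive; auto.
  - assert (Hcm : Rabs (c - m) <= Rabs (y - m)).
    { destruct (Rle_dec m y); [rewrite Rmin_left, Rmax_right in Hc1 by lra; rewrite !Rabs_right by lra; lra|].
      rewrite Rmin_right, Rmax_left in Hc1 by lra. rewrite !Rabs_left1 by lra; lra. }
    assert (Hc3 : Rabs (H1f p beta h c - l * (c - m)) <= eps / 2 * Rabs (c - m)).
    { destruct (Req_dec c m) as [->|hc].
      - rewrite H1, Rminus_diag. replace (0 - l * 0) with 0 by ring. rewrite Rabs_R0. lra.
      - specialize (Hd' (c - m) ltac:(lra) ltac:(lra)).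
        rewrite Rplus_minus in Hd'. rewrite H1, Rminus_0_r in Hd'.
        replace (H1f p beta h c - l * (c - m)) with ((H1f p beta h c / (c - m) - l) * (c - m)) by (field; lra).
        rewrite Rabs_mult. apply Rmult_le_compat_r. apply Rabs_pos. lra. }
    assert (Hne : 0 < Rabs (y - m)) by (apply Rabs_pos_lt; lra).
    replace ((Hfun p beta h y - Hfun p beta h m) / (y - m) ^ 2 - l / 2)
      with ((H1f p beta h c - l * (c - m)) / (y - m)).
    2:{ replace (Hfun p beta h y - Hfun p beta h m) with
         ((H1f p beta h c - l * (c - m)) * (y - m) + l / 2 * (y - m) ^ 2).
        field. lra. rewrite <- Hc2. ring. }
    unfold Rdiv. rewrite Rabs_mult, Rabs_inv.
    apply Rle_lt_trans with (eps / 2).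
    2: lra.
    apply Rmult_le_reg_r with (Rabs (y - m)); auto.
    rewrite Rmult_assoc, Rinv_l by lra. rewrite Rmult_1_r.
    eapply Rle_trans. apply Hc3. apply Rmult_le_compat_l; lra.
Qed.

Lemma pow_abs_le_1 (n : nat) (x : R) : -1 <= x <= 1 -> Rabs (x ^ n) <= 1.
Proof.
  intros Hx. rewrite <- RPow_abs. pose proof (pow_incr (Rabs x) 1 n) as H. rewrite pow1 in H.
  apply H. split. apply Rabs_pos. apply Rabs_le; lra.
Qed.

Lemma pow_diff_le (p : nat) (x y : R) : -1 <= x <= 1 -> -1 <= y <= 1 ->
  Rabs (x ^ p - y ^ p) <= INR p * Rabs (x - y).
Proof.
  intros Hx Hy. induction p as [|p IH].
  - simpl. rewrite Rminus_diag, Rabs_R0. pose proof (Rabs_pos (x - y)). lra.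
  - rewrite S_INR. simpl.
    replace (x * x ^ p - y * y ^ p) with (x * (x ^ p - y ^ p) + (x - y) * y ^ p) by ring.
    eapply Rle_trans. apply Rabs_triang. rewrite !Rabs_mult.
    assert (Rabs x <= 1) by (apply Rabs_le; lra).
    pose proof (pow_abs_le_1 p y Hy).
    pose proof (Rabs_pos (x ^ p - y ^ p)). pose proof (Rabs_pos (x - y)). pose proof (Rabs_pos x).
    pose proof (Rabs_pos (y ^ p)). nra.
Qed.

(** The rate 1/4 is what [well_ok] leaves of the Gaussian. Two units of linear exponent pay for (1 +
    z^2)^2 <= 16 exp (2 |z|), and completing the square gives the constant. *)
Lemma gauss_dom (a : R) : 0 <= a ->
  forall z, exp (- z ^ 2 / 4) * exp (a * Rabs z) <= 16 * exp ((a + 2) ^ 2) / (1 + z ^ 2) ^ 2.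
Proof.
  intros Ha z.
  assert (Hz : 1 + z ^ 2 <= 4 * exp (Rabs z)).
  { rewrite <- (pow2_abs z). pose proof (Rabs_pos z). set (u := Rabs z) in *.
    replace (exp u) with (exp (u / 2) * exp (u / 2)) by (rewrite <- exp_plus; f_equal; field).
    assert (1 + u / 2 <= exp (u / 2)).
    { destruct H as [H|H]. left. apply exp_ineq1. lra. rewrite <- H.
      replace (0 / 2) with 0 by field. rewrite exp_0. lra. }
    nra. }
  assert (Hz2 : (1 + z ^ 2) ^ 2 <= 16 * exp (2 * Rabs z)).
  { replace (16 * exp (2 * Rabs z)) with ((4 * exp (Rabs z)) ^ 2).
    apply pow_incr. nra.
    replace (2 * Rabs z) with (Rabs z + Rabs z) by ring. rewrite exp_plus. ring. }
  assert (HD : 0 < (1 + z ^ 2) ^ 2) by (apply pow_lt; nra).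
  apply Rmult_le_reg_r with ((1 + z ^ 2) ^ 2); auto.
  unfold Rdiv at 2. rewrite Rmult_assoc, Rmult_assoc, Rinv_l, Rmult_1_r by lra.
  apply Rle_trans with (exp (- z ^ 2 / 4) * (exp (a * Rabs z) * (16 * exp (2 * Rabs z)))).
  { apply Rmult_le_compat_l. left; apply exp_pos. apply Rmult_le_compat_l. left; apply exp_pos. auto. }
  replace (exp (- z ^ 2 / 4) * (exp (a * Rabs z) * (16 * exp (2 * Rabs z))))
    with (16 * exp (- z ^ 2 / 4 + (a * Rabs z + 2 * Rabs z))) by (rewrite !exp_plus; ring).
  apply Rmult_le_compat_l. lra. apply exp_mono.
  rewrite <- (pow2_abs z). pose proof (pow2_ge_0 (Rabs z / 2 - (a + 2))). nra.
Qed.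

Lemma expbound_dom (Phi : R -> R) (B b th : R) : 0 <= b ->
  (forall z, Rabs (Phi z) <= B * exp (b * Rabs z)) ->
  forall z, Rabs (Phi z * exp (th * z) * gexp z) <= B * (16 * exp ((Rabs th + b + 2) ^ 2)) / (1 + z ^ 2) ^ 2.
Proof.
  intros Hb HP z.
  assert (HB : 0 <= B).
  { specialize (HP 0). pose proof (Rabs_pos (Phi 0)). rewrite Rabs_R0, Rmult_0_r, exp_0 in HP. lra. }
  pose proof (Rabs_pos th) as Hth.
  pose proof (gauss_dom (Rabs th + b) ltac:(lra) z) as HG.
  rewrite !Rabs_mult, (Rabs_right (exp _)), (Rabs_right (gexp _)) by (left; apply exp_pos).
  apply Rle_trans with ((B * exp (b * Rabs z)) * exp (Rabs th * Rabs z) * exp (- z ^ 2 / 4)).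
  - apply Rmult_le_compat.
    + apply Rmult_le_pos. apply Rabs_pos. left; apply exp_pos.
    + left; apply exp_pos.
    + apply Rmult_le_compat; auto. apply Rabs_pos. left; apply exp_pos.
      apply exp_mono. rewrite <- Rabs_mult. apply Rle_abs.
    + unfold gexp. apply exp_mono. nra.
  - replace (B * exp (b * Rabs z) * exp (Rabs th * Rabs z) * exp (- z ^ 2 / 4))
      with (B * (exp (- z ^ 2 / 4) * exp ((Rabs th + b) * Rabs z))).
    2:{ replace ((Rabs th + b) * Rabs z) with (b * Rabs z + Rabs th * Rabs z) by ring.
        rewrite exp_plus. ring. }
    unfold Rdiv at 2. rewrite Rmult_assoc. apply Rmult_le_compat_l; auto.
Qed.

Lemma inv_sqr_dom (D z : R) : 0 <= D -> D / (1 + z ^ 2) ^ 2 <= D / (1 + z ^ 2).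
Proof. intros HD. apply Rmult_le_compat_l; auto. apply Rinv_le_contravar; nra. Qed.

Definition curvature (p : nat) (beta m : R) : R := - H2f p beta m.
Definition curvature_sqrt (p : nat) (beta m : R) : R := sqrt (curvature p beta m).
(** Near [m] the exponent t sqrt N (x^p - m^p) tends to this slope times z. *)
Definition tilt_slope (p : nat) (beta m t : R) : R := t * (INR p * m ^ (p - 1)) / curvature_sqrt p beta m.

Definition chi (d m x : R) : R := if Rlt_dec (Rabs (x - m)) d then 1 else 0.

(* Normalised so that a grid point near a maximizer with [p]-th power [M] keeps a weight of order [1 / sqrt N]. *)
Definition tilted_weight (p : nat) (beta h Hs t M : R) (N k : nat) : R :=
  binw N k * exp (INR N * (Hfun p beta h (grid N k) - Hs) + t * sqrt (INR N) * (grid N k ^ p - M)).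

(** The extra factor does not depend on k, so ratios of sums of tilted weights are exactly means in
    the model at beta + t / sqrt N. *)
Lemma tilted_weight_wt (p : nat) (beta h Hs t M : R) (N k : nat) : (1 <= N)%nat ->
  tilted_weight p beta h Hs t M N k =
  gibbs_weight p (beta + t / sqrt (INR N)) h N k * exp (- (INR N * Hs + t * sqrt (INR N) * M)).
Proof.
  intros HN. pose proof (sqrt_INR_pos N HN) as Hq.
  unfold tilted_weight, gibbs_weight, binw. rewrite !Rmult_assoc, <- !exp_plus. do 2 f_equal. unfold Hfun.
  assert (E : INR N * (t / sqrt (INR N)) = t * sqrt (INR N)).
  { assert (0 < INR N) by (apply lt_0_INR; lia).
    rewrite <- (sqrt_sqrt (INR N)) at 1 by lra. field. lra. }
  replace (INR N * ((beta + t / sqrt (INR N)) * grid N k ^ p + h * grid N k)) with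
   (INR N * (beta * grid N k ^ p + h * grid N k) + INR N * (t / sqrt (INR N)) * grid N k ^ p) by ring.
  rewrite E. ring.
Qed.

(** Half of the true quadratic decay is kept as a uniform bound on the window; the distance to the
    endpoints is what [binw_window_bound] requires. *)
Definition well_ok (p : nat) (beta h m d : R) : Prop :=
  forall x, Rabs (x - m) < d ->
    Hfun p beta h x - Hfun p beta h m <= - (curvature p beta m / 4) * (x - m) ^ 2 /\ Rabs x <= 1 - d.

Lemma well_ok_ex (p : nat) (beta h m : R) : (3 <= p)%nat -> nondeg_max p beta h m ->
  exists d0, 0 < d0 /\ forall d, 0 < d <= d0 -> well_ok p beta h m d.
Proof.
  intros Hp [Im [Cm [Nm _]]].
  assert (He : 0 < curvature p beta m / 4) by (unfold curvature; lra).
  destruct (proj1 (filterlim_locally (F := locally m) _ _) (quot2_lim p beta h m ltac:(lia) Im Cm) (mkposreal _ He)) as [d1 Hd1].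
  set (d2 := Rmin (1 + m) (1 - m) / 2).
  assert (Hd2 : 0 < d2) by (unfold d2; apply Rdiv_lt_0_compat; [apply Rmin_pos|]; lra).
  pose proof (Rmin_l (1 + m) (1 - m)) as e1. pose proof (Rmin_r (1 + m) (1 - m)) as e2.
  exists (Rmin d1 d2). split. apply Rmin_pos; auto. apply cond_pos.
  intros d [Hd0 Hd] x Hx.
  pose proof (Rmin_l d1 d2). pose proof (Rmin_r d1 d2).
  split.
  - rewrite (quot2_eq (Hfun p beta h) m (H2f p beta m / 2)).
    assert (Hb : ball m d1 x) by (change (Rabs (x - m) < d1); lra).
    specialize (Hd1 x Hb).
    change (Rabs (quot2 (Hfun p beta h) m (H2f p beta m / 2) x - H2f p beta m / 2) < curvature p beta m / 4) in Hd1.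
    apply Rabs_def2 in Hd1. unfold curvature in *. pose proof (pow2_ge_0 (x - m)). nra.
  - apply Rabs_def2 in Hx. unfold d2 in *. apply Rabs_le. lra.
Qed.

(* [Phi] may jump at [r] and [- r]. *)
Definition local_lim (p : nat) (beta t m : R) (phi : nat -> nat -> R) (J : R) : Prop :=
  exists (Phi : R -> R) (B b r : R), 0 <= b /\
   (forall z, z <> r -> z <> - r ->
      filterlim (fun q => phi (fst q) (snd q)) (grid_filter (curvature_sqrt p beta m) m z) (locally (Phi z))) /\
   (forall z, z <> r -> z <> - r -> continuous Phi z) /\
   (forall u v, ex_RInt (fun z => Phi z * exp (tilt_slope p beta m t * z) * gexp z) u v) /\
   (forall N k, (1 <= N)%nat -> (k <= N)%nat ->
      Rabs (phi N k) <= B * exp (b * Rabs (zgrid (curvature_sqrt p beta m) m N k))) /\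
   (forall z, Rabs (Phi z) <= B * exp (b * Rabs z)) /\
   is_RIntR (fun z => Phi z * exp (tilt_slope p beta m t * z) * gexp z) J.

Lemma chi_lim (d m s z : R) : 0 < s -> 0 < d ->
  filterlim (fun q => chi d m (grid (fst q) (snd q))) (grid_filter s m z) (locally 1).
Proof.
  intros Hs Hd. apply filterlim_ext_loc with (fun _ => 1).
  - generalize (proj1 (filterlim_locally _ _) (grid_filter_grid s m z Hs) (mkposreal d Hd)).
    apply filter_imp. intros [N k] Hx. change (Rabs (grid N k - m) < d) in Hx.
    simpl. unfold chi. destruct (Rlt_dec _ _); auto. contradiction.
  - apply filterlim_const.
Qed.

Lemma filterlim_Rmult {T : Type} (F : (T -> Prop) -> Prop) {FF : Filter F} (f g : T -> R) (a b : R) :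
  filterlim f F (locally a) -> filterlim g F (locally b) ->
  filterlim (fun x => f x * g x) F (locally (a * b)).
Proof.
  intros Hf Hg. apply (filterlim_comp_2 (G := locally a) (H := locally b) f g Rmult); auto.
  apply (filterlim_mult a b).
Qed.

Lemma filterlim_cont {T : Type} (F : (T -> Prop) -> Prop) {FF : Filter F} (f : T -> R) (g : R -> R) (a : R) :
  filterlim f F (locally a) -> continuous g a -> filterlim (fun x => g (f x)) F (locally (g a)).
Proof. intros Hf Hg. apply (filterlim_comp _ _ _ f g _ (locally a)); auto. Qed.

Lemma continuous_exp_R (x : R) : continuous exp x.
Proof. apply (ex_derive_continuous exp). auto_derive. auto. Qed.

Lemma tilted_weight_local (p : nat) (beta h m t : R) (N k : nat) : 0 < curvature p beta m ->
  exp (INR N * (Hfun p beta h (grid N k) - Hfun p beta h m)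
       + t * sqrt (INR N) * (grid N k ^ p - m ^ p)) =
  exp (zgrid (curvature_sqrt p beta m) m N k * zgrid (curvature_sqrt p beta m) m N k * / curvature p beta m
         * quot2 (Hfun p beta h) m (H2f p beta m / 2) (grid N k)) *
  exp (t / curvature_sqrt p beta m * zgrid (curvature_sqrt p beta m) m N k
         * quot1 (fun x => x ^ p) m (INR p * m ^ (p - 1)) (grid N k)).
Proof.
  intros Hl. rewrite <- exp_plus. f_equal.
  rewrite (quot2_eq (Hfun p beta h) m (H2f p beta m / 2)).
  rewrite (quot1_eq (fun x => x ^ p) m (INR p * m ^ (p - 1))).
  assert (Hs : 0 < curvature_sqrt p beta m) by (apply sqrt_lt_R0; auto).
  assert (E : curvature p beta m = curvature_sqrt p beta m * curvature_sqrt p beta m) by (unfold curvature_sqrt; rewrite sqrt_sqrt; lra).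
  unfold zgrid.
  replace (INR N) with (sqrt (INR N) * sqrt (INR N)) at 1 by (apply sqrt_sqrt, pos_INR).
  rewrite E. field. lra.
Qed.

(** Laplace's method as a Riemann sum: [binw] supplies the constant, the quadratic part of H the
    Gaussian, the tilt the factor exp (th z), and [phi] its limit [Phi]. On the window [well_ok]
    supplies the majorant. *)
Lemma laplace_well (p : nat) (beta h m d t A J : R) (phi : nat -> nat -> R) :
  (3 <= p)%nat -> nondeg_max p beta h m -> 0 < d -> well_ok p beta h m d ->
  0 < A -> is_lim_seq stirling A -> local_lim p beta t m phi J ->
  is_lim_seq (fun N => sum_f_R0 (fun k => chi d m (grid N k) *
      (tilted_weight p beta h (Hfun p beta h m) t (m ^ p) N k * phi N k)) N)
    (/ A * (/ (curvature_sqrt p beta m * sqrt (1 - m ^ 2)) * J)).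
Proof.
  intros Hp [Im [Cm [Nm _]]] Hd Hok HA Hst [Phi [B [b [r [Hb [Hlim [Hcont [Hex [Bphi [BPhi HJ]]]]]]]]]].
  assert (Hl : 0 < curvature p beta m) by (unfold curvature; lra).
  set (s := curvature_sqrt p beta m) in *.
  assert (Hs : 0 < s) by (apply sqrt_lt_R0; auto).
  assert (Es : curvature p beta m = s * s) by (unfold s, curvature_sqrt; rewrite sqrt_sqrt; lra).
  assert (Hm2 : 0 < sqrt (1 - m ^ 2)) by (apply sqrt_lt_R0; nra).
  set (th := tilt_slope p beta m t) in *.
  set (c0 := / A * / (s * sqrt (1 - m ^ 2))).
  assert (Hc0 : 0 < c0).
  { unfold c0. apply Rmult_lt_0_compat; apply Rinv_0_lt_compat; auto. apply Rmult_lt_0_compat; auto. }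
  (* Scaled so that the mesh 2 s / sqrt N times [f] is the original term. *)
  set (f := fun N k => / (2 * s) * (sqrt (INR N) * binw N k) * (chi d m (grid N k) *
     exp (INR N * (Hfun p beta h (grid N k) - Hfun p beta h m)
       + t * sqrt (INR N) * (grid N k ^ p - m ^ p))) * phi N k).
  set (F := fun z => c0 * (Phi z * exp (th * z) * gexp z)).
  set (a := Rabs t * INR p / s + b).
  assert (Ha : 0 <= a).
  { unfold a. assert (0 <= Rabs t * INR p / s); [|lra].
    apply Rdiv_le_0_compat; auto. apply Rmult_le_pos. apply Rabs_pos. apply pos_INR. }
  assert (HB : 0 <= B).
  { specialize (BPhi 0). pose proof (Rabs_pos (Phi 0)). rewrite Rabs_R0, Rmult_0_r, exp_0 in BPhi. lra. }
  set (a2 := Rabs th + b).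
  assert (Ha2 : 0 <= a2) by (unfold a2; pose proof (Rabs_pos th); lra).
  (* [D1] dominates the grid terms and [D2] the limit function; [grid_dct] takes one constant for
     both. *)
  set (D1 := / (2 * s) * (6 / d) * B * (16 * exp ((a + 2) ^ 2))).
  set (D2 := c0 * B * (16 * exp ((a2 + 2) ^ 2))).
  assert (H2s : 0 < / (2 * s)) by (apply Rinv_0_lt_compat; lra).
  assert (H6d : 0 < 6 / d) by (apply Rdiv_lt_0_compat; lra).
  assert (HD1 : 0 <= D1).
  { unfold D1. pose proof (exp_pos ((a+2)^2)). repeat apply Rmult_le_pos; lra. }
  assert (HD2 : 0 <= D2).
  { unfold D2. pose proof (exp_pos ((a2+2)^2)). apply Rmult_le_pos; [apply Rmult_le_pos|]; lra. }
  apply is_lim_seq_ext_loc with (fun N => sum_f_R0 (fun k => 2 * s / sqrt (INR N) * f N k) N).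
  { exists 1%nat. intros N HN. pose proof (sqrt_INR_pos N HN) as Hq. apply sum_eq. intros k _.
    unfold f, tilted_weight. field. lra. }
  replace (Finite (/ A * (/ (s * sqrt (1 - m ^ 2)) * J))) with (Finite (c0 * J))
    by (f_equal; unfold c0; ring).
  apply (grid_dct s m r (D1 + D2) (c0 * J) f F); auto.
  - intros z h1 h2. unfold F, f.
    replace (c0 * (Phi z * exp (th * z) * gexp z)) with
     (/ (2 * s) * (2 / (A * sqrt (1 - m ^ 2))) * (1 * (gexp z * exp (th * z))) * Phi z)
      by (unfold c0; field; lra).
    apply filterlim_Rmult; [typeclasses eauto| |apply Hlim; auto].
    apply filterlim_Rmult; [typeclasses eauto| |].
    + apply filterlim_Rmult. typeclasses eauto. apply filterlim_const. apply binw_lim; auto.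
    + apply filterlim_Rmult. typeclasses eauto. apply chi_lim; auto.
      apply filterlim_ext with (fun q => exp (zgrid s m (fst q) (snd q) * zgrid s m (fst q) (snd q) * / curvature p beta m
         * quot2 (Hfun p beta h) m (H2f p beta m / 2) (grid (fst q) (snd q))) *
        exp (t / s * zgrid s m (fst q) (snd q)
         * quot1 (fun x => x ^ p) m (INR p * m ^ (p - 1)) (grid (fst q) (snd q)))).
      { intros q. symmetry. apply tilted_weight_local; auto. }
      replace (gexp z) with (exp (z * z * / curvature p beta m * (H2f p beta m / 2))).
      2:{ unfold gexp. f_equal. unfold curvature. field. lra. }
      replace (exp (th * z)) with (exp (t / s * z * (INR p * m ^ (p - 1)))).
      2:{ f_equal. unfold th, tilt_slope. fold s. field. lra. }
      apply filterlim_Rmult; [typeclasses eauto| |].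
      * apply filterlim_cont; [typeclasses eauto| |apply continuous_exp_R].
        apply filterlim_Rmult; [typeclasses eauto| |].
        -- apply filterlim_Rmult; [typeclasses eauto| |apply filterlim_const].
           apply filterlim_Rmult; [typeclasses eauto| |]; apply grid_filter_zgrid.
        -- eapply filterlim_comp. apply grid_filter_grid; auto. apply quot2_lim; auto. lia.
      * apply filterlim_cont; [typeclasses eauto| |apply continuous_exp_R].
        apply filterlim_Rmult; [typeclasses eauto| |].
        -- apply filterlim_Rmult; [typeclasses eauto|apply filterlim_const|apply grid_filter_zgrid].
        -- eapply filterlim_comp. apply grid_filter_grid; auto. apply quot1_lim.
           auto_derive; auto. replace (Init.Nat.pred p) with (p - 1)%nat by lia. ring.
  - intros z h1 h2. unfold F.
    apply (continuous_scal_r c0 (fun z => Phi z * exp (th * z) * gexp z)).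
    apply (continuous_mult (fun z => Phi z * exp (th * z)) gexp). 2: apply continuous_gexp.
    apply (continuous_mult Phi (fun z => exp (th * z))). auto.
    apply (ex_derive_continuous (fun z => exp (th * z))). auto_derive; auto.
  - intros u v. apply (ex_RInt_scal (fun z => Phi z * exp (th * z) * gexp z)). auto.
  - intros N k HN Hk. unfold f.
    set (z := zgrid s m N k).
    assert (HP : 0 < (1 + z ^ 2) ^ 2) by (apply pow_lt; nra).
    apply Rle_trans with (D1 / (1 + z ^ 2) ^ 2).
    2:{ apply Rmult_le_compat_r. left; apply Rinv_0_lt_compat; auto. lra. }
    unfold chi. destruct (Rlt_dec (Rabs (grid N k - m)) d) as [hx|hx].
    2:{ rewrite !Rmult_0_l, Rmult_0_r, Rmult_0_l, Rabs_R0. apply Rdiv_le_0_compat; auto. }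
    destruct (Hok _ hx) as [k1 k2].
    pose proof (binw_window_bound N k d HN Hk Hd k2) as k3. pose proof (binw_pos N k) as k4.
    pose proof (sqrt_INR_pos N HN) as k5.
    rewrite !Rabs_mult, Rabs_R1, Rmult_1_l, (Rabs_right (exp _)) by (left; apply exp_pos).
    rewrite (Rabs_right (/ (2 * s))), (Rabs_right (sqrt _)), (Rabs_right (binw _ _)) by lra.
    specialize (Bphi N k HN Hk). fold z in Bphi.
    assert (k6 : exp (INR N * (Hfun p beta h (grid N k) - Hfun p beta h m) + t * sqrt (INR N) * (grid N k ^ p - m ^ p))
       <= exp (- z ^ 2 / 4) * exp (Rabs t * INR p / s * Rabs z)).
    { rewrite <- exp_plus. apply exp_mono. apply Rplus_le_compat.
      - replace (- z ^ 2 / 4) with (INR N * (- (curvature p beta m / 4) * (grid N k - m) ^ 2)).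
        apply Rmult_le_compat_l. apply pos_INR. lra.
        unfold z, zgrid. rewrite Es.
        replace (INR N) with (sqrt (INR N) * sqrt (INR N)) at 1 by (apply sqrt_sqrt, pos_INR). field.
      - eapply Rle_trans. apply Rle_abs. rewrite !Rabs_mult, (Rabs_right (sqrt _)) by lra.
        pose proof (pow_diff_le p (grid N k) m (grid_bounds N k HN Hk) ltac:(lra)) as k7.
        replace (Rabs t * INR p / s * Rabs z) with (Rabs t * sqrt (INR N) * (INR p * Rabs (grid N k - m))).
        apply Rmult_le_compat_l; auto. apply Rmult_le_pos. apply Rabs_pos. lra.
        unfold z, zgrid. rewrite !Rabs_mult, (Rabs_right (sqrt _)), (Rabs_right s) by lra. field. lra. }
    pose proof (gauss_dom a Ha z) as k8.
    assert (k9 : exp (a * Rabs z) = exp (Rabs t * INR p / s * Rabs z) * exp (b * Rabs z)).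
    { rewrite <- exp_plus. f_equal. unfold a. ring. }
    rewrite k9 in k8.
    replace (D1 / (1 + z ^ 2) ^ 2) with
     (/ (2 * s) * (6 / d) * (B * (16 * exp ((a + 2) ^ 2) / (1 + z ^ 2) ^ 2))) by (unfold D1, Rdiv; ring).
    rewrite Rmult_assoc.
    apply Rmult_le_compat.
    { apply Rmult_le_pos. lra. apply Rmult_le_pos; lra. }
    { apply Rmult_le_pos. left; apply exp_pos. apply Rabs_pos. }
    { apply Rmult_le_compat_l; lra. }
    apply Rle_trans with ((exp (- z ^ 2 / 4) * exp (Rabs t * INR p / s * Rabs z)) * (B * exp (b * Rabs z))).
    { apply Rmult_le_compat; auto. left; apply exp_pos. apply Rabs_pos. }
    replace (exp (- z ^ 2 / 4) * exp (Rabs t * INR p / s * Rabs z) * (B * exp (b * Rabs z)))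
      with (B * (exp (- z ^ 2 / 4) * (exp (Rabs t * INR p / s * Rabs z) * exp (b * Rabs z)))) by ring.
    apply Rmult_le_compat_l; auto.
  - intros z. unfold F.
    assert (HP : 0 < (1 + z ^ 2) ^ 2) by (apply pow_lt; nra).
    apply Rle_trans with (D2 / (1 + z ^ 2) ^ 2).
    2:{ apply Rmult_le_compat_r. left; apply Rinv_0_lt_compat; auto. lra. }
    rewrite Rabs_mult, (Rabs_right c0) by lra.
    replace (D2 / (1 + z ^ 2) ^ 2) with (c0 * (B * (16 * exp ((Rabs th + b + 2) ^ 2)) / (1 + z ^ 2) ^ 2))
      by (unfold D2, a2, Rdiv; ring).
    apply Rmult_le_compat_l. lra. apply expbound_dom; auto.
  - apply (is_RInt_gen_scal (fun z => Phi z * exp (th * z) * gexp z) c0 J). auto.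
Qed.

(** Compactness of [-1, 1]: around a non-maximizer continuity gives a local gap, and around a
    maximizer a ball of radius [d] contains no admissible point. *)
Lemma rest_gap (p : nat) (beta h d Hs : R) (ms : list R) :
  0 < d -> (forall x, In x ms <-> is_global_max p beta h x) ->
  ms <> nil -> (forall m, In m ms -> Hfun p beta h m = Hs) ->
  exists eta, 0 < eta /\ forall x, -1 <= x <= 1 -> (forall m, In m ms -> d <= Rabs (x - m)) ->
    Hfun p beta h x <= Hs - eta.
Proof.
  intros Hd Hin Hne HH.
  assert (HU : forall y, -1 <= y <= 1 -> ~ In y ms -> Hfun p beta h y < Hs).
  { intros y Hy Hn. destruct ms as [|m0 l]; [tauto|].
    pose proof (proj1 (Hin m0) (or_introl eq_refl)) as [_ Mm].
    pose proof (HH m0 (or_introl eq_refl)) as E. rewrite E in Mm.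
    destruct (Mm y Hy) as [h1|h1]; auto. exfalso. apply Hn. apply Hin. split; auto.
    intros z Hz. rewrite h1. auto. }
  assert (HQ : forall y, exists e : posreal, -1 <= y <= 1 -> forall x, -1 <= x <= 1 -> Rabs (x - y) < e ->
     (forall m, In m ms -> d <= Rabs (x - m)) -> Hfun p beta h x <= Hs - e).
  { intros y. destruct (classic (In y ms)) as [h1|h1].
    - exists (mkposreal d Hd). intros _ x _ Hx Hm. simpl in Hx. specialize (Hm y h1). lra.
    - destruct (classic (-1 <= y <= 1)) as [h2|h2].
      + specialize (HU y h2 h1).
        assert (Hg : 0 < (Hs - Hfun p beta h y) / 2) by lra.
        destruct (proj1 (filterlim_locally (F := locally y) _ _) (continuous_Hfun p beta h y) (mkposreal _ Hg)) as [e He].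
        assert (Hm : 0 < Rmin e ((Hs - Hfun p beta h y) / 2)) by (apply Rmin_pos; auto; apply cond_pos).
        exists (mkposreal _ Hm). intros _ x _ Hx _. simpl in *.
        pose proof (Rmin_l e ((Hs - Hfun p beta h y) / 2)). pose proof (Rmin_r e ((Hs - Hfun p beta h y) / 2)).
        assert (Hb : ball y e x) by (change (Rabs (x - y) < e); lra).
        specialize (He x Hb).
        change (Rabs (Hfun p beta h x - Hfun p beta h y) < (Hs - Hfun p beta h y) / 2) in He.
        apply Rabs_def2 in He. lra.
      + exists (mkposreal 1 Rlt_0_1). intros; tauto. }
  set (delta := fun t => proj1_sig (constructive_indefinite_description _ (HQ t))).
  destruct (compactness_value_1d (-1) 1 delta) as [e He].
  exists e. split. apply cond_pos. intros x Hx Hm.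
  destruct (NNPP _ (He x Hx)) as [t [Ht [Hxt Het]]].
  assert (Hfun p beta h x <= Hs - delta t); [|lra].
  unfold delta in *. destruct (constructive_indefinite_description _ (HQ t)) as [e' He']. simpl in *.
  apply He'; auto.
Qed.

Lemma uniform_radius {T : Type} (P : T -> R -> Prop) (l : list T) :
  (forall m, In m l -> exists d0, 0 < d0 /\ forall d, 0 < d <= d0 -> P m d) ->
  exists d0, 0 < d0 /\ forall d, 0 < d <= d0 -> forall m, In m l -> P m d.
Proof.
  induction l as [|a l IH]; intros H.
  - exists 1. split. lra. intros d _ m [].
  - destruct IH as [d1 [h1 H1]]. { intros m Hm. apply H. right; auto. }
    destruct (H a (or_introl eq_refl)) as [d2 [h2 H2]].
    exists (Rmin d1 d2). split. apply Rmin_pos; auto.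
    pose proof (Rmin_l d1 d2). pose proof (Rmin_r d1 d2).
    intros d Hd m [<-|Hm]. apply H2; lra. apply H1; auto; lra.
Qed.

Lemma separation_radius (l : list R) :
  exists d0, 0 < d0 /\ forall d, 0 < d <= d0 -> forall a, In a l -> forall b, In b l -> a <> b -> 2 * d <= Rabs (a - b).
Proof.
  apply (uniform_radius (fun a d => forall b, In b l -> a <> b -> 2 * d <= Rabs (a - b))).
  intros a _. apply (uniform_radius (fun b d => a <> b -> 2 * d <= Rabs (a - b))).
  intros b _. destruct (Req_dec a b) as [h|h].
  - exists 1. split. lra. intros; contradiction.
  - assert (0 < Rabs (a - b)) by (apply Rabs_pos_lt; lra).
    exists (Rabs (a - b) / 2). split. lra. intros; lra.
Qed.

(** The windows are disjoint, so one minus this sum is the indicator of the complement of all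
    windows. *)
Lemma chi_sum (d x : R) (l : list R) : NoDup l ->
  (forall a, In a l -> forall b, In b l -> a <> b -> 2 * d <= Rabs (a - b)) ->
  (sumR (map (fun m => chi d m x) l) = 0 /\ forall m, In m l -> d <= Rabs (x - m)) \/
  (sumR (map (fun m => chi d m x) l) = 1 /\ exists m, In m l /\ Rabs (x - m) < d).
Proof.
  induction l as [|a l IH]; intros ND Hs.
  - left. split. reflexivity. intros m [].
  - inversion ND as [|? ? Hna HND]; subst.
    destruct IH as [[h1 h2]|[h1 [m [h2 h3]]]]; auto.
    { intros; apply Hs; simpl; auto. }
    + unfold sumR in *. simpl. rewrite h1. unfold chi. destruct (Rlt_dec (Rabs (x - a)) d) as [h4|h4].
      * right. split. ring. exists a; auto.
      * left. split. ring. intros m [<-|Hm]; auto. lra.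
    + unfold sumR in *. simpl. rewrite h1. unfold chi. destruct (Rlt_dec (Rabs (x - a)) d) as [h4|h4].
      * exfalso. assert (a <> m) by (intros ->; contradiction).
        assert (h5 : 2 * d <= Rabs (a - m)) by (apply Hs; simpl; auto).
        replace (a - m) with ((x - m) - (x - a)) in h5 by ring.
        pose proof (Rabs_triang (x - m) (- (x - a))) as h6. rewrite Rabs_Ropp in h6. unfold Rminus at 1 in h5. lra.
      * right. split. ring. exists m; auto.
Qed.

Lemma sumR_map_plus {T : Type} (f g : T -> R) (l : list T) :
  sumR (map (fun m => f m + g m) l) = sumR (map f l) + sumR (map g l).
Proof. induction l as [|a l IH]; unfold sumR in *; simpl. ring. rewrite IH. ring. Qed.

Lemma sum_sumR_swap {T : Type} (g : T -> nat -> R) (l : list T) (N : nat) :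
  sum_f_R0 (fun k => sumR (map (fun m => g m k) l)) N = sumR (map (fun m => sum_f_R0 (g m) N) l).
Proof. induction N as [|N IH]; simpl; auto. rewrite IH, <- sumR_map_plus. reflexivity. Qed.

Lemma is_lim_seq_sumR {T : Type} (u : T -> nat -> R) (L : T -> R) (l : list T) :
  (forall m, In m l -> is_lim_seq (u m) (L m)) ->
  is_lim_seq (fun N => sumR (map (fun m => u m N) l)) (sumR (map L l)).
Proof.
  induction l as [|a l IH]; intros H; unfold sumR in *; simpl.
  - apply is_lim_seq_const.
  - apply (is_lim_seq_plus' (u a) (fun N => fold_right Rplus 0 (map (fun m => u m N) l))).
    apply H; left; auto. apply IH. intros; apply H; right; auto.
Qed.

Lemma is_lim_seq_0_bound (u v : nat -> R) :
  (exists N0, forall N, (N0 <= N)%nat -> Rabs (u N) <= v N) -> is_lim_seq v 0 -> is_lim_seq u 0.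
Proof.
  intros [N0 H] Hv. apply is_lim_seq_abs_0.
  apply (is_lim_seq_le_le_loc (fun _ => 0) _ v); auto.
  - exists N0. intros N HN. split. apply Rabs_pos. auto.
  - apply is_lim_seq_const.
Qed.

Lemma exp_ge_id (x : R) : x <= exp x.
Proof.
  destruct (Req_dec x 0) as [->|h]. left; apply exp_pos. pose proof (exp_ineq1 x h). lra.
Qed.

Lemma exp_pow_nat (x : R) (n : nat) : exp x ^ n = exp (INR n * x).
Proof.
  induction n as [|n IH]. simpl. rewrite Rmult_0_l, exp_0. auto.
  rewrite S_INR. simpl. rewrite IH, <- exp_plus. f_equal. ring.
Qed.

Lemma pow_le_exp (n : nat) (c y : R) : 0 < c -> 0 <= y ->
  y ^ n <= (INR (S n) / c) ^ n * exp (c * y).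
Proof.
  intros Hc Hy.
  assert (Hn : 0 < INR (S n)) by (apply lt_0_INR; lia).
  assert (y <= INR (S n) / c * exp (c * y / INR (S n))).
  { pose proof (exp_ge_id (c * y / INR (S n))) as He.
    apply Rmult_le_compat_l with (r := INR (S n) / c) in He.
    replace (INR (S n) / c * (c * y / INR (S n))) with y in He by (field; lra). auto.
    left. apply Rdiv_lt_0_compat; auto. }
  apply Rle_trans with ((INR (S n) / c * exp (c * y / INR (S n))) ^ n).
  apply pow_incr; auto.
  rewrite Rpow_mult_distr, exp_pow_nat. apply Rmult_le_compat_l.
  apply pow_le. left. apply Rdiv_lt_0_compat; auto.
  apply exp_mono.
  assert (INR n / INR (S n) <= 1).
  { apply Rmult_le_reg_r with (INR (S n)); auto. unfold Rdiv. rewrite Rmult_assoc, Rinv_l by lra.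
    rewrite S_INR. lra. }
  replace (INR n * (c * y / INR (S n))) with (INR n / INR (S n) * (c * y)) by (field; lra).
  assert (0 <= c * y) by (apply Rmult_le_pos; lra). nra.
Qed.

(** Half of the rate absorbs the polynomial, and the other half still decays at least like 1 / sqrt
    N. *)
Lemma exp_decay (q : nat) (c : R) : 0 < c ->
  is_lim_seq (fun N => (1 + INR N) ^ q * exp (- c * sqrt (INR N))) 0.
Proof.
  intros Hc. set (n := (2 * q)%nat). set (K := (INR (S n) / (c / 2)) ^ n * exp (c / 2)).
  assert (HK : 0 <= K).
  { unfold K. apply Rmult_le_pos. apply pow_le. apply Rdiv_le_0_compat. apply pos_INR. lra.
    left; apply exp_pos. }
  apply is_lim_seq_0_bound with (fun N => (K * (2 / c)) / sqrt (INR N)).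
  2: apply is_lim_seq_inv_sqrt.
  exists 1%nat. intros N HN. pose proof (sqrt_INR_pos N HN) as Hq. set (u := sqrt (INR N)) in *.
  assert (EN : INR N = u * u) by (unfold u; rewrite sqrt_sqrt; auto; apply pos_INR).
  rewrite Rabs_right.
  2:{ apply Rle_ge. apply Rmult_le_pos. apply pow_le. pose proof (pos_INR N); lra. left; apply exp_pos. }
  assert (B1 : (1 + INR N) ^ q <= K * exp (c / 2 * u)).
  { apply Rle_trans with ((1 + u) ^ n).
    - unfold n. rewrite pow_mult. apply pow_incr. rewrite EN. split; nra.
    - eapply Rle_trans. apply (pow_le_exp n (c / 2) (1 + u)); lra.
      right. unfold K. rewrite Rmult_assoc, <- exp_plus. do 2 f_equal. ring. }
  assert (B2 : exp (- (c / 2 * u)) <= (2 / c) / u).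
  { replace ((2 / c) / u) with (/ (c / 2 * u)) by (field; lra). rewrite exp_Ropp.
    apply Rinv_le_contravar. nra. apply exp_ge_id. }
  apply Rle_trans with (K * exp (c / 2 * u) * exp (- c * u)).
  { apply Rmult_le_compat_r; auto. left; apply exp_pos. }
  replace (K * exp (c / 2 * u) * exp (- c * u)) with (K * exp (- (c / 2 * u))).
  2:{ rewrite Rmult_assoc, <- exp_plus. do 2 f_equal. field. }
  replace (K * (2 / c) / u) with (K * (2 / c / u)) by (field; lra). apply Rmult_le_compat_l; auto.
Qed.

(** The unnormalised mixture weight: one factor is the Gaussian width of the well, the other the
    binomial variance from Stirling's formula. At a nondegenerate maximizer it equals [cst]. *)
Definition well_weight (p : nat) (beta m : R) : R := / (curvature_sqrt p beta m * sqrt (1 - m ^ 2)).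

Lemma well_weight_pos (p : nat) (beta h m : R) : nondeg_max p beta h m -> 0 < well_weight p beta m.
Proof.
  intros [Im [_ [Nm _]]]. apply Rinv_0_lt_compat, Rmult_lt_0_compat; apply sqrt_lt_R0; unfold curvature; nra.
Qed.

Lemma curvature_sqrt_pos (p : nat) (beta h m : R) : nondeg_max p beta h m -> 0 < curvature_sqrt p beta m.
Proof. intros [Im [_ [Nm _]]]. apply sqrt_lt_R0. unfold curvature. lra. Qed.

Lemma tilted_gauss_dom (th z : R) :
  Rabs (exp (th * z) * gexp z) <= 16 * exp ((Rabs th + 2) ^ 2) / (1 + z ^ 2).
Proof.
  pose proof (expbound_dom (fun _ => 1) 1 0 th (Rle_refl 0)) as H.
  cbv beta in H. rewrite !Rmult_1_l, Rplus_0_r in H. eapply Rle_trans.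
  - rewrite <- (Rmult_1_l (exp (th * z))). apply H.
    intros. rewrite Rabs_R1, Rmult_0_l, exp_0. lra.
  - apply inv_sqr_dom. pose proof (exp_pos ((Rabs th + 2) ^ 2)). lra.
Qed.

Lemma continuous_tilted_gauss (th z : R) : continuous (fun z => exp (th * z) * gexp z) z.
Proof.
  apply (ex_derive_continuous (fun z => exp (th * z) * gexp z)). unfold gexp. auto_derive. auto.
Qed.

Lemma is_RIntR_ge_RInt (F : R -> R) (J : R) : (forall a b, ex_RInt F a b) -> (forall x, 0 <= F x) ->
  is_RIntR F J -> RInt F (-1) 1 <= J.
Proof.
  intros Hex Hp HJ.
  pose proof (is_RIntR_lim_seq F J (fun n => - INR n) INR HJ) as HL.
  assert (HL' : is_lim_seq (fun n => RInt F (- INR n) (INR n)) J).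
  { apply HL. apply (is_lim_seq_opp INR p_infty). apply is_lim_seq_INR. apply is_lim_seq_INR. }
  assert (Rbar_le (RInt F (-1) 1) J); [|auto].
  apply (is_lim_seq_le_loc (fun _ => RInt F (-1) 1) (fun n => RInt F (- INR n) (INR n))); auto.
  2: apply is_lim_seq_const.
  exists 1%nat. intros n Hn. apply (le_INR 1) in Hn. simpl in Hn.
  rewrite <- (RInt_Chasles_R F (- INR n) (-1) (INR n)), <- (RInt_Chasles_R F (-1) 1 (INR n)) by auto.
  assert (0 <= RInt F (- INR n) (-1)) by (apply RInt_ge_0; [lra|auto|intros; apply Hp]).
  assert (0 <= RInt F 1 (INR n)) by (apply RInt_ge_0; [lra|auto|intros; apply Hp]).
  lra.
Qed.

Lemma tilted_gauss_int (th : R) : exists J, 0 < J /\ is_RIntR (fun z => exp (th * z) * gexp z) J.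
Proof.
  destruct (ex_RIntR_dominated (fun z => exp (th * z) * gexp z) _
    (fun a b => ex_RInt_cont _ a b (continuous_tilted_gauss th)) (tilted_gauss_dom th)) as [J HJ].
  assert (Hp : forall z, 0 < exp (th * z) * gexp z) by (intros; apply Rmult_lt_0_compat; apply exp_pos).
  exists J. split; auto.
  apply Rlt_le_trans with (RInt (fun z => exp (th * z) * gexp z) (-1) 1).
  - apply RInt_gt_0; [lra|intros; apply Hp|intros; apply continuous_tilted_gauss].
  - apply is_RIntR_ge_RInt; auto.
    intros; apply ex_RInt_cont, continuous_tilted_gauss. intros; left; apply Hp.
Qed.

Lemma is_RIntR_ext (f g : R -> R) (J : R) : (forall x, f x = g x) -> is_RIntR f J -> is_RIntR g J.
Proof. intros H. apply is_RInt_gen_ext. apply filter_forall. intros; auto. Qed.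

Lemma local_lim_one (p : nat) (beta t m J : R) :
  is_RIntR (fun z => exp (tilt_slope p beta m t * z) * gexp z) J ->
  local_lim p beta t m (fun _ _ => 1) J.
Proof.
  intros HJ. exists (fun _ => 1), 1, 0, 0. repeat split; auto.
  - lra.
  - intros; apply filterlim_const.
  - intros; apply continuous_const.
  - intros u v. apply ex_RInt_cont. intros x.
    apply continuous_ext with (fun z => exp (tilt_slope p beta m t * z) * gexp z). intros y. rewrite Rmult_1_l. reflexivity.
    apply continuous_tilted_gauss.
  - intros. rewrite Rabs_R1, Rmult_0_l, exp_0. lra.
  - intros. rewrite Rabs_R1, Rmult_0_l, exp_0. lra.
  - apply is_RIntR_ext with (fun z => exp (tilt_slope p beta m t * z) * gexp z); auto. intros; ring.
Qed.

Lemma tilted_weight_pos (p : nat) (beta h Hs t M : R) (N k : nat) : 0 < tilted_weight p beta h Hs t M N k.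
Proof. apply Rmult_lt_0_compat. apply binw_pos. apply exp_pos. Qed.

Lemma chi_01 (d m x : R) : 0 <= chi d m x <= 1.
Proof. unfold chi. destruct (Rlt_dec _ _); lra. Qed.

Lemma sum_abs_le (f g : nat -> R) (N : nat) : (forall k, (k <= N)%nat -> Rabs (f k) <= g k) ->
  Rabs (sum_f_R0 f N) <= sum_f_R0 g N.
Proof.
  intros H. eapply Rle_trans. apply (sum_f_R0_triangle f N). apply sum_Rle. auto.
Qed.

(** Measured against the selected value [M], this well carries an extra exp (- c sqrt N), which
    beats the polynomial bound on [phi]; its own Laplace limit bounds the rest. *)
Lemma suppressed_well (p : nat) (beta h m d t M A B : R) (q : nat) (phi : nat -> nat -> R) :
  (3 <= p)%nat -> nondeg_max p beta h m -> 0 < d -> well_ok p beta h m d ->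
  0 < A -> is_lim_seq stirling A -> t * m ^ p < t * M ->
  (forall N k, (1 <= N)%nat -> (k <= N)%nat -> Rabs (phi N k) <= B * (1 + INR N) ^ q) ->
  is_lim_seq (fun N => sum_f_R0 (fun k => chi d m (grid N k) *
      (tilted_weight p beta h (Hfun p beta h m) t M N k * phi N k)) N) 0.
Proof.
  intros Hp Gm Hd Hok HA Hst Ht Bphi.
  destruct (tilted_gauss_int (tilt_slope p beta m t)) as [J [HJ0 HJ]].
  pose proof (laplace_well p beta h m d t A J (fun _ _ => 1) Hp Gm Hd Hok HA Hst (local_lim_one _ _ _ _ _ HJ)) as HL.
  set (c := t * M - t * m ^ p).
  assert (Hc : 0 < c) by (unfold c; lra).
  apply is_lim_seq_0_bound with (fun N => B * ((1 + INR N) ^ q * exp (- c * sqrt (INR N))) *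
     sum_f_R0 (fun k => chi d m (grid N k) * (tilted_weight p beta h (Hfun p beta h m) t (m ^ p) N k * 1)) N).
  - exists 1%nat. intros N HN. rewrite scal_sum. apply sum_abs_le. intros k Hk.
    pose proof (chi_01 d m (grid N k)). pose proof (tilted_weight_pos p beta h (Hfun p beta h m) t M N k).
    rewrite !Rabs_mult, (Rabs_right (chi _ _ _)), (Rabs_right (tilted_weight _ _ _ _ _ _ _ _)) by lra.
    assert (E : tilted_weight p beta h (Hfun p beta h m) t M N k
      = tilted_weight p beta h (Hfun p beta h m) t (m ^ p) N k * exp (- c * sqrt (INR N))).
    { unfold tilted_weight. rewrite (Rmult_assoc (binw N k)), <- exp_plus. do 2 f_equal. unfold c. ring. }
    rewrite E in *.
    specialize (Bphi N k HN Hk).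
    replace (chi d m (grid N k) * (tilted_weight p beta h (Hfun p beta h m) t (m ^ p) N k * 1) *
      (B * ((1 + INR N) ^ q * exp (- c * sqrt (INR N)))))
    with (chi d m (grid N k) * (tilted_weight p beta h (Hfun p beta h m) t (m ^ p) N k * exp (- c * sqrt (INR N))
       * (B * (1 + INR N) ^ q))) by ring.
    apply Rmult_le_compat_l. lra. apply Rmult_le_compat_l; lra.
  - replace (Finite 0) with (Finite ((B * 0) * (/ A * (/ (curvature_sqrt p beta m * sqrt (1 - m ^ 2)) * J)))) by (f_equal; ring).
    apply is_lim_seq_mult'; auto.
    apply is_lim_seq_mult'. apply is_lim_seq_const. apply exp_decay; auto.
Qed.

Lemma sum_const_le (f : nat -> R) (N : nat) (c : R) : (forall k, (k <= N)%nat -> f k <= c) ->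
  sum_f_R0 f N <= c * (1 + INR N).
Proof.
  intros H. induction N as [|N IH]; simpl sum_f_R0.
  - specialize (H 0%nat ltac:(lia)). simpl. lra.
  - rewrite S_INR. pose proof (H (S N) ltac:(lia)). pose proof (IH ltac:(intros; apply H; lia)). lra.
Qed.

(** Selection is expressed as t m^p = t M rather than m^p = M, so that t = 0 selects every well
    whatever [M] is. Off the windows the loss exp (- eta N) outweighs the tilt, of size exp (O (sqrt
    N)). *)
Lemma tilted_laplace (p : nat) (beta h Hs t M A B : R) (q : nat) (ms : list R)
    (phi : nat -> nat -> R) (J : R -> R) :
  (3 <= p)%nat -> NoDup ms -> ms <> nil -> (forall x, In x ms <-> is_global_max p beta h x) ->
  (forall m, In m ms -> nondeg_max p beta h m) -> (forall m, In m ms -> Hfun p beta h m = Hs) ->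
  0 < A -> is_lim_seq stirling A -> 0 <= B ->
  (forall N k, (1 <= N)%nat -> (k <= N)%nat -> Rabs (phi N k) <= B * (1 + INR N) ^ q) ->
  (forall m, In m ms -> (t * m ^ p = t * M /\ local_lim p beta t m phi (J m)) \/
      (t * m ^ p < t * M /\ J m = 0)) ->
  is_lim_seq (fun N => sum_f_R0 (fun k => tilted_weight p beta h Hs t M N k * phi N k) N)
    (/ A * sumR (map (fun m => well_weight p beta m * J m) ms)).
Proof.
  intros Hp ND Hne Hin Hgood HH HA Hst HB Bphi Hloc.
  destruct (separation_radius ms) as [d1 [Hd1 Hsep]].
  destruct (uniform_radius (well_ok p beta h) ms) as [d2 [Hd2 Hok]].
  { intros m Hm. apply well_ok_ex; auto. }
  set (d := Rmin d1 d2).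
  assert (Hd : 0 < d) by (apply Rmin_pos; auto).
  specialize (Hsep d (conj Hd (Rmin_l _ _))). specialize (Hok d (conj Hd (Rmin_r _ _))).
  destruct (rest_gap p beta h d Hs ms Hd Hin Hne HH) as [eta [Heta Hgap]].
  set (w := fun N k => tilted_weight p beta h Hs t M N k * phi N k).
  set (rest := fun N => sum_f_R0 (fun k => (1 - sumR (map (fun m => chi d m (grid N k)) ms)) * w N k) N).
  apply is_lim_seq_ext with (fun N => rest N + sumR (map (fun m => sum_f_R0 (fun k => chi d m (grid N k) * w N k) N) ms)).
  { intros N. unfold rest. rewrite <- (sum_sumR_swap (fun m k => chi d m (grid N k) * w N k)).
    rewrite <- plus_sum. apply sum_eq. intros k _. rewrite sumR_map_scal. unfold w. ring. }
  replace (Finite (/ A * sumR (map (fun m => well_weight p beta m * J m) ms)))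
    with (Finite (0 + sumR (map (fun m => / A * (well_weight p beta m * J m)) ms))).
  2:{ f_equal. rewrite Rplus_0_l, (Rmult_comm (/ A)), <- sumR_map_scal. f_equal. apply map_ext. intros; ring. }
  apply is_lim_seq_plus'.
  (* [c0 * sqrt N] bounds the tilt exponent. Requiring (c0 + 1) sqrt N <= eta N leaves exp (- sqrt
     N) to spare against the polynomial factors. *)
  - set (c0 := 2 * Rabs t * (1 + Rabs M)).
    apply is_lim_seq_0_bound with (fun N => (6 * B) * ((1 + INR N) ^ (S q) * exp (- (1) * sqrt (INR N)))).
    2:{ replace (Finite 0) with (Finite (6 * B * 0)) by (f_equal; ring).
        apply is_lim_seq_mult'. apply is_lim_seq_const. apply exp_decay. lra. }
    destruct (eventually_inv_sqrt (c0 + 1) eta Heta) as [N0 HN0].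
    exists (max 1 N0). intros N HN.
    assert (HN1 : (1 <= N)%nat) by lia.
    pose proof (sqrt_INR_pos N HN1) as Hq.
    assert (EN : INR N = sqrt (INR N) * sqrt (INR N)) by (rewrite sqrt_sqrt; auto; apply pos_INR).
    assert (Hb : (c0 + 1) * sqrt (INR N) <= eta * INR N).
    { specialize (HN0 N ltac:(lia)). rewrite Rabs_right in HN0.
      2:{ apply Rle_ge, Rdiv_le_0_compat; auto. unfold c0. pose proof (Rabs_pos t). pose proof (Rabs_pos M). nra. }
      apply Rmult_lt_compat_r with (r := sqrt (INR N) * sqrt (INR N)) in HN0; [|nra].
      replace ((c0 + 1) / sqrt (INR N) * (sqrt (INR N) * sqrt (INR N))) with ((c0 + 1) * sqrt (INR N)) in HN0 by (field; lra).
      rewrite <- EN in HN0. lra. }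
    unfold rest. eapply Rle_trans. apply (sum_abs_le _ (fun _ => 6 * exp (- (1) * sqrt (INR N)) * (B * (1 + INR N) ^ q))).
    2:{ eapply Rle_trans. apply sum_const_le with (c := 6 * exp (- (1) * sqrt (INR N)) * (B * (1 + INR N) ^ q)). intros; lra.
        right. simpl. ring. }
    intros k Hk.
    assert (HP0 : 0 <= 6 * exp (- (1) * sqrt (INR N)) * (B * (1 + INR N) ^ q)).
    { apply Rmult_le_pos. apply Rmult_le_pos; [lra|left; apply exp_pos]. apply Rmult_le_pos; auto.
      apply pow_le. pose proof (pos_INR N). lra. }
    destruct (chi_sum d (grid N k) ms ND Hsep) as [[h1 h2]|[h1 _]]; rewrite h1.
    2:{ rewrite Rminus_diag, Rmult_0_l, Rabs_R0. auto. }
    rewrite Rminus_0_r, Rmult_1_l. unfold w. rewrite Rabs_mult.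
    apply Rmult_le_compat; try apply Rabs_pos. 2: auto.
    rewrite Rabs_right by (left; apply tilted_weight_pos).
    unfold tilted_weight. apply Rmult_le_compat. left; apply binw_pos. left; apply exp_pos.
    apply binw_bound; auto.
    apply exp_mono.
    pose proof (grid_bounds N k HN1 Hk) as Hx.
    specialize (Hgap _ Hx h2).
    assert (INR N * (Hfun p beta h (grid N k) - Hs) <= - (eta * INR N)) by (pose proof (pos_INR N); nra).
    assert (t * sqrt (INR N) * (grid N k ^ p - M) <= c0 * sqrt (INR N)).
    { eapply Rle_trans. apply Rle_abs. rewrite !Rabs_mult, (Rabs_right (sqrt _)) by lra.
      assert (Rabs (grid N k ^ p - M) <= 1 + Rabs M).
      { unfold Rminus. eapply Rle_trans. apply Rabs_triang. rewrite Rabs_Ropp.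
        apply Rplus_le_compat_r. apply pow_abs_le_1; auto. }
      assert (0 <= Rabs t * sqrt (INR N)) by (apply Rmult_le_pos; [apply Rabs_pos|lra]).
      apply Rle_trans with (Rabs t * sqrt (INR N) * (1 + Rabs M)). apply Rmult_le_compat_l; auto.
      unfold c0. pose proof (Rabs_pos M). nra. }
    lra.
  - apply (is_lim_seq_sumR (fun m N => sum_f_R0 (fun k => chi d m (grid N k) * w N k) N)
      (fun m => / A * (well_weight p beta m * J m))).
    intros m Hm. unfold w. rewrite <- (HH m Hm).
    destruct (Hloc m Hm) as [[h1 h2]|[h1 h2]].
    + apply is_lim_seq_ext with (fun N => sum_f_R0 (fun k => chi d m (grid N k) *
      (tilted_weight p beta h (Hfun p beta h m) t (m ^ p) N k * phi N k)) N).
      { intros N. apply sum_eq. intros k _. do 2 f_equal. unfold tilted_weight. do 3 f_equal.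
        replace (t * sqrt (INR N) * (grid N k ^ p - m ^ p)) with (sqrt (INR N) * (t * grid N k ^ p - t * m ^ p)) by ring.
        rewrite h1. ring. }
      apply laplace_well; auto.
    + rewrite h2, !Rmult_0_r. apply (suppressed_well p beta h m d t M A B q phi); auto.
Qed.

Lemma model_mean_Wt (p : nat) (beta h Hs t M : R) (N : nat) (phi : nat -> R) : (1 <= N)%nat ->
  model_mean p (beta + t / sqrt (INR N)) h N phi =
  sum_f_R0 (fun k => tilted_weight p beta h Hs t M N k * phi k) N / sum_f_R0 (fun k => tilted_weight p beta h Hs t M N k * 1) N.
Proof.
  intros HN. unfold model_mean. set (E := exp (- (INR N * Hs + t * sqrt (INR N) * M))).
  assert (HE : 0 < E) by apply exp_pos.
  rewrite (sum_eq (fun k => tilted_weight p beta h Hs t M N k * phi k)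
     (fun k => gibbs_weight p (beta + t / sqrt (INR N)) h N k * phi k * E)).
  2:{ intros k _. rewrite tilted_weight_wt by auto. unfold E. ring. }
  rewrite (sum_eq (fun k => tilted_weight p beta h Hs t M N k * 1)
     (fun k => gibbs_weight p (beta + t / sqrt (INR N)) h N k * E)).
  2:{ intros k _. rewrite tilted_weight_wt by auto. unfold E. ring. }
  rewrite <- !scal_sum.
  pose proof (gibbs_weight_sum_pos p (beta + t / sqrt (INR N)) h N). field. lra.
Qed.

Lemma tilted_expectation (p : nat) (beta h t M B : R) (q : nat) (ms : list R)
    (phi : nat -> nat -> R) (J J1 : R -> R) :
  (3 <= p)%nat -> NoDup ms -> (forall x, In x ms <-> is_global_max p beta h x) ->
  (forall m, In m ms -> nondeg_max p beta h m) -> 0 <= B ->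
  (forall N k, (1 <= N)%nat -> (k <= N)%nat -> Rabs (phi N k) <= B * (1 + INR N) ^ q) ->
  (forall m, In m ms ->
     (t * m ^ p = t * M /\ local_lim p beta t m phi (J m) /\
        is_RIntR (fun z => exp (tilt_slope p beta m t * z) * gexp z) (J1 m)) \/
     (t * m ^ p < t * M /\ J m = 0 /\ J1 m = 0)) ->
  sumR (map (fun m => well_weight p beta m * J1 m) ms) <> 0 ->
  is_lim_seq (fun N => model_mean p (beta + t / sqrt (INR N)) h N (phi N))
    (sumR (map (fun m => well_weight p beta m * J m) ms) / sumR (map (fun m => well_weight p beta m * J1 m) ms)).
Proof.
  intros Hp ND Hin Hgood HB Bphi Hloc Hden.
  destruct stirling_lim as [A [HA Hst]].
  destruct ms as [|m0 l]; [exfalso; apply Hden; reflexivity|].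
  set (Hs := Hfun p beta h m0).
  assert (HH : forall m, In m (m0 :: l) -> Hfun p beta h m = Hs).
  { intros m Hm. unfold Hs. pose proof (proj1 (Hin m) Hm) as [I1 M1].
    pose proof (proj1 (Hin m0) (or_introl eq_refl)) as [I0 M0].
    apply Rle_antisym; auto. }
  apply is_lim_seq_ext_loc with (fun N => sum_f_R0 (fun k => tilted_weight p beta h Hs t M N k * phi N k) N
     / sum_f_R0 (fun k => tilted_weight p beta h Hs t M N k * 1) N).
  { exists 1%nat. intros N HN. symmetry. apply model_mean_Wt; auto. }
  assert (HiA : 0 < / A) by (apply Rinv_0_lt_compat; auto).
  set (S := sumR (map (fun m => well_weight p beta m * J m) (m0 :: l))) in *.
  set (S1 := sumR (map (fun m => well_weight p beta m * J1 m) (m0 :: l))) in *.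
  replace (S / S1) with ((/ A * S) / (/ A * S1)) by (field; split; [auto|lra]).
  apply is_lim_seq_div'.
  - apply (tilted_laplace p beta h Hs t M A B q (m0 :: l) phi J); auto. discriminate.
    intros m Hm. destruct (Hloc m Hm) as [[a1 [a2 a3]]|[a1 [a2 a3]]]; auto.
  - apply (tilted_laplace p beta h Hs t M A 1 0 (m0 :: l) (fun _ _ => 1) J1); auto. discriminate. lra.
    intros. rewrite Rabs_R1. simpl. lra.
    intros m Hm. destruct (Hloc m Hm) as [[a1 [a2 a3]]|[a1 [a2 a3]]]; auto.
    left. split; auto. apply local_lim_one; auto.
  - apply Rmult_integral_contrapositive. split; auto; lra.
Qed.

(** * Asymptotics of the tilted mean *)

Lemma is_RIntR_plus (f g : R -> R) (a b : R) :
  is_RIntR f a -> is_RIntR g b -> is_RIntR (fun x => f x + g x) (a + b).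
Proof. intros Hf Hg. apply (is_RInt_gen_plus f g a b Hf Hg). Qed.

Lemma is_RIntR_scal (f : R -> R) (c a : R) : is_RIntR f a -> is_RIntR (fun x => c * f x) (c * a).
Proof. intros Hf. apply (is_RInt_gen_scal f c a Hf). Qed.

Lemma is_RIntR_unique (f : R -> R) (a : R) : is_RIntR f a ->
  RInt_gen f (Rbar_locally m_infty) (Rbar_locally p_infty) = a.
Proof. intros H. apply is_RInt_gen_unique. exact H. Qed.

Lemma is_RIntR_inj (f : R -> R) (a b : R) : is_RIntR f a -> is_RIntR f b -> a = b.
Proof. intros Ha Hb. rewrite <- (is_RIntR_unique f a Ha). apply is_RIntR_unique; auto. Qed.

Definition sqrt_2pi : R := sqrt (2 * PI).

Lemma sqrt_2pi_pos : 0 < sqrt_2pi.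
Proof. apply sqrt_lt_R0. pose proof PI_RGT_0. lra. Qed.

Lemma gauss_int_of (f : R -> R) (E : R) : is_RIntR (fun z => f z * gexp z) (sqrt_2pi * E) -> gauss_int f = E.
Proof.
  intros H. apply (is_RIntR_scal _ (/ sqrt_2pi)) in H. pose proof sqrt_2pi_pos.
  replace (/ sqrt_2pi * (sqrt_2pi * E)) with E in H by (field; lra).
  unfold gauss_int. apply is_RIntR_unique. eapply is_RIntR_ext. 2: apply H.
  intros x. unfold gexp, sqrt_2pi in *. simpl. field. unfold sqrt_2pi in *. lra.
Qed.

Lemma gauss_int_ex (f : R -> R) : (exists J, is_RIntR (fun z => f z * gexp z) J) ->
  is_RIntR (fun z => f z * gexp z) (sqrt_2pi * gauss_int f).
Proof.
  intros [J HJ]. pose proof sqrt_2pi_pos. assert (E : J = sqrt_2pi * (J / sqrt_2pi)) by (field; lra).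
  rewrite (gauss_int_of f (J / sqrt_2pi)). rewrite <- E; auto. rewrite <- E; auto.
Qed.

Lemma gexp_opp (x : R) : gexp (- x) = gexp x.
Proof. unfold gexp. f_equal. field. Qed.

Lemma ex_RIntR_expbound (Phi : R -> R) (B b th : R) : 0 <= b ->
  (forall u v, ex_RInt (fun z => Phi z * exp (th * z) * gexp z) u v) ->
  (forall z, Rabs (Phi z) <= B * exp (b * Rabs z)) ->
  exists J, is_RIntR (fun z => Phi z * exp (th * z) * gexp z) J.
Proof.
  intros Hb Hex HP. eapply ex_RIntR_dominated; auto.
  intros z. eapply Rle_trans. apply expbound_dom; eauto.
  apply inv_sqr_dom. apply Rmult_le_pos.
  - specialize (HP 0). pose proof (Rabs_pos (Phi 0)). rewrite Rabs_R0, Rmult_0_r, exp_0 in HP. lra.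
  - pose proof (exp_pos ((Rabs th + b + 2) ^ 2)). lra.
Qed.

Lemma continuous_Rmult (f g : R -> R) (x : R) : continuous f x -> continuous g x ->
  continuous (fun x => f x * g x) x.
Proof. intros Hf Hg. apply (continuous_mult f g); auto. Qed.

Lemma continuous_tilt (Phi : R -> R) (th z : R) : continuous Phi z ->
  continuous (fun z => Phi z * exp (th * z) * gexp z) z.
Proof.
  intros H. apply continuous_Rmult. 2: apply continuous_gexp.
  apply continuous_Rmult; auto.
  apply (ex_derive_continuous (fun z => exp (th * z))). auto_derive; auto.
Qed.

Lemma kernel_lim (D : R) (L : Rbar) : L = p_infty \/ L = m_infty ->
  is_lim (fun x => D / (1 + x ^ 2)) L 0.
Proof.
  intros HL.
  assert (HA : forall K, is_lim (fun x => K * / Rabs x) L 0).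
  { intros K. replace (Finite 0) with (Rbar_mult K 0) by (simpl; f_equal; ring).
    apply is_lim_scal_l, (is_lim_inv Rabs L p_infty). 2: discriminate.
    destruct HL as [-> | ->].
    - apply is_lim_ext_loc with (fun x => x). exists 0. intros; rewrite Rabs_right; lra. apply is_lim_id.
    - apply is_lim_ext_loc with (fun x => - x). exists 0. intros; rewrite Rabs_left; lra.
      apply (is_lim_opp (fun x => x) m_infty m_infty). apply is_lim_id. }
  apply (is_lim_le_le_loc (fun x => - Rabs D * / Rabs x) (fun x => Rabs D * / Rabs x)); auto.
  assert (H : forall x, 1 < Rabs x -> - Rabs D * / Rabs x <= D / (1 + x ^ 2) <= Rabs D * / Rabs x).
  { intros x Hx. assert (HI : 0 < / (1 + x ^ 2) <= / Rabs x).
    { split. apply Rinv_0_lt_compat. nra. apply Rinv_le_contravar. lra. rewrite <- (pow2_abs x). nra. }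
    pose proof (Rle_abs D). pose proof (Rle_abs (- D)) as H'. rewrite Rabs_Ropp in H'.
    pose proof (Rabs_pos D). unfold Rdiv. split; nra. }
  destruct HL as [-> | ->].
  - exists 1. intros x Hx. apply H. rewrite Rabs_right; lra.
  - exists (-1). intros x Hx. apply H. rewrite Rabs_left; lra.
Qed.

(** Integration by parts: the derivative of exp (th z) exp (- z^2 / 2) is (th - z) times itself and
    integrates to 0, so no closed form of [J] is required. *)
Lemma tilted_gauss_first_moment (th J : R) : is_RIntR (fun z => exp (th * z) * gexp z) J ->
  is_RIntR (fun z => z * exp (th * z) * gexp z) (th * J).
Proof.
  intros HJ. set (E := fun z => exp (th * z) * gexp z).
  set (F := fun z => (th - z) * E z).
  assert (Hd : forall z, is_derive E z (F z)).
  { intros z. unfold F, E, gexp. auto_derive; auto.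
    replace (- z ^ 2 / 2) with (- (z * (z * 1)) * / 2) by field. field. }
  assert (Hc : forall z, continuous F z).
  { intros z. apply continuous_Rmult. apply (ex_derive_continuous (fun z => th - z)); auto_derive; auto.
    apply continuous_tilted_gauss. }
  assert (HE : forall b, RInt F 0 b = E b - E 0).
  { intros b. apply is_RInt_unique. apply (is_RInt_derive E F); auto. }
  assert (Hlim : forall L, L = p_infty \/ L = m_infty -> is_lim (fun b => RInt F 0 b) L (0 - E 0)).
  { intros L HL. apply is_lim_ext with (fun b => E b - E 0). intros; symmetry; apply HE.
    apply (is_lim_minus' E (fun _ => E 0) L 0 (E 0)). 2: apply is_lim_const.
    apply (is_lim_le_le_loc (fun x => 0) (fun x => 16 * exp ((Rabs th + 2) ^ 2) / (1 + x ^ 2))).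
    - assert (H : forall x, 0 <= E x <= 16 * exp ((Rabs th + 2) ^ 2) / (1 + x ^ 2)).
      { intros x. split. apply Rmult_le_pos; left; apply exp_pos.
        eapply Rle_trans. apply Rle_abs. apply tilted_gauss_dom. }
      destruct HL as [-> | ->]; exists 0; intros; apply H.
    - apply is_lim_const.
    - apply kernel_lim; auto. }
  assert (H0 : is_RIntR F 0).
  { replace 0 with ((0 - E 0) - (0 - E 0)) by ring.
    apply is_RIntR_of_limits; auto. intros; apply ex_RInt_cont; auto. }
  replace (th * J) with (th * J + -1 * 0) by ring.
  eapply is_RIntR_ext.
  2: apply is_RIntR_plus; [apply (is_RIntR_scal _ th _ HJ)|apply (is_RIntR_scal _ (-1) _ H0)].
  intros x. unfold F, E. ring.
Qed.

Definition setup (p : nat) (beta h : R) (ms : list R) : Prop :=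
  (3 <= p)%nat /\ NoDup ms /\ (forall x, In x ms <-> is_global_max p beta h x) /\
  (forall m, In m ms -> nondeg_max p beta h m).

Definition pow_slope (p : nat) (m : R) : R := INR p * m ^ (p - 1).

(** Kept abstract: it appears in both numerator and denominator of the tilted mean and cancels. *)
Definition tilted_gauss_mass (th : R) : R := proj1_sig (constructive_indefinite_description _ (tilted_gauss_int th)).
Lemma tilted_gauss_mass_spec (th : R) : 0 < tilted_gauss_mass th /\ is_RIntR (fun z => exp (th * z) * gexp z) (tilted_gauss_mass th).
Proof. unfold tilted_gauss_mass. destruct (constructive_indefinite_description _ _); auto. Qed.

Lemma sumR_map_nonneg {T : Type} (f : T -> R) (l : list T) :
  (forall m, In m l -> 0 <= f m) -> 0 <= sumR (map f l).
Proof.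
  induction l as [|a l IH]; intros H; unfold sumR in *; simpl. lra.
  assert (0 <= f a) by (apply H; left; auto). assert (0 <= fold_right Rplus 0 (map f l)).
  { apply IH. intros; apply H; right; auto. } lra.
Qed.

Lemma sumR_map_pos {T : Type} (f : T -> R) (l : list T) (m0 : T) :
  (forall m, In m l -> 0 <= f m) -> In m0 l -> 0 < f m0 -> 0 < sumR (map f l).
Proof.
  induction l as [|a l IH]; intros H Hin Hp; [destruct Hin|].
  assert (Hl : 0 <= sumR (map f l)) by (apply sumR_map_nonneg; intros; apply H; right; auto).
  assert (Ha : 0 <= f a) by (apply H; left; auto).
  change (0 < f a + sumR (map f l)).
  destruct Hin as [->|Hin]. lra.
  assert (0 < sumR (map f l)) by (apply IH; auto; intros; apply H; right; auto). lra.
Qed.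

Lemma sqrt_INR_le (N : nat) : sqrt (INR N) <= 1 + INR N.
Proof.
  pose proof (pos_INR N). pose proof (sqrt_pos (INR N)).
  pose proof (sqrt_sqrt (INR N) ltac:(lra)). nra.
Qed.

Lemma root_n_diff_eq (p : nat) (beta m : R) (N k : nat) : 0 < curvature_sqrt p beta m ->
  sqrt (INR N) * (grid N k ^ p - m ^ p) =
  zgrid (curvature_sqrt p beta m) m N k * / curvature_sqrt p beta m * quot1 (fun x => x ^ p) m (pow_slope p m) (grid N k).
Proof.
  intros Hs. rewrite (quot1_eq (fun x => x ^ p) m (pow_slope p m)). unfold zgrid. field. lra.
Qed.

(** To first order the summand is z [pow_slope] / [curvature_sqrt]. Its tilted mean carries the
    factor [tilt_slope], which contains [pow_slope] / [curvature_sqrt] once more; hence the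
    square. *)
Lemma local_lim_pow_diff (p : nat) (beta h t m : R) : (3 <= p)%nat -> nondeg_max p beta h m ->
  local_lim p beta t m (fun N k => sqrt (INR N) * (grid N k ^ p - m ^ p))
    (t * (pow_slope p m ^ 2 / curvature p beta m) * tilted_gauss_mass (tilt_slope p beta m t)).
Proof.
  intros Hp Gm. pose proof (curvature_sqrt_pos _ _ _ _ Gm) as Hs. destruct Gm as [Im [_ [Nm _]]].
  set (s := curvature_sqrt p beta m) in *.
  assert (El : curvature p beta m = s * s) by (unfold s, curvature_sqrt; rewrite sqrt_sqrt; unfold curvature; lra).
  assert (Hk : Rabs (pow_slope p m) <= INR p).
  { unfold pow_slope. rewrite Rabs_mult, (Rabs_right (INR p)) by (apply Rle_ge, pos_INR).
    pose proof (pow_abs_le_1 (p - 1) m ltac:(lra)). pose proof (pos_INR p). nra. }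
  assert (HB : 0 <= INR p / s) by (apply Rdiv_le_0_compat; auto; apply pos_INR).
  assert (Hid : forall z, Rabs z <= exp (1 * Rabs z)) by (intros; rewrite Rmult_1_l; apply exp_ge_id).
  exists (fun z => z * / s * pow_slope p m), (INR p / s), 1, 0.
  assert (Hc : forall z, continuous (fun z => z * / s * pow_slope p m) z).
  { intros z. apply (ex_derive_continuous (fun z => z * / s * pow_slope p m)). auto_derive; auto. }
  split; [lra|]. split; [|split; [|split; [|split; [|split]]]].
  - intros z _ _. apply filterlim_ext with (fun q => zgrid s m (fst q) (snd q) * / s *
      quot1 (fun x => x ^ p) m (pow_slope p m) (grid (fst q) (snd q))).
    { intros q. symmetry. apply root_n_diff_eq; auto. }
    apply filterlim_Rmult; [typeclasses eauto| |].
    + apply filterlim_Rmult; [typeclasses eauto|apply grid_filter_zgrid|apply filterlim_const].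
    + eapply filterlim_comp. apply grid_filter_grid; auto. apply quot1_lim.
      auto_derive; auto. unfold pow_slope. replace (Init.Nat.pred p) with (p - 1)%nat by lia. ring.
  - intros; apply Hc.
  - intros u v. apply ex_RInt_cont. intros; apply continuous_tilt, Hc.
  - intros N k HN Hk'.
    pose proof (pow_diff_le p (grid N k) m (grid_bounds N k HN Hk') ltac:(lra)) as H1.
    pose proof (sqrt_INR_pos N HN) as Hq.
    rewrite Rabs_mult, (Rabs_right (sqrt _)) by lra.
    apply Rle_trans with (INR p / s * Rabs (zgrid s m N k)).
    2: apply Rmult_le_compat_l; auto.
    unfold zgrid. rewrite !Rabs_mult, (Rabs_right (sqrt _)), (Rabs_right s) by lra.
    replace (INR p / s * (s * sqrt (INR N) * Rabs (grid N k - m))) with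
      (sqrt (INR N) * (INR p * Rabs (grid N k - m))) by (field; lra).
    apply Rmult_le_compat_l; lra.
  - intros z. rewrite !Rabs_mult, (Rabs_right (/ s)) by (left; apply Rinv_0_lt_compat; auto).
    apply Rle_trans with (INR p / s * Rabs z). 2: apply Rmult_le_compat_l; auto.
    assert (0 <= / s * Rabs z) by (apply Rmult_le_pos; [left; apply Rinv_0_lt_compat; auto|apply Rabs_pos]).
    unfold Rdiv. nra.
  - destruct (tilted_gauss_mass_spec (tilt_slope p beta m t)) as [_ HJ].
    replace (t * (pow_slope p m ^ 2 / curvature p beta m) * tilted_gauss_mass (tilt_slope p beta m t)) with
      (/ s * pow_slope p m * (tilt_slope p beta m t * tilted_gauss_mass (tilt_slope p beta m t))).
    2:{ unfold tilt_slope. fold s. fold (pow_slope p m). rewrite El. field. lra. }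
    eapply is_RIntR_ext. 2: apply is_RIntR_scal, tilted_gauss_first_moment, HJ.
    intros x. simpl. ring.
Qed.

(** All selected wells share the value [M] and the response [v], so their weights and masses cancel.
    This covers the symmetric wells -m and m for even p, which no tilt separates. *)
Lemma mean_p_track (p : nat) (beta h t M v : R) (ms : list R) : setup p beta h ms ->
  (exists m, In m ms /\ m ^ p = M) ->
  (forall m, In m ms -> (m ^ p = M /\ pow_slope p m ^ 2 / curvature p beta m = v) \/ t * m ^ p < t * M) ->
  is_lim_seq (fun N => sqrt (INR N) * (mean_p p (beta + t / sqrt (INR N)) h N - M)) (t * v).
Proof.
  intros [Hp [ND [Hin Hgood]]] [m0 [Hm0 Em0]] Hms.
  set (J1 := fun m => if Req_EM_T (m ^ p) M then tilted_gauss_mass (tilt_slope p beta m t) else 0).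
  set (J := fun m => t * v * J1 m).
  assert (HJ1 : forall m, 0 <= J1 m).
  { intros m. unfold J1. destruct (Req_EM_T _ _). left; apply tilted_gauss_mass_spec. lra. }
  assert (Hpos : 0 < sumR (map (fun m => well_weight p beta m * J1 m) ms)).
  { apply sumR_map_pos with m0; auto.
    - intros m Hm. apply Rmult_le_pos; auto. left. apply (well_weight_pos p beta h); auto.
    - apply Rmult_lt_0_compat. apply (well_weight_pos p beta h); auto.
      unfold J1. destruct (Req_EM_T _ _); [apply tilted_gauss_mass_spec|contradiction]. }
  pose proof (tilted_expectation p beta h t M (1 + Rabs M) 1 ms
    (fun N k => sqrt (INR N) * (grid N k ^ p - M)) J J1 Hp ND Hin Hgood) as HT.
  replace (t * v) with (sumR (map (fun m => well_weight p beta m * J m) ms) / sumR (map (fun m => well_weight p beta m * J1 m) ms)).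
  2:{ rewrite (map_ext (fun m => well_weight p beta m * J m) (fun m => well_weight p beta m * J1 m * (t * v))).
      rewrite sumR_map_scal. field. lra. intros; unfold J; ring. }
  apply is_lim_seq_ext with (fun N => model_mean p (beta + t / sqrt (INR N)) h N (fun k => sqrt (INR N) * (grid N k ^ p - M))).
  { intros N. unfold mean_p. set (b := beta + t / sqrt (INR N)).
    pose proof (gibbs_weight_sum_pos p b h N).
    assert (H1 := model_mean_weighted p b h N (fun k => grid N k ^ p) M).
    unfold model_mean at 1. rewrite (sum_eq _ (fun k => gibbs_weight p b h N k * (grid N k ^ p - M) * sqrt (INR N))) by (intros; ring).
    rewrite <- scal_sum, H1. field. lra. }
  apply HT.
  - pose proof (Rabs_pos M). lra.
  - intros N k HN Hk. rewrite Rabs_mult, (Rabs_right (sqrt _)) by (apply Rle_ge, sqrt_pos).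
    pose proof (sqrt_INR_le N). pose proof (sqrt_pos (INR N)). pose proof (pos_INR N).
    assert (Rabs (grid N k ^ p - M) <= 1 + Rabs M).
    { unfold Rminus. eapply Rle_trans. apply Rabs_triang. rewrite Rabs_Ropp.
      apply Rplus_le_compat_r. apply pow_abs_le_1. apply grid_bounds; auto. }
    pose proof (Rabs_pos (grid N k ^ p - M)). rewrite pow_1. rewrite Rmult_comm. apply Rmult_le_compat; auto.
  - intros m Hm. destruct (Hms m Hm) as [[h1 h2]|h1].
    + left. split. rewrite h1; auto. unfold J, J1. destruct (Req_EM_T _ _); [|contradiction].
      split. 2: apply tilted_gauss_mass_spec. rewrite <- h1, <- h2. apply local_lim_pow_diff with h; auto.
    + right. split; auto. assert (m ^ p <> M) by (intros E; rewrite E in h1; lra).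
      unfold J, J1. destruct (Req_EM_T _ _); [contradiction|]. split; ring.
  - lra.
Qed.

Lemma mean_p_track_lim (p : nat) (beta h t M v : R) :
  is_lim_seq (fun N => sqrt (INR N) * (mean_p p (beta + t / sqrt (INR N)) h N - M)) v ->
  is_lim_seq (fun N => mean_p p (beta + t / sqrt (INR N)) h N) M.
Proof.
  intros H.
  apply is_lim_seq_ext_loc with (fun N => (1 / sqrt (INR N)) * (sqrt (INR N) * (mean_p p (beta + t / sqrt (INR N)) h N - M)) + M).
  { exists 1%nat. intros N HN. pose proof (sqrt_INR_pos N HN). field. lra. }
  replace (Finite M) with (Finite (0 * v + M)) by (f_equal; ring).
  apply is_lim_seq_plus'. 2: apply is_lim_seq_const.
  apply is_lim_seq_mult'; auto. apply is_lim_seq_inv_sqrt.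
Qed.

Lemma curvature_sqrt_0 (p : nat) (beta : R) : (3 <= p)%nat -> curvature_sqrt p beta 0 = 1.
Proof. intros Hp. unfold curvature_sqrt, curvature. rewrite H2f_0 by auto. replace (- (-1)) with 1 by ring. apply sqrt_1. Qed.

Lemma tilt_slope_0 (p : nat) (beta t : R) : (3 <= p)%nat -> tilt_slope p beta 0 t = 0.
Proof. intros Hp. unfold tilt_slope. rewrite pow_i by lia. rewrite curvature_sqrt_0 by auto. field. Qed.

Lemma pow_expbound (p : nat) (z : R) : Rabs (z ^ p) <= (INR (S p) / 1) ^ p * exp (1 * Rabs z).
Proof. rewrite <- RPow_abs. apply pow_le_exp. lra. apply Rabs_pos. Qed.

Lemma continuous_pow (p : nat) (z : R) : continuous (fun z => z ^ p) z.
Proof. apply (ex_derive_continuous (fun z => z ^ p)). auto_derive; auto. Qed.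

Lemma is_RIntR_gauss_pow (p : nat) : is_RIntR (fun z => z ^ p * gexp z) (sqrt_2pi * gauss_int (fun u => u ^ p)).
Proof.
  apply gauss_int_ex.
  destruct (ex_RIntR_expbound (fun z => z ^ p) _ 1 0 Rle_0_1
    (fun u v => ex_RInt_cont _ u v (fun z => continuous_tilt _ 0 z (continuous_pow p z))) (pow_expbound p)) as [J HJ].
  exists J. eapply is_RIntR_ext. 2: apply HJ. intros x. simpl. rewrite Rmult_0_l, exp_0. ring.
Qed.

Lemma local_lim_pow_zero (p : nat) (beta t : R) : (3 <= p)%nat ->
  local_lim p beta t 0 (fun N k => (sqrt (INR N) * grid N k) ^ p) (sqrt_2pi * gauss_int (fun u => u ^ p)).
Proof.
  intros Hp. exists (fun z => z ^ p), ((INR (S p) / 1) ^ p), 1, 0.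
  rewrite curvature_sqrt_0, tilt_slope_0 by auto.
  assert (E : forall N k, zgrid 1 0 N k = sqrt (INR N) * grid N k) by (intros; unfold zgrid; ring).
  split; [lra|]. split; [|split; [|split; [|split; [|split]]]].
  - intros z _ _. apply filterlim_ext with (fun q => zgrid 1 0 (fst q) (snd q) ^ p).
    { intros q. rewrite E. auto. }
    apply (filterlim_cont (grid_filter 1 0 z) (fun q => zgrid 1 0 (fst q) (snd q)) (fun x => x ^ p) z).
    apply grid_filter_zgrid. apply continuous_pow.
  - intros; apply continuous_pow.
  - intros u v. apply ex_RInt_cont. intros; apply continuous_tilt, continuous_pow.
  - intros N k _ _. rewrite E. apply pow_expbound.
  - apply pow_expbound.
  - eapply is_RIntR_ext. 2: apply is_RIntR_gauss_pow. intros x. simpl. rewrite Rmult_0_l, exp_0. ring.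
Qed.

Lemma pow_sqrt_le (p N : nat) : sqrt (INR N) ^ p <= (1 + INR N) ^ p.
Proof. apply pow_incr. split. apply sqrt_pos. apply sqrt_INR_le. Qed.

Lemma tilted_gauss_mass_0 : tilted_gauss_mass 0 = sqrt_2pi.
Proof.
  apply is_RIntR_inj with (fun z => exp (0 * z) * gexp z). apply tilted_gauss_mass_spec.
  eapply is_RIntR_ext. 2: apply gexp_int. intros; simpl. rewrite Rmult_0_l, exp_0. ring.
Qed.

(** Around 0, x^p is of order N^(-p/2), so the tilt t sqrt N x^p vanishes and the limit is the
    untilted moment, the same for every t that suppresses the other wells. *)
Lemma mean_p_zero_well (p : nat) (beta h t : R) (ms : list R) : setup p beta h ms -> In 0 ms ->
  (forall m, In m ms -> m = 0 \/ t * m ^ p < 0) ->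
  is_lim_seq (fun N => sqrt (INR N) ^ p * mean_p p (beta + t / sqrt (INR N)) h N) (gauss_int (fun u => u ^ p)).
Proof.
  intros [Hp [ND [Hin Hgood]]] H0 Hms.
  set (c := gauss_int (fun u => u ^ p)).
  set (J1 := fun m => if Req_EM_T m 0 then sqrt_2pi else 0).
  set (J := fun m => c * J1 m).
  pose proof sqrt_2pi_pos as Hs2.
  assert (HJ1 : forall m, 0 <= J1 m).
  { intros m. unfold J1. destruct (Req_EM_T _ _); lra. }
  assert (Hpos : 0 < sumR (map (fun m => well_weight p beta m * J1 m) ms)).
  { apply sumR_map_pos with 0; auto.
    - intros m Hm. apply Rmult_le_pos; auto. left. apply (well_weight_pos p beta h); auto.
    - apply Rmult_lt_0_compat. apply (well_weight_pos p beta h); auto.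
      unfold J1. destruct (Req_EM_T _ _); [auto|contradiction]. }
  pose proof (tilted_expectation p beta h t 0 1 p ms
    (fun N k => (sqrt (INR N) * grid N k) ^ p) J J1 Hp ND Hin Hgood) as HT.
  replace c with (sumR (map (fun m => well_weight p beta m * J m) ms) / sumR (map (fun m => well_weight p beta m * J1 m) ms)).
  2:{ rewrite (map_ext (fun m => well_weight p beta m * J m) (fun m => well_weight p beta m * J1 m * c)).
      rewrite sumR_map_scal. field. lra. intros; unfold J; ring. }
  apply is_lim_seq_ext with (fun N => model_mean p (beta + t / sqrt (INR N)) h N (fun k => (sqrt (INR N) * grid N k) ^ p)).
  { intros N. unfold mean_p, model_mean. pose proof (gibbs_weight_sum_pos p (beta + t / sqrt (INR N)) h N).
    rewrite (sum_eq _ (fun k => gibbs_weight p (beta + t / sqrt (INR N)) h N k * grid N k ^ p * sqrt (INR N) ^ p)).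
    rewrite <- scal_sum. field. lra. intros. rewrite Rpow_mult_distr. ring. }
  apply HT.
  - lra.
  - intros N k HN Hk. rewrite Rpow_mult_distr, Rabs_mult, Rabs_right by (apply Rle_ge, pow_le, sqrt_pos).
    pose proof (pow_sqrt_le p N). pose proof (pow_abs_le_1 p (grid N k) (grid_bounds N k HN Hk)).
    rewrite Rmult_comm. apply Rmult_le_compat; auto. apply Rabs_pos. apply pow_le, sqrt_pos.
  - intros m Hm. destruct (Req_dec m 0) as [->|h0].
    + left. split. rewrite pow_i by lia. ring. unfold J, J1. destruct (Req_EM_T 0 0); [|lra].
      split. rewrite Rmult_comm. apply local_lim_pow_zero; auto.
      rewrite tilt_slope_0 by auto. rewrite <- tilted_gauss_mass_0. apply tilted_gauss_mass_spec.
    + right. destruct (Hms m Hm) as [h1|h1]; [contradiction|]. split. lra.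
      unfold J, J1. destruct (Req_EM_T m 0); [contradiction|]. split; ring.
  - lra.
Qed.

(** * Limit of the error on each well *)

Lemma ext_bounded (g : R -> R) (lm lp : R) :
  (forall x, continuous g x) -> is_lim g m_infty lm -> is_lim g p_infty lp ->
  exists B, 0 <= B /\ forall y, Rabs (ext g lm lp y) <= B.
Proof.
  intros Hc Hm Hp.
  destruct (Hm (fun y => Rabs (y - lm) < 1)) as [a Ha]. { exists (mkposreal 1 Rlt_0_1). auto. }
  destruct (Hp (fun y => Rabs (y - lp) < 1)) as [b Hb]. { exists (mkposreal 1 Rlt_0_1). auto. }
  set (a' := Rmin a b - 1). set (b' := Rmax a b + 1).
  pose proof (Rmin_l a b). pose proof (Rmin_r a b). pose proof (Rmax_l a b). pose proof (Rmax_r a b).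
  destruct (continuity_ab_maj (fun x => Rabs (g x)) a' b') as [M [HM _]].
  { unfold a', b'; lra. }
  { intros x _. apply continuity_pt_filterlim. apply (continuous_comp g Rabs). auto. apply continuous_Rabs. }
  exists (Rmax (Rabs (g M)) (Rmax (Rabs lm + 1) (Rabs lp + 1))).
  set (B := Rmax (Rabs (g M)) (Rmax (Rabs lm + 1) (Rabs lp + 1))).
  assert (B1 : Rabs (g M) <= B) by apply Rmax_l.
  assert (B2 : Rabs lm + 1 <= B) by (eapply Rle_trans; [apply Rmax_l|apply Rmax_r]).
  assert (B3 : Rabs lp + 1 <= B) by (eapply Rle_trans; [apply Rmax_r|apply Rmax_r]).
  split. pose proof (Rabs_pos (g M)); lra.
  intros [y| |]; simpl; try lra.
  destruct (Rlt_dec y a) as [h1|h1].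
  - specialize (Ha y h1). replace (g y) with ((g y - lm) + lm) by ring.
    eapply Rle_trans. apply Rabs_triang. lra.
  - destruct (Rlt_dec b y) as [h2|h2].
    + specialize (Hb y h2). replace (g y) with ((g y - lp) + lp) by ring.
      eapply Rle_trans. apply Rabs_triang. lra.
    + eapply Rle_trans. apply (HM y). unfold a', b'; lra. auto.
Qed.

Lemma exists_between_nonzero (a b : R) : a < b -> exists t, a < t < b /\ t <> 0.
Proof.
  intros H. destruct (Req_dec ((a + b) / 2) 0) as [h|h].
  - exists ((a + 3 * b) / 4). lra.
  - exists ((a + b) / 2). lra.
Qed.

(** Two nonzero thresholds around [tau], within the continuity radius of [g], trap [S]. Excluding t
    = 0 is essential: the level is understood only when the tilt selects wells. *)
Lemma ext_lim {T : Type} (F : (T -> Prop) -> Prop) {FF : Filter F} (g : R -> R) (lm lp tau : R) (S : T -> Rbar) :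
  continuous g tau ->
  (forall t, t <> 0 -> tau < t -> F (fun q => Rbar_le (S q) t)) ->
  (forall t, t <> 0 -> t < tau -> F (fun q => ~ Rbar_le (S q) t)) ->
  filterlim (fun q => ext g lm lp (S q)) F (locally (g tau)).
Proof.
  intros Hc H1 H2. apply filterlim_locally. intros eps.
  destruct (proj1 (filterlim_locally (F := locally tau) _ _) Hc eps) as [d Hd]. pose proof (cond_pos d).
  destruct (exists_between_nonzero (tau - d) tau ltac:(lra)) as [t1 [h1 n1]].
  destruct (exists_between_nonzero tau (tau + d) ltac:(lra)) as [t2 [h2 n2]].
  generalize (filter_and _ _ (H1 t2 n2 (proj1 h2)) (H2 t1 n1 (proj2 h1))). apply filter_imp.
  intros q [k1 k2]. destruct (S q) as [y| |]; simpl in *; try tauto.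
  apply Hd. change (Rabs (y - tau) < d). apply Rabs_def1; lra.
Qed.

Lemma ext_lim_m {T : Type} (F : (T -> Prop) -> Prop) {FF : Filter F} (g : R -> R) (lm lp : R) (S : T -> Rbar) :
  is_lim g m_infty lm -> (forall t, t < 0 -> F (fun q => Rbar_le (S q) t)) ->
  filterlim (fun q => ext g lm lp (S q)) F (locally lm).
Proof.
  intros Hg H1. apply filterlim_locally. intros eps.
  destruct (Hg (ball lm eps)) as [a Ha]. { exists eps. auto. }
  assert (Ht : Rmin (a - 1) (-1) < 0) by (pose proof (Rmin_r (a - 1) (-1)); lra).
  pose proof (Rmin_l (a - 1) (-1)).
  generalize (H1 _ Ht). apply filter_imp. intros q k1. destruct (S q) as [y| |]; simpl in *; try tauto.
  - apply Ha. lra.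
  - apply ball_center.
Qed.

(** [rho] is the scale on which x^p and the level separate: sqrt N in a tracked well, sqrt N ^ p at
    the origin, and 1 when they have different limits. *)
Lemma err_at_compare (p : nat) (beta h s m z t : R) (rho : nat -> R) (c l1 l2 : R) : (1 <= p)%nat ->
  (forall N, (1 <= N)%nat -> 0 < rho N) ->
  filterlim (fun q => rho (fst q) * (grid (fst q) (snd q) ^ p - c)) (grid_filter s m z) (locally l1) ->
  is_lim_seq (fun N => rho N * (mean_p p (beta + t / sqrt (INR N)) h N - c)) l2 ->
  (l1 < l2 -> grid_filter s m z (fun q => Rbar_le (err_at p beta h (fst q) (grid (fst q) (snd q))) t)) /\
  (l2 < l1 -> grid_filter s m z (fun q => ~ Rbar_le (err_at p beta h (fst q) (grid (fst q) (snd q))) t)).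
Proof.
  intros Hp Hrho L1 L2.
  assert (K : forall e, 0 < e -> grid_filter s m z (fun q => (2 <= fst q)%nat /\ (0 < rho (fst q)) /\
     Rabs (rho (fst q) * (grid (fst q) (snd q) ^ p - c) - l1) < e /\
     Rabs (rho (fst q) * (mean_p p (beta + t / sqrt (INR (fst q))) h (fst q) - c) - l2) < e)).
  { intros e He.
    assert (K1 : grid_filter s m z (fun q => (2 <= fst q)%nat)).
    { apply (grid_filter_fst s m z). exists 2%nat; auto. }
    assert (K2 : grid_filter s m z (fun q => Rabs (rho (fst q) * (grid (fst q) (snd q) ^ p - c) - l1) < e)).
    { apply (L1 (fun y => Rabs (y - l1) < e)). exists (mkposreal e He). auto. }
    assert (K3 : grid_filter s m z (fun q => Rabs (rho (fst q) * (mean_p p (beta + t / sqrt (INR (fst q))) h (fst q) - c) - l2) < e)).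
    { apply (grid_filter_fst s m z (fun N => Rabs (rho N * (mean_p p (beta + t / sqrt (INR N)) h N - c) - l2) < e)).
      apply (L2 (fun y => Rabs (y - l2) < e)). exists (mkposreal e He). auto. }
    generalize (filter_and _ _ K1 (filter_and _ _ K2 K3)). apply filter_imp.
    intros q [a1 [a2 a3]]. split; auto. split; auto. apply Hrho. lia. }
  split; intros Hl.
  - generalize (K ((l2 - l1) / 2) ltac:(lra)). apply filter_imp. intros [N k] [a1 [a2 [a3 a4]]]. simpl in *.
    apply err_at_le; auto. apply Rabs_def2 in a3, a4.
    apply Rmult_le_reg_l with (rho N); auto. nra.
  - generalize (K ((l1 - l2) / 2) ltac:(lra)). apply filter_imp. intros [N k] [a1 [a2 [a3 a4]]]. simpl in *.
    rewrite err_at_le by auto. apply Rabs_def2 in a3, a4. intros Hle.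
    apply Rmult_le_compat_l with (r := rho N) in Hle; lra.
Qed.

(** The untilted counterpart of [local_lim] for bounded functions, with sqrt (2 pi) split off so
    that [E] is a Gaussian expectation. *)
Definition well_lim (p : nat) (beta m : R) (phi : nat -> nat -> R) (E : R) : Prop :=
  exists (Phi : R -> R) (B r : R),
   (forall z, z <> r -> z <> - r ->
      filterlim (fun q => phi (fst q) (snd q)) (grid_filter (curvature_sqrt p beta m) m z) (locally (Phi z))) /\
   (forall z, z <> r -> z <> - r -> continuous Phi z) /\
   (forall u v, ex_RInt (fun z => Phi z * gexp z) u v) /\
   (forall z, Rabs (Phi z) <= B) /\
   is_RIntR (fun z => Phi z * gexp z) (sqrt_2pi * E).

Lemma untilted (Phi : R -> R) (th x : R) : th = 0 -> Phi x * gexp x = Phi x * exp (th * x) * gexp x.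
Proof. intros ->. rewrite Rmult_0_l, exp_0. ring. Qed.

Lemma well_mixture (p : nat) (beta h B : R) (ms : list R) (phi : nat -> nat -> R) (E : R -> R) :
  setup p beta h ms -> ms <> nil -> 0 <= B ->
  (forall N k, Rabs (phi N k) <= B) -> (forall m, In m ms -> well_lim p beta m phi (E m)) ->
  is_lim_seq (fun N => model_mean p beta h N (phi N))
    (sumR (map (fun m => well_weight p beta m * E m) ms) / sumR (map (well_weight p beta) ms)).
Proof.
  intros [Hp [ND [Hin Hgood]]] Hne HB Hphi HE.
  pose proof sqrt_2pi_pos as Hs2.
  assert (Hpos : 0 < sumR (map (well_weight p beta) ms)).
  { destruct ms as [|m0 l]; [contradiction|]. apply sumR_map_pos with m0; auto.
    - intros m Hm. left. apply (well_weight_pos p beta h); auto.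
    - left; auto.
    - apply (well_weight_pos p beta h). apply Hgood. left; auto. }
  replace (sumR (map (fun m => well_weight p beta m * E m) ms) / sumR (map (well_weight p beta) ms))
    with (sumR (map (fun m => well_weight p beta m * (sqrt_2pi * E m)) ms) / sumR (map (fun m => well_weight p beta m * sqrt_2pi) ms)).
  2:{ rewrite (map_ext (fun m => well_weight p beta m * (sqrt_2pi * E m)) (fun m => well_weight p beta m * E m * sqrt_2pi)) by (intros; ring).
      rewrite !sumR_map_scal. field. lra. }
  apply is_lim_seq_ext with (fun N => model_mean p (beta + 0 / sqrt (INR N)) h N (phi N)).
  { intros N. replace (beta + 0 / sqrt (INR N)) with beta; auto. unfold Rdiv. ring. }
  assert (Hth : forall m, tilt_slope p beta m 0 = 0) by (intros; unfold tilt_slope, Rdiv; ring).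
  (* With t = 0 every well is selected, so the value 0 given for [M] is arbitrary. *)
  apply (tilted_expectation p beta h 0 0 B 0 ms phi (fun m => sqrt_2pi * E m) (fun _ => sqrt_2pi)); auto.
  - intros. simpl. rewrite Rmult_1_r. auto.
  - intros m Hm. left. split; [ring|]. split.
    + destruct (HE m Hm) as [Phi [B' [r [a1 [a2 [a3 [a4 a5]]]]]]].
      assert (H0 : 0 <= B') by (eapply Rle_trans; [apply Rabs_pos|apply (a4 0)]).
      pose proof (Rmax_l B' B). pose proof (Rmax_r B' B).
      exists Phi, (Rmax B' B), 0, r. split; [lra|]. split; [auto|]. split; [auto|].
      split; [|split; [|split]].
      * intros u v. apply ex_RInt_ext with (fun z => Phi z * gexp z); auto.
        intros x _. apply untilted; auto.
      * intros. rewrite Rmult_0_l, exp_0, Rmult_1_r. eapply Rle_trans; [apply Hphi|auto].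
      * intros. rewrite Rmult_0_l, exp_0, Rmult_1_r. eapply Rle_trans; [apply a4|auto].
      * eapply is_RIntR_ext. 2: apply a5. intros; apply untilted; auto.
    + rewrite Hth. rewrite <- tilted_gauss_mass_0. apply tilted_gauss_mass_spec.
  - rewrite sumR_map_scal. apply Rgt_not_eq. nra.
Qed.

Lemma gauss_int_bounded (f : R -> R) (B : R) : (forall x, continuous f x) -> (forall x, Rabs (f x) <= B) ->
  is_RIntR (fun z => f z * gexp z) (sqrt_2pi * gauss_int f).
Proof.
  intros Hc HB. apply gauss_int_ex.
  destruct (ex_RIntR_expbound f B 0 0) as [J HJ]. lra.
  - intros u v. apply ex_RInt_cont. intros; apply continuous_tilt; auto.
  - intros z. rewrite Rmult_0_l, exp_0, Rmult_1_r. auto.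
  - exists J. eapply is_RIntR_ext. 2: apply HJ. intros x. simpl. symmetry. apply untilted; auto.
Qed.

(** Pairing x with -x turns the law of a positive or negative part into half a half-normal law plus
    half an atom at 0. *)
Lemma gauss_int_symm (f k : R -> R) (c B : R) : (forall x, continuous f x) -> (forall x, Rabs (f x) <= B) ->
  (forall x, f x + f (- x) = k x + c) -> gauss_int f = / 2 * gauss_int k + / 2 * c.
Proof.
  intros Hc HB Hk.
  pose proof (gauss_int_bounded f B Hc HB) as H1.
  pose proof (is_RIntR_plus _ _ _ _ H1 (is_RIntR_opp_arg _ _ H1)) as H2.
  pose proof (is_RIntR_plus _ _ _ _ H2 (is_RIntR_scal _ (- c) _ gexp_int)) as H3.
  enough (gauss_int k = 2 * gauss_int f - c) by lra.
  apply gauss_int_of.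
  replace (sqrt_2pi * (2 * gauss_int f - c)) with (sqrt_2pi * gauss_int f + sqrt_2pi * gauss_int f + - c * sqrt (2 * PI))
    by (unfold sqrt_2pi; ring).
  eapply is_RIntR_ext. 2: apply H3. intros x. simpl. rewrite gexp_opp.
  replace (k x) with (f x + f (- x) - c) by (rewrite Hk; ring). ring.
Qed.

Definition test_err (p : nat) (beta h : R) (g : R -> R) (lm lp : R) (N k : nat) : R :=
  ext g lm lp (err_at p beta h N (grid N k)).

Lemma well_tau (p : nat) (beta h m : R) (g tau : R -> R) (lm lp : R) :
  (forall x, continuous g x) -> is_lim g m_infty lm -> is_lim g p_infty lp ->
  (forall z, continuous tau z) ->
  (forall z t, t <> 0 -> tau z < t ->
     grid_filter (curvature_sqrt p beta m) m z (fun q => Rbar_le (err_at p beta h (fst q) (grid (fst q) (snd q))) t)) ->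
  (forall z t, t <> 0 -> t < tau z ->
     grid_filter (curvature_sqrt p beta m) m z (fun q => ~ Rbar_le (err_at p beta h (fst q) (grid (fst q) (snd q))) t)) ->
  well_lim p beta m (test_err p beta h g lm lp) (gauss_int (fun z => g (tau z))).
Proof.
  intros Hc Hm Hp Ht H1 H2.
  destruct (ext_bounded g lm lp Hc Hm Hp) as [B [_ HB]].
  assert (Hcc : forall z, continuous (fun z => g (tau z)) z) by (intros; apply (continuous_comp tau g); auto).
  exists (fun z => g (tau z)), B, 0. split; [|split; [|split; [|split]]].
  - intros z _ _. unfold test_err. apply ext_lim; auto. typeclasses eauto.
  - intros; apply Hcc.
  - intros u v. apply ex_RInt_cont. intros; apply continuous_Rmult; auto. apply continuous_gexp.
  - intros z. apply (HB (Finite (tau z))).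
  - apply gauss_int_bounded with B; auto. intros z. apply (HB (Finite (tau z))).
Qed.

(** Obtained by equating the fluctuation z [pow_slope] / [curvature_sqrt] with the response t
    [pow_slope]^2 / [curvature] and solving for t; its square is [sigma2]. *)
Definition err_slope (p : nat) (beta m : R) : R := curvature_sqrt p beta m / pow_slope p m.

Lemma pow_slope_neq0 (p : nat) (m : R) : (3 <= p)%nat -> m <> 0 -> pow_slope p m <> 0.
Proof.
  intros Hp Hm. unfold pow_slope. apply Rmult_integral_contrapositive. split.
  apply not_0_INR; lia. apply pow_nonzero; auto.
Qed.

Lemma sqrt_sigma2 (p : nat) (beta h m : R) : (3 <= p)%nat -> nondeg_max p beta h m -> m <> 0 ->
  sqrt (sigma2 p beta h m) = Rabs (err_slope p beta m).
Proof.
  intros Hp Gm Hm. pose proof (curvature_sqrt_pos _ _ _ _ Gm) as Hs. pose proof (pow_slope_neq0 p m Hp Hm) as Hk.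
  destruct Gm as [Im [_ [Nm _]]].
  assert (E : sigma2 p beta h m = Rsqr (err_slope p beta m)).
  { unfold sigma2. rewrite H2_eq by (auto; lia). unfold Rsqr, err_slope.
    replace (- H2f p beta m) with (curvature_sqrt p beta m * curvature_sqrt p beta m) by (unfold curvature_sqrt; rewrite sqrt_sqrt; unfold curvature; lra).
    assert (Ek : INR p ^ 2 * m ^ (2 * p - 2) = pow_slope p m * pow_slope p m).
    { unfold pow_slope. replace (2 * p - 2)%nat with ((p - 1) + (p - 1))%nat by lia. rewrite pow_add. ring. }
    rewrite Ek. field. auto. }
  rewrite E. apply sqrt_Rsqr_abs.
Qed.

Lemma pow_diff_lim (p : nat) (beta h m z : R) : (3 <= p)%nat -> nondeg_max p beta h m ->
  filterlim (fun q => sqrt (INR (fst q)) * (grid (fst q) (snd q) ^ p - m ^ p)) (grid_filter (curvature_sqrt p beta m) m z)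
    (locally (z * / curvature_sqrt p beta m * pow_slope p m)).
Proof.
  intros Hp Gm. pose proof (curvature_sqrt_pos _ _ _ _ Gm) as Hs.
  apply filterlim_ext with (fun q => zgrid (curvature_sqrt p beta m) m (fst q) (snd q) * / curvature_sqrt p beta m *
    quot1 (fun x => x ^ p) m (pow_slope p m) (grid (fst q) (snd q))).
  { intros q. symmetry. apply root_n_diff_eq; auto. }
  apply filterlim_Rmult; [typeclasses eauto| |].
  - apply filterlim_Rmult; [typeclasses eauto|apply grid_filter_zgrid|apply filterlim_const].
  - eapply filterlim_comp. apply grid_filter_grid; auto. apply quot1_lim.
    auto_derive; auto. unfold pow_slope. replace (Init.Nat.pred p) with (p - 1)%nat by lia. ring.
Qed.

(** Linear response of the level. The coefficient is the limiting variance of sqrt N x^p inside the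
    well, as befits the derivative of a mean in its natural parameter. *)
Definition tracks (p : nat) (beta h m t : R) : Prop :=
  is_lim_seq (fun N => sqrt (INR N) * (mean_p p (beta + t / sqrt (INR N)) h N - m ^ p))
    (t * (pow_slope p m ^ 2 / curvature p beta m)).

Definition mean_lim (p : nat) (beta h t a : R) : Prop :=
  is_lim_seq (fun N => mean_p p (beta + t / sqrt (INR N)) h N) a.

Lemma tracks_compare (p : nat) (beta h m z t : R) : (3 <= p)%nat -> nondeg_max p beta h m -> m <> 0 ->
  tracks p beta h m t ->
  (err_slope p beta m * z < t -> grid_filter (curvature_sqrt p beta m) m z (fun q => Rbar_le (err_at p beta h (fst q) (grid (fst q) (snd q))) t)) /\
  (t < err_slope p beta m * z -> grid_filter (curvature_sqrt p beta m) m z (fun q => ~ Rbar_le (err_at p beta h (fst q) (grid (fst q) (snd q))) t)).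
Proof.
  intros Hp Gm Hm Ht.
  pose proof (curvature_sqrt_pos _ _ _ _ Gm) as Hs. pose proof (pow_slope_neq0 p m Hp Hm) as Hk.
  assert (El : curvature p beta m = curvature_sqrt p beta m * curvature_sqrt p beta m).
  { destruct Gm as [Im [_ [Nm _]]]. unfold curvature_sqrt. rewrite sqrt_sqrt; auto. unfold curvature; lra. }
  destruct (err_at_compare p beta h (curvature_sqrt p beta m) m z t (fun N => sqrt (INR N)) (m ^ p)
    (z * / curvature_sqrt p beta m * pow_slope p m) (t * (pow_slope p m ^ 2 / curvature p beta m))) as [h1 h2]; auto.
  { lia. } { intros; apply sqrt_INR_pos; auto. } { apply pow_diff_lim with h; auto. }
  set (v := pow_slope p m ^ 2 / curvature p beta m) in *.
  assert (Hv : 0 < v).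
  { unfold v. apply Rdiv_lt_0_compat. rewrite <- pow2_abs. apply pow_lt, Rabs_pos_lt; auto. rewrite El. nra. }
  assert (E : z * / curvature_sqrt p beta m * pow_slope p m = err_slope p beta m * z * v).
  { unfold v, err_slope. rewrite El. field. lra. }
  rewrite E in h1, h2. split; intros H; [apply h1|apply h2]; nra.
Qed.

Lemma level_compare (p : nat) (beta h m z t a : R) : (3 <= p)%nat -> nondeg_max p beta h m ->
  mean_lim p beta h t a ->
  (m ^ p < a -> grid_filter (curvature_sqrt p beta m) m z (fun q => Rbar_le (err_at p beta h (fst q) (grid (fst q) (snd q))) t)) /\
  (a < m ^ p -> grid_filter (curvature_sqrt p beta m) m z (fun q => ~ Rbar_le (err_at p beta h (fst q) (grid (fst q) (snd q))) t)).
Proof.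
  intros Hp Gm Ha. pose proof (curvature_sqrt_pos _ _ _ _ Gm) as Hs.
  apply (err_at_compare p beta h (curvature_sqrt p beta m) m z t (fun _ => 1) 0 (m ^ p) a).
  - lia.
  - intros; lra.
  - apply filterlim_ext with (fun q => grid (fst q) (snd q) ^ p). intros; ring.
    apply (filterlim_cont (grid_filter (curvature_sqrt p beta m) m z) (fun q => grid (fst q) (snd q)) (fun x => x ^ p) m).
    apply grid_filter_grid; auto. apply continuous_pow.
  - eapply is_lim_seq_ext. 2: apply Ha. intros; simpl; ring.
Qed.

Lemma continuous_linear_abs (a b z : R) : continuous (fun z => a * z + b * Rabs z) z.
Proof.
  apply (continuous_plus (fun z => a * z) (fun z => b * Rabs z)).
  apply (ex_derive_continuous (fun z => a * z)). auto_derive; auto.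
  apply continuous_Rmult. apply continuous_const. apply continuous_Rabs.
Qed.

Lemma Rabs_mult_l (a z : R) : Rabs (Rabs a * z) = Rabs a * Rabs z.
Proof. rewrite Rabs_mult, Rabs_Rabsolu. auto. Qed.

(** For t > 0 the level follows this well; for t < 0 it falls to a lower value which every point of
    the well exceeds. No error stays below a negative t, so only the positive part of the line
    survives. *)
Lemma well_up (p : nat) (beta h m : R) (g : R -> R) (lm lp : R) :
  (forall x, continuous g x) -> is_lim g m_infty lm -> is_lim g p_infty lp ->
  (3 <= p)%nat -> nondeg_max p beta h m -> m <> 0 ->
  (forall t, 0 < t -> tracks p beta h m t) ->
  (forall t, t < 0 -> exists a, mean_lim p beta h t a /\ a < m ^ p) ->
  well_lim p beta m (test_err p beta h g lm lp)
    (/ 2 * comp_int (HalfPos (sigma2 p beta h m)) g lm lp + / 2 * g 0).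
Proof.
  intros Hc Hm Hlp Hp Gm Hm0 Hup Hdn.
  set (c := err_slope p beta m).
  (* The positive part of c z as (c z + |c z|) / 2, a form whose continuity and symmetrisation are
     immediate for either sign of [c]. *)
  set (tau := fun z => c / 2 * z + Rabs c / 2 * Rabs z).
  assert (Etau : forall z, tau z = (c * z + Rabs (c * z)) / 2) by (intros; unfold tau; rewrite Rabs_mult; field).
  assert (Htau : forall z, continuous tau z) by (intros; apply continuous_linear_abs).
  destruct (ext_bounded g lm lp Hc Hm Hlp) as [B [_ HB]].
  replace (/ 2 * comp_int (HalfPos (sigma2 p beta h m)) g lm lp + / 2 * g 0) with (gauss_int (fun z => g (tau z))).
  - apply well_tau; auto.
    + intros z t Ht Hlt. rewrite Etau in Hlt. pose proof (Rle_abs (c * z)).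
      assert (0 <= c * z + Rabs (c * z)) by (pose proof (Rle_abs (- (c * z))) as Hh; rewrite Rabs_Ropp in Hh; lra).
      apply tracks_compare; auto. apply Hup; lra. fold c. lra.
    + intros z t Ht Hlt. destruct (Rdichotomy _ _ Ht) as [h1|h1].
      * destruct (Hdn t h1) as [a [Ha1 Ha2]]. apply (level_compare p beta h m z t a); auto.
      * apply tracks_compare; auto. fold c. rewrite Etau in Hlt.
        destruct (Rle_dec 0 (c * z)). rewrite Rabs_right in Hlt by lra. lra.
        rewrite Rabs_left in Hlt by lra. lra.
  - simpl. rewrite sqrt_sigma2 by auto. fold c.
    apply (gauss_int_symm _ _ _ B).
    + intros; apply (continuous_comp tau g); auto.
    + intros x. apply (HB (Finite (tau x))).
    + intros x. rewrite !Etau. replace (c * - x) with (- (c * x)) by ring. rewrite Rabs_Ropp.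
      rewrite Rabs_mult_l, <- Rabs_mult.
      destruct (Rle_dec 0 (c * x)).
      * rewrite Rabs_right by lra. f_equal; f_equal; field.
      * rewrite Rabs_left by lra. rewrite Rplus_comm. f_equal; f_equal; field.
Qed.

(** Mirror image of [well_up]: negative t follow the well, and for positive t the level jumps above
    it. *)
Lemma well_down (p : nat) (beta h m : R) (g : R -> R) (lm lp : R) :
  (forall x, continuous g x) -> is_lim g m_infty lm -> is_lim g p_infty lp ->
  (3 <= p)%nat -> nondeg_max p beta h m -> m <> 0 ->
  (forall t, t < 0 -> tracks p beta h m t) ->
  (forall t, 0 < t -> exists a, mean_lim p beta h t a /\ m ^ p < a) ->
  well_lim p beta m (test_err p beta h g lm lp)
    (/ 2 * comp_int (HalfNeg (sigma2 p beta h m)) g lm lp + / 2 * g 0).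
Proof.
  intros Hc Hm Hlp Hp Gm Hm0 Hdn Hup.
  set (c := err_slope p beta m).
  set (tau := fun z => c / 2 * z + (- Rabs c / 2) * Rabs z).
  assert (Etau : forall z, tau z = (c * z - Rabs (c * z)) / 2) by (intros; unfold tau; rewrite Rabs_mult; field).
  assert (Htau : forall z, continuous tau z) by (intros; apply continuous_linear_abs).
  destruct (ext_bounded g lm lp Hc Hm Hlp) as [B [_ HB]].
  replace (/ 2 * comp_int (HalfNeg (sigma2 p beta h m)) g lm lp + / 2 * g 0) with (gauss_int (fun z => g (tau z))).
  - apply well_tau; auto.
    + intros z t Ht Hlt. destruct (Rdichotomy _ _ Ht) as [h1|h1].
      * apply tracks_compare; auto. fold c. rewrite Etau in Hlt.
        destruct (Rle_dec 0 (c * z)). rewrite Rabs_right in Hlt by lra. lra.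
        rewrite Rabs_left in Hlt by lra. lra.
      * destruct (Hup t h1) as [a [Ha1 Ha2]]. apply (level_compare p beta h m z t a); auto.
    + intros z t Ht Hlt. rewrite Etau in Hlt. pose proof (Rle_abs (c * z)).
      assert (- Rabs (c * z) <= c * z) by (pose proof (Rle_abs (- (c * z))) as Hh; rewrite Rabs_Ropp in Hh; lra).
      apply tracks_compare; auto. apply Hdn; lra. fold c. lra.
  - simpl. rewrite sqrt_sigma2 by auto. fold c.
    apply (gauss_int_symm _ _ _ B).
    + intros; apply (continuous_comp tau g); auto.
    + intros x. apply (HB (Finite (tau x))).
    + intros x. rewrite !Etau. replace (c * - x) with (- (c * x)) by ring. rewrite Rabs_Ropp.
      rewrite Rabs_mult_l, <- Rabs_mult.
      destruct (Rle_dec 0 (c * x)).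
      * rewrite Rabs_right by lra. rewrite Rplus_comm. f_equal; f_equal; field.
      * rewrite Rabs_left by lra. f_equal; f_equal; field.
Qed.

Lemma well_both (p : nat) (beta h m : R) (g : R -> R) (lm lp : R) :
  (forall x, continuous g x) -> is_lim g m_infty lm -> is_lim g p_infty lp ->
  (3 <= p)%nat -> nondeg_max p beta h m -> m <> 0 ->
  (forall t, tracks p beta h m t) ->
  well_lim p beta m (test_err p beta h g lm lp) (comp_int (Normal (sigma2 p beta h m)) g lm lp).
Proof.
  intros Hc Hm Hlp Hp Gm Hm0 Htr.
  set (c := err_slope p beta m).
  destruct (ext_bounded g lm lp Hc Hm Hlp) as [B [_ HB]].
  assert (Hcont : forall z, continuous (fun z => c * z) z).
  { intros z. apply (ex_derive_continuous (fun z => c * z)). auto_derive; auto. }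
  replace (comp_int (Normal (sigma2 p beta h m)) g lm lp) with (gauss_int (fun z => g (c * z))).
  - apply (well_tau p beta h m g (fun z => c * z)); auto; intros z t _ Hlt; apply tracks_compare; auto.
  - simpl. rewrite sqrt_sigma2 by auto. fold c.
    (* The limit law uses |c| as standard deviation; a negative slope is absorbed by z -> -z. *)
    destruct (Rle_dec 0 c). rewrite Rabs_right by lra; auto. rewrite Rabs_left by lra.
    symmetry. apply gauss_int_of.
    eapply is_RIntR_ext. 2: apply is_RIntR_opp_arg, (gauss_int_bounded (fun z => g (c * z)) B).
    + intros x. simpl. rewrite gexp_opp. do 2 f_equal. ring.
    + intros; apply (continuous_comp (fun z => c * z) g); auto.
    + intros x. apply (HB (Finite (c * x))).
Qed.

(** * Integrals with jumps, and the well at the origin *)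

Lemma RInt_ends_neq (c a x : R) : Rmin a c < x < Rmax a c -> x <> c.
Proof.
  intros H E. subst x. destruct (Rle_dec a c).
  - rewrite Rmin_left, Rmax_right in H; lra.
  - rewrite Rmin_right, Rmax_left in H; lra.
Qed.

(** The value at the cut is left free, since integrability sees only the open pieces. *)
Lemma ex_RInt_cut (F G1 G2 : R -> R) (c : R) :
  (forall z, z < c -> F z = G1 z) -> (forall z, c < z -> F z = G2 z) ->
  (forall a b, ex_RInt G1 a b) -> (forall a b, ex_RInt G2 a b) -> forall a b, ex_RInt F a b.
Proof.
  intros H1 H2 E1 E2.
  assert (H : forall a, ex_RInt F a c).
  { intros a. destruct (Rle_dec a c) as [h|h].
    - apply ex_RInt_ext with G1; auto. rewrite Rmin_left, Rmax_right by lra.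
      intros x Hx. symmetry. apply H1. lra.
    - apply ex_RInt_ext with G2; auto. rewrite Rmin_right, Rmax_left by lra.
      intros x Hx. symmetry. apply H2. lra. }
  intros a b. apply ex_RInt_Chasles with c; auto. apply ex_RInt_swap. auto.
Qed.

Lemma is_RIntR_off_point (F G : R -> R) (c J : R) : (forall z, z <> c -> F z = G z) ->
  (forall a b, ex_RInt F a b) -> is_RIntR F J -> is_RIntR G J.
Proof.
  intros H Hex HJ.
  assert (HG : forall a b, ex_RInt G a b).
  { apply (ex_RInt_cut G F F c); auto; intros; symmetry; apply H; lra. }
  assert (HE : forall a b, RInt G a b = RInt F a b).
  { intros a b. rewrite <- (RInt_Chasles_R G a c b), <- (RInt_Chasles_R F a c b) by auto.
    f_equal; apply RInt_ext; intros x Hx; symmetry; apply H.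
    - apply RInt_ends_neq in Hx; auto.
    - rewrite Rmin_comm, Rmax_comm in Hx. apply RInt_ends_neq in Hx; auto. }
  intros P HP. generalize (HJ P HP). unfold filtermapi. apply filter_imp.
  intros [a b] [y [Hy1 Hy2]]. exists y. split; auto. simpl in *.
  rewrite <- (is_RInt_unique (V := R_CompleteNormedModule) _ _ _ _ Hy1), <- HE.
  apply (RInt_correct G). auto.
Qed.

Definition gauss_moment (p : nat) : R := gauss_int (fun u => u ^ p).
Definition moment_indicator (p : nat) (z : R) : R := if Rle_dec (z ^ p) (gauss_moment p) then 1 else 0.

Lemma gauss_moment_odd (p : nat) : Nat.Odd p -> gauss_moment p = 0.
Proof.
  intros Ho. pose proof (is_RIntR_gauss_pow p) as H. pose proof sqrt_2pi_pos.
  assert (H2 : is_RIntR (fun z => z ^ p * gexp z) (-1 * (sqrt_2pi * gauss_int (fun u => u ^ p)))).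
  { eapply is_RIntR_ext. 2: apply is_RIntR_scal, is_RIntR_opp_arg, H.
    intros x. simpl. rewrite gexp_opp.
    replace ((- x) ^ p) with (- x ^ p). ring.
    destruct Ho as [k ->]. replace (- x) with (-1 * x) by ring.
    rewrite Rpow_mult_distr, Nat.add_1_r, pow_1_odd. ring. }
  pose proof (is_RIntR_inj _ _ _ H H2). unfold gauss_moment. nra.
Qed.

Lemma gauss_moment_nonneg (p : nat) : 0 <= gauss_moment p.
Proof.
  destruct (Nat.Even_or_Odd p) as [He|Ho].
  - pose proof (is_RIntR_gauss_pow p) as H. pose proof sqrt_2pi_pos.
    assert (Hp : forall x, 0 <= x ^ p * gexp x).
    { intros x. apply Rmult_le_pos. destruct He as [k ->]. rewrite pow_mult. apply pow_le. nra.
      left; apply exp_pos. }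
    assert (Hex : forall a b, ex_RInt (fun z => z ^ p * gexp z) a b).
    { intros. apply ex_RInt_cont. intros. apply continuous_Rmult. apply continuous_pow. apply continuous_gexp. }
    pose proof (is_RIntR_ge_RInt _ _ Hex Hp H) as H1.
    assert (0 <= RInt (fun z => z ^ p * gexp z) (-1) 1) by (apply RInt_ge_0; [lra|auto|auto]).
    unfold gauss_moment. nra.
  - rewrite gauss_moment_odd by auto. lra.
Qed.

(** The points r and -r are the only possible jumps of the limiting error at the origin, and feed
    the two exceptional points of [grid_dct]. For odd p, r = 0. *)
Lemma gauss_moment_root (p : nat) : (1 <= p)%nat -> exists r, 0 <= r /\ r ^ p = gauss_moment p.
Proof.
  intros Hp. pose proof (gauss_moment_nonneg p) as Hc.
  destruct (IVT_gen (fun x => x ^ p) 0 (gauss_moment p + 1) (gauss_moment p)) as [r [Hr1 Hr2]].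
  - intros x. apply continuity_pt_filterlim. apply continuous_pow.
  - rewrite pow_i by lia. assert (gauss_moment p + 1 <= (gauss_moment p + 1) ^ p).
    { pose proof (Rle_pow (gauss_moment p + 1) 1 p ltac:(lra) Hp). rewrite pow_1 in H. auto. }
    rewrite Rmin_left, Rmax_right by lra. lra.
  - rewrite Rmin_left in Hr1 by lra. exists r. split; auto. lra.
Qed.

Lemma pow_lt_mono (p : nat) (a b : R) : (1 <= p)%nat -> 0 <= a -> a < b -> a ^ p < b ^ p.
Proof.
  intros Hp Ha Hab. induction Hp as [|p Hp IH]. rewrite !pow_1; auto.
  simpl. assert (0 <= a ^ p) by (apply pow_le; auto). nra.
Qed.

Lemma pow_eq_root (p : nat) (r z c : R) : (1 <= p)%nat -> 0 <= r -> 0 <= c -> r ^ p = c -> z ^ p = c ->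
  z = r \/ z = - r.
Proof.
  intros Hp Hr Hc Er Ez.
  assert (Ea : Rabs z ^ p = r ^ p).
  { rewrite RPow_abs, Ez, Er. apply Rabs_right. lra. }
  assert (Rabs z = r).
  { pose proof (Rabs_pos z). destruct (total_order_T (Rabs z) r) as [[h|h]|h]; auto.
    - pose proof (pow_lt_mono p _ _ Hp H h). lra.
    - pose proof (pow_lt_mono p _ _ Hp Hr h). lra. }
  unfold Rabs in H. destruct (Rcase_abs z); [right|left]; lra.
Qed.

Lemma ex_RInt_gexp (a b : R) : ex_RInt gexp a b.
Proof. apply ex_RInt_cont, continuous_gexp. Qed.

Lemma ex_RInt_zero (a b : R) : ex_RInt (fun _ : R => 0) a b.
Proof. apply ex_RInt_cont. intros; apply continuous_const. Qed.

(** The event is [-r, r] for even p, obtained by two cuts, and (-oo, 0] for odd p, obtained by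
    one. *)
Lemma ex_RInt_moment_indicator (p : nat) (a b : R) : (1 <= p)%nat -> ex_RInt (fun z => moment_indicator p z * gexp z) a b.
Proof.
  intros Hp. revert a b.
  destruct (Nat.Even_or_Odd p) as [He|Ho].
  - destruct (gauss_moment_root p Hp) as [r [Hr Er]].
    set (K := fun z => if Rlt_dec z (- r) then 0 else gexp z).
    assert (HK : forall a b, ex_RInt K a b).
    { apply (ex_RInt_cut K (fun _ => 0) gexp (- r)).
      - intros z Hz. unfold K. destruct (Rlt_dec z (- r)); lra.
      - intros z Hz. unfold K. destruct (Rlt_dec z (- r)); lra.
      - apply ex_RInt_zero.
      - apply ex_RInt_gexp. }
    assert (Ep : forall z, z ^ p = Rabs z ^ p).
    { intros z. unfold Rabs. destruct (Rcase_abs z); auto. symmetry. apply pow_opp_even; auto. }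
    apply (ex_RInt_cut _ K (fun _ => 0) r); auto. 3: apply ex_RInt_zero.
    + intros z Hz. unfold moment_indicator, K. rewrite Ep, <- Er. destruct (Rlt_dec z (- r)) as [h|h].
      * destruct (Rle_dec _ _) as [h1|h1]; [|ring]. rewrite Rabs_left in h1 by lra.
        pose proof (pow_lt_mono p r (- z) Hp Hr ltac:(lra)). lra.
      * destruct (Rle_dec _ _) as [h1|h1]; [ring|]. exfalso. apply h1. apply pow_incr. split.
        apply Rabs_pos. apply Rabs_le. lra.
    + intros z Hz. unfold moment_indicator. rewrite Ep, <- Er. destruct (Rle_dec _ _) as [h1|h1]; [|ring].
      rewrite Rabs_right in h1 by lra. pose proof (pow_lt_mono p r z Hp Hr Hz). lra.
  - apply (ex_RInt_cut _ gexp (fun _ => 0) 0). 3: apply ex_RInt_gexp. 3: apply ex_RInt_zero.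
    + intros z Hz. unfold moment_indicator. rewrite gauss_moment_odd by auto.
      destruct (Rle_dec _ _) as [h1|h1]; [ring|]. exfalso. apply h1. apply pow_odd_nonpos; auto; lra.
    + intros z Hz. unfold moment_indicator. rewrite gauss_moment_odd by auto.
      destruct (Rle_dec _ _) as [h1|h1]; [|ring]. pose proof (pow_lt z p Hz). lra.
Qed.

Lemma moment_indicator_01 (p : nat) (z : R) : 0 <= moment_indicator p z <= 1.
Proof. unfold moment_indicator. destruct (Rle_dec _ _); lra. Qed.

Lemma is_RIntR_moment_indicator (p : nat) : (1 <= p)%nat ->
  is_RIntR (fun z => moment_indicator p z * gexp z) (sqrt_2pi * gamma_p p).
Proof.
  intros Hp. change (gamma_p p) with (gauss_int (moment_indicator p)). apply gauss_int_ex.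
  destruct (ex_RIntR_expbound (moment_indicator p) 1 0 0) as [J HJ]. lra.
  - intros u v. apply ex_RInt_ext with (fun z => moment_indicator p z * gexp z).
    intros x _. apply untilted; auto. apply ex_RInt_moment_indicator; auto.
  - intros z. rewrite Rmult_0_l, exp_0, Rmult_1_r. pose proof (moment_indicator_01 p z). rewrite Rabs_right; lra.
  - exists J. eapply is_RIntR_ext. 2: apply HJ. intros x. simpl. symmetry. apply untilted; auto.
Qed.

(** For odd p the events at z and -z are complementary off 0, so together they carry the full
    Gaussian mass. *)
Lemma gamma_odd (p : nat) : (1 <= p)%nat -> Nat.Odd p -> gamma_p p = / 2.
Proof.
  intros Hp Ho. pose proof (is_RIntR_moment_indicator p Hp) as H. pose proof sqrt_2pi_pos.
  pose proof (is_RIntR_plus _ _ _ _ H (is_RIntR_opp_arg _ _ H)) as H2.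
  assert (H3 : is_RIntR (fun x => moment_indicator p x * gexp x + moment_indicator p (- x) * gexp (- x)) sqrt_2pi).
  { apply is_RIntR_off_point with gexp 0.
    - intros z Hz. rewrite gexp_opp. unfold moment_indicator. rewrite gauss_moment_odd by auto.
      destruct (Rdichotomy _ _ Hz) as [h|h].
      + destruct (Rle_dec (z ^ p) 0) as [h1|h1]; [|exfalso; apply h1, pow_odd_nonpos; auto; lra].
        destruct (Rle_dec ((- z) ^ p) 0) as [h2|h2]; [|ring]. pose proof (pow_lt (- z) p ltac:(lra)). lra.
      + destruct (Rle_dec ((- z) ^ p) 0) as [h1|h1]; [|exfalso; apply h1, pow_odd_nonpos; auto; lra].
        destruct (Rle_dec (z ^ p) 0) as [h2|h2]; [|ring]. pose proof (pow_lt z p h). lra.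
    - apply ex_RInt_gexp.
    - apply gexp_int. }
  pose proof (is_RIntR_inj _ _ _ H2 H3). nra.
Qed.

(** If z^p is below the moment, the error is eventually below every t < 0 and tends to -oo. If
    above, it exceeds every t < 0, while for t > 0 the level has a positive limit, so the error
    tends to 0. *)
Lemma well_zero (p : nat) (beta h : R) (g : R -> R) (lm lp : R) :
  (forall x, continuous g x) -> is_lim g m_infty lm -> is_lim g p_infty lp ->
  (3 <= p)%nat -> nondeg_max p beta h 0 ->
  (forall t, t < 0 -> is_lim_seq (fun N => sqrt (INR N) ^ p * mean_p p (beta + t / sqrt (INR N)) h N) (gauss_moment p)) ->
  (forall t, 0 < t -> exists a, mean_lim p beta h t a /\ 0 < a) ->
  well_lim p beta 0 (test_err p beta h g lm lp) (gamma_p p * lm + (1 - gamma_p p) * g 0).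
Proof.
  intros Hc Hm Hlp Hp Gm Hdn Hup.
  destruct (gauss_moment_root p ltac:(lia)) as [r [Hr Er]].
  set (Phi := fun z => moment_indicator p z * lm + (1 - moment_indicator p z) * g 0).
  assert (Hcmp : forall z t, t < 0 ->
    (z ^ p < gauss_moment p -> grid_filter (curvature_sqrt p beta 0) 0 z (fun q => Rbar_le (err_at p beta h (fst q) (grid (fst q) (snd q))) t)) /\
    (gauss_moment p < z ^ p -> grid_filter (curvature_sqrt p beta 0) 0 z (fun q => ~ Rbar_le (err_at p beta h (fst q) (grid (fst q) (snd q))) t))).
  { intros z t Ht. apply (err_at_compare p beta h (curvature_sqrt p beta 0) 0 z t (fun N => sqrt (INR N) ^ p) 0 (z ^ p) (gauss_moment p)).
    - lia.
    - intros N HN. apply pow_lt, sqrt_INR_pos; auto.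
    - rewrite curvature_sqrt_0 by auto.
      apply filterlim_ext with (fun q => zgrid 1 0 (fst q) (snd q) ^ p).
      { intros q. unfold zgrid.
        replace (1 * sqrt (INR (fst q)) * (grid (fst q) (snd q) - 0)) with (sqrt (INR (fst q)) * grid (fst q) (snd q)) by ring.
        rewrite Rpow_mult_distr. ring. }
      apply (filterlim_cont (grid_filter 1 0 z) (fun q => zgrid 1 0 (fst q) (snd q)) (fun x => x ^ p) z).
      apply grid_filter_zgrid. apply continuous_pow.
    - eapply is_lim_seq_ext. 2: apply (Hdn t Ht). intros; simpl; ring. }
  assert (Hne : forall z, z <> r -> z <> - r -> z ^ p <> gauss_moment p).
  { intros z h1 h2 E. destruct (pow_eq_root p r z (gauss_moment p)); auto. lia. apply gauss_moment_nonneg. }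
  exists Phi, (Rabs lm + Rabs (g 0)), r. split; [|split; [|split; [|split]]].
  - intros z h1 h2. unfold test_err, Phi, moment_indicator. destruct (Rle_dec (z ^ p) (gauss_moment p)) as [h0|h0].
    + replace (1 * lm + (1 - 1) * g 0) with lm by ring.
      apply ext_lim_m; auto. typeclasses eauto.
      intros t Ht. apply Hcmp; auto. destruct h0 as [h0|h0]; auto. exfalso. apply (Hne z); auto.
    + replace (0 * lm + (1 - 0) * g 0) with (g 0) by ring.
      apply ext_lim; auto. typeclasses eauto.
      * intros t _ Ht. destruct (Hup t Ht) as [a [Ha1 Ha2]].
        apply (level_compare p beta h 0 z t a); auto. rewrite pow_i by lia. auto.
      * intros t _ Ht. apply Hcmp; auto. lra.
  (* Off r and -r the inequality between z^p and the moment is strict, hence stable, and [Phi] is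
     locally constant. *)
  - intros z h1 h2. specialize (Hne z h1 h2).
    apply continuous_ext_loc with (fun _ => Phi z). 2: apply continuous_const.
    assert (He : 0 < Rabs (z ^ p - gauss_moment p)) by (apply Rabs_pos_lt; lra).
    destruct (proj1 (filterlim_locally (F := locally z) _ _) (continuous_pow p z) (mkposreal _ He)) as [d Hd].
    exists d. intros y Hy. specialize (Hd y Hy).
    change (Rabs (y ^ p - z ^ p) < Rabs (z ^ p - gauss_moment p)) in Hd. unfold Phi, moment_indicator.
    destruct (Rle_dec (z ^ p) (gauss_moment p)) as [k|k]; destruct (Rle_dec (y ^ p) (gauss_moment p)) as [k'|k']; auto; exfalso.
    + rewrite (Rabs_left1 (z ^ p - gauss_moment p)) in Hd by lra. apply Rabs_def2 in Hd. lra.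
    + rewrite (Rabs_right (z ^ p - gauss_moment p)) in Hd by lra. apply Rabs_def2 in Hd. lra.
  - intros u v. apply ex_RInt_ext with (fun z => plus (scal (lm - g 0) (moment_indicator p z * gexp z)) (scal (g 0) (gexp z))).
    { intros x _. change ((lm - g 0) * (moment_indicator p x * gexp x) + g 0 * gexp x = Phi x * gexp x). unfold Phi. ring. }
    apply (ex_RInt_plus (fun z => scal (lm - g 0) (moment_indicator p z * gexp z)) (fun z => scal (g 0) (gexp z))).
    apply (ex_RInt_scal (fun z => moment_indicator p z * gexp z)). apply ex_RInt_moment_indicator; lia.
    apply (ex_RInt_scal gexp). apply ex_RInt_gexp.
  - intros z. unfold Phi, moment_indicator. pose proof (Rabs_pos lm). pose proof (Rabs_pos (g 0)).
    destruct (Rle_dec _ _).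
    + replace (1 * lm + (1 - 1) * g 0) with lm by ring. lra.
    + replace (0 * lm + (1 - 0) * g 0) with (g 0) by ring. lra.
  - replace (sqrt_2pi * (gamma_p p * lm + (1 - gamma_p p) * g 0)) with
      ((lm - g 0) * (sqrt_2pi * gamma_p p) + g 0 * sqrt (2 * PI)) by (unfold sqrt_2pi; ring).
    eapply is_RIntR_ext.
    2: apply is_RIntR_plus; [apply is_RIntR_scal, (is_RIntR_moment_indicator p); lia|apply is_RIntR_scal, gexp_int].
    intros x. unfold Phi. ring.
Qed.

(** * Assembling the wells into mixture limits *)

Lemma converges_to_of_wells (p : nat) (beta h : R) (ms : list R) (mu : list (R * Defs.comp)) :
  setup p beta h ms -> ms <> nil ->
  (forall (g : R -> R) (lm lp : R), (forall x, continuous g x) -> is_lim g m_infty lm -> is_lim g p_infty lp ->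
     exists E, (forall m, In m ms -> well_lim p beta m (test_err p beta h g lm lp) (E m)) /\
       sumR (map (fun m => well_weight p beta m * E m) ms) / sumR (map (well_weight p beta) ms) = mix_int mu g lm lp) ->
  converges_to p beta h mu.
Proof.
  intros HS Hne HE g lm lp Hc Hm Hp.
  destruct (HE g lm lp Hc Hm Hp) as [E [HE1 HE2]]. rewrite <- HE2.
  destruct (ext_bounded g lm lp Hc Hm Hp) as [B [HB0 HB]].
  apply is_lim_seq_ext_loc with (fun N => model_mean p beta h N (test_err p beta h g lm lp N)).
  { exists 1%nat. intros N HN. symmetry.
    apply (Emodel_model_mean p beta h N (fun x => ext g lm lp (err_at p beta h N x))). auto. }
  apply well_mixture with B; auto. intros; apply HB.
Qed.

Lemma cst_well_weight (p : nat) (beta h m : R) : (3 <= p)%nat -> nondeg_max p beta h m -> cst p beta h m = well_weight p beta m.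
Proof.
  intros Hp [Im [_ [Nm _]]]. unfold cst, well_weight, curvature_sqrt, curvature. rewrite H2_eq by (auto; lia).
  rewrite <- sqrt_mult by nra. do 2 f_equal. ring.
Qed.

(** [lo] and [hi] are ordered by their p-th powers, not by position: the two orders are opposite for
    even p and h < 0. *)
Lemma ordered_wells (p : nat) (beta h lo hi : R) (ms : list R) (g : R -> R) (lm lp : R) :
  (forall x, continuous g x) -> is_lim g m_infty lm -> is_lim g p_infty lp ->
  setup p beta h ms -> In lo ms -> In hi ms -> (forall m, In m ms -> m = lo \/ m = hi) ->
  lo ^ p < hi ^ p -> lo <> 0 -> hi <> 0 ->
  well_lim p beta lo (test_err p beta h g lm lp) (/ 2 * comp_int (HalfNeg (sigma2 p beta h lo)) g lm lp + / 2 * g 0) /\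
  well_lim p beta hi (test_err p beta h g lm lp) (/ 2 * comp_int (HalfPos (sigma2 p beta h hi)) g lm lp + / 2 * g 0).
Proof.
  intros Hc Hm Hp HS Hlo Hhi Hall Hlt Nlo Nhi.
  assert (Thi : forall t, 0 < t -> tracks p beta h hi t).
  { intros t Ht. apply mean_p_track with ms; auto. exists hi; auto.
    intros m Hin. destruct (Hall m Hin) as [->| ->]; [right; nra|left; auto]. }
  assert (Tlo : forall t, t < 0 -> tracks p beta h lo t).
  { intros t Ht. apply mean_p_track with ms; auto. exists lo; auto.
    intros m Hin. destruct (Hall m Hin) as [->| ->]; [left; auto|right; nra]. }
  destruct HS as [H3 [_ [_ Hgood]]].
  split.
  - apply well_down; auto. intros t Ht. exists (hi ^ p). split; auto.
    apply mean_p_track_lim with (1 := Thi t Ht).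
  - apply well_up; auto. intros t Ht. exists (lo ^ p). split; auto.
    apply mean_p_track_lim with (1 := Tlo t Ht).
Qed.

(** Serves both threshold cases: 0 with one positive well for odd p, and 0 with the pair -m, m for
    even p, which acts as one well because its p-th power and response agree. *)
Lemma zero_and_equal_wells (p : nat) (beta h M v : R) (ms : list R) (g : R -> R) (lm lp : R) :
  (forall x, continuous g x) -> is_lim g m_infty lm -> is_lim g p_infty lp ->
  setup p beta h ms -> In 0 ms -> 0 < M ->
  (forall m, In m ms -> m = 0 \/ (m ^ p = M /\ pow_slope p m ^ 2 / curvature p beta m = v)) ->
  (exists m, In m ms /\ m <> 0) ->
  well_lim p beta 0 (test_err p beta h g lm lp) (gamma_p p * lm + (1 - gamma_p p) * g 0) /\
  (forall m, In m ms -> m <> 0 ->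
    well_lim p beta m (test_err p beta h g lm lp) (/ 2 * comp_int (HalfPos (sigma2 p beta h m)) g lm lp + / 2 * g 0)).
Proof.
  intros Hc Hm Hlp HS H0 HM Hall [m1 [Hm1 Nm1]].
  pose proof HS as [H3 [_ [_ Hgood]]].
  assert (E0 : 0 ^ p = 0) by (apply pow_i; lia).
  assert (Tup : forall t, 0 < t -> is_lim_seq (fun N => sqrt (INR N) * (mean_p p (beta + t / sqrt (INR N)) h N - M)) (t * v)).
  { intros t Ht. apply mean_p_track with ms; auto.
    - exists m1. split; auto. destruct (Hall m1 Hm1) as [h1|[h1 _]]; auto. contradiction.
    - intros m Hin. destruct (Hall m Hin) as [->|h1]; auto. right. rewrite E0. nra. }
  assert (Tdn : forall t, t < 0 -> is_lim_seq (fun N => sqrt (INR N) ^ p * mean_p p (beta + t / sqrt (INR N)) h N) (gauss_moment p)).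
  { intros t Ht. apply mean_p_zero_well with ms; auto.
    intros m Hin. destruct (Hall m Hin) as [->|[h1 _]]; auto. right. rewrite h1. nra. }
  split.
  - apply well_zero; auto. intros t Ht. exists M. split; auto.
    apply mean_p_track_lim with (1 := Tup t Ht).
  - intros m Hin Nm. destruct (Hall m Hin) as [h1|[h1 h2]]; [contradiction|].
    apply well_up; auto.
    + intros t Ht. unfold tracks. rewrite h1, h2. auto.
    + intros t Ht. exists 0. split; [|lra].
      (* The level is of order N^(-p/2) for t < 0, hence tends to 0, below the p-th power of this
         well. *)
      apply is_lim_seq_ext_loc with (fun N => (1 / sqrt (INR N)) ^ p * (sqrt (INR N) ^ p * mean_p p (beta + t / sqrt (INR N)) h N)).
      { exists 1%nat. intros N HN. pose proof (sqrt_INR_pos N HN).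
        rewrite <- Rmult_assoc, <- Rpow_mult_distr. replace (1 / sqrt (INR N) * sqrt (INR N)) with 1 by (field; lra).
        rewrite pow1. ring. }
      replace (Finite 0) with (Finite (0 ^ p * gauss_moment p)) by (rewrite E0; f_equal; ring).
      apply is_lim_seq_mult'; auto.
      apply (is_lim_seq_continuous (fun x => x ^ p) (fun N => 1 / sqrt (INR N)) 0).
      apply continuity_pt_filterlim, continuous_pow. apply is_lim_seq_inv_sqrt.
Qed.

Lemma odd_pow_lt (p : nat) (a b : R) : Nat.Odd p -> a < b -> a ^ p < b ^ p.
Proof.
  intros Ho Hab. assert (Hp : (1 <= p)%nat) by (destruct Ho; lia).
  assert (Hopp : forall x, (- x) ^ p = - x ^ p).
  { intros x. destruct Ho as [k ->]. replace (- x) with (-1 * x) by ring.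
    rewrite Rpow_mult_distr, Nat.add_1_r, pow_1_odd. ring. }
  destruct (Rle_dec 0 a) as [h|h]. apply pow_lt_mono; auto.
  destruct (Rlt_dec 0 b) as [h'|h'].
  - pose proof (pow_lt b p h'). pose proof (pow_lt (- a) p ltac:(lra)) as H1. rewrite Hopp in H1. lra.
  - pose proof (pow_lt_mono p (- b) (- a) Hp ltac:(lra) ltac:(lra)) as H1. rewrite !Hopp in H1. lra.
Qed.

Lemma setup_intro (p : nat) (beta h : R) (ms : list R) : (3 <= p)%nat -> StronglySorted Rlt ms ->
  (forall x, In x ms <-> is_global_max p beta h x) -> (forall m, In m ms -> nondeg_max p beta h m) ->
  setup p beta h ms.
Proof.
  intros Hp HS Hin Hg. split; auto. split; auto. clear -HS.
  induction HS as [|a l HS IH HF]; constructor; auto.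
  intros Ha. rewrite Forall_forall in HF. specialize (HF a Ha). lra.
Qed.

Lemma converges_two_ordered (p : nat) (beta h a b lo hi : R) : setup p beta h (a :: b :: nil) -> a <> b ->
  (lo = a /\ hi = b) \/ (lo = b /\ hi = a) -> lo ^ p < hi ^ p -> lo <> 0 -> hi <> 0 ->
  converges_to p beta h
    ((well_weight p beta lo / (well_weight p beta lo + well_weight p beta hi) / 2, HalfNeg (sigma2 p beta h lo)) ::
     (well_weight p beta hi / (well_weight p beta lo + well_weight p beta hi) / 2, HalfPos (sigma2 p beta h hi)) ::
     (/ 2, Dirac (Finite 0)) :: nil).
Proof.
  intros HS Hab Hc Hlt Nlo Nhi.
  assert (Ilo : In lo (a :: b :: nil)) by (simpl; destruct Hc as [[-> _]|[-> _]]; auto).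
  assert (Ihi : In hi (a :: b :: nil)) by (simpl; destruct Hc as [[_ ->]|[_ ->]]; auto).
  assert (Hall : forall m, In m (a :: b :: nil) -> m = lo \/ m = hi).
  { intros m [<-|[<-|[]]]; destruct Hc as [[-> ->]|[-> ->]]; auto. }
  assert (Hcl : 0 < well_weight p beta lo) by (apply (well_weight_pos p beta h); apply HS; auto).
  assert (Hch : 0 < well_weight p beta hi) by (apply (well_weight_pos p beta h); apply HS; auto).
  apply converges_to_of_wells with (a :: b :: nil); auto. discriminate.
  intros g lm lp g1 g2 g3.
  destruct (ordered_wells p beta h lo hi _ g lm lp g1 g2 g3 HS Ilo Ihi Hall Hlt Nlo Nhi) as [Wlo Whi].
  set (Elo := / 2 * comp_int (HalfNeg (sigma2 p beta h lo)) g lm lp + / 2 * g 0) in *.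
  set (Ehi := / 2 * comp_int (HalfPos (sigma2 p beta h hi)) g lm lp + / 2 * g 0) in *.
  assert (Hne : lo <> hi) by (intros E; rewrite E in Hlt; lra).
  exists (fun m => if Req_EM_T m lo then Elo else Ehi). split.
  - intros m Hin. destruct (Req_EM_T m lo) as [->|k]; auto.
    destruct (Hall m Hin) as [->| ->]; auto. contradiction.
  - assert (E : forall f : R -> R, sumR (map f (a :: b :: nil)) = f lo + f hi).
    { intros f. unfold sumR; simpl. destruct Hc as [[-> ->]|[-> ->]]; ring. }
    rewrite !E. destruct (Req_EM_T lo lo) as [_|n]; [|contradiction].
    destruct (Req_EM_T hi lo) as [e|_]; [congruence|].
    unfold mix_int, sumR. cbn [map fold_right fst snd].
    change (comp_int (Dirac (Finite 0)) g lm lp) with (g 0).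
    unfold Elo, Ehi. field. lra.
Qed.

(** * The mixture limits *)

Lemma curvature_opp (p : nat) (beta m : R) : Nat.Even p -> (2 <= p)%nat -> curvature p beta (- m) = curvature p beta m.
Proof. intros. unfold curvature. rewrite H2f_opp; auto. Qed.

Lemma well_weight_opp (p : nat) (beta m : R) : Nat.Even p -> (2 <= p)%nat -> well_weight p beta (- m) = well_weight p beta m.
Proof. intros. unfold well_weight, curvature_sqrt. rewrite curvature_opp by auto. do 3 f_equal. ring. Qed.

Lemma pow_slope_sqr_opp (p : nat) (m : R) : pow_slope p (- m) ^ 2 = pow_slope p m ^ 2.
Proof.
  unfold pow_slope. replace (- m) with (-1 * m) by ring. rewrite Rpow_mult_distr.
  rewrite !Rpow_mult_distr, <- pow_mult, Nat.mul_comm, pow_1_even. ring.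
Qed.

Lemma sigma2_opp (p : nat) (beta m : R) : Nat.Even p -> (2 <= p)%nat -> -1 < m < 1 ->
  sigma2 p beta 0 (- m) = sigma2 p beta 0 m.
Proof.
  intros He Hp Hm. unfold sigma2. rewrite !H2_eq, H2f_opp by (auto; lra).
  rewrite pow_opp_even; auto. exists (p - 1)%nat. lia.
Qed.

(** The two wells have equal p-th powers, so no tilt separates them; each is tracked for both signs
    of t and keeps its whole Gaussian, without atoms. *)
Lemma converges_pair (p : nat) (beta m : R) : Nat.Even p -> setup p beta 0 (- m :: m :: nil) -> 0 < m ->
  converges_to p beta 0 ((1, Normal (sigma2 p beta 0 m)) :: nil).
Proof.
  intros He HS Hm. pose proof HS as [Hp [_ [_ Hgood]]].
  assert (Gm : nondeg_max p beta 0 m) by (apply Hgood; simpl; auto).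
  assert (Hcm : 0 < well_weight p beta m) by (apply (well_weight_pos p beta 0); auto).
  assert (Ep : (- m) ^ p = m ^ p) by (apply pow_opp_even; auto).
  assert (Ek : pow_slope p (- m) ^ 2 / curvature p beta (- m) = pow_slope p m ^ 2 / curvature p beta m).
  { rewrite pow_slope_sqr_opp, curvature_opp; auto. lia. }
  assert (HT : forall t, tracks p beta 0 m t).
  { intros t. apply mean_p_track with (- m :: m :: nil); auto. exists m; simpl; auto.
    intros x [<-|[<-|[]]]; left; auto. }
  apply converges_to_of_wells with (- m :: m :: nil); auto. discriminate.
  intros g lm lp g1 g2 g3.
  exists (fun _ => comp_int (Normal (sigma2 p beta 0 m)) g lm lp). split.
  - intros x [<-|[<-|[]]].
    + rewrite <- sigma2_opp by (auto; try lia; destruct Gm; lra).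
      apply well_both; auto. apply Hgood; simpl; auto. lra.
      intros t. unfold tracks. rewrite Ep, Ek. apply HT.
    + apply well_both; auto. lra.
  - unfold mix_int, sumR. cbn [map fold_right fst snd].
    rewrite well_weight_opp by (auto; lia). field. lra.
Qed.

(** The two outer wells have weight p_1 each. Their halves combine to p_1 of the half-normal law and
    p_1 at 0; with p_2 (1 - gamma_p) from the origin and 2 p_1 + p_2 = 1, the atom at 0 is as
    stated. *)
Lemma converges_triple (p : nat) (beta m : R) : Nat.Even p -> setup p beta 0 (- m :: 0 :: m :: nil) -> 0 < m ->
  converges_to p beta 0
    ((well_weight p beta 0 / (well_weight p beta m + well_weight p beta 0 + well_weight p beta m) * gamma_p p, Dirac m_infty) ::
     (well_weight p beta m / (well_weight p beta m + well_weight p beta 0 + well_weight p beta m), HalfPos (sigma2 p beta 0 m)) ::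
     (1 - well_weight p beta m / (well_weight p beta m + well_weight p beta 0 + well_weight p beta m)
        - well_weight p beta 0 / (well_weight p beta m + well_weight p beta 0 + well_weight p beta m) * gamma_p p, Dirac (Finite 0)) :: nil).
Proof.
  intros He HS Hm. pose proof HS as [Hp [_ [_ Hgood]]].
  assert (Gm : nondeg_max p beta 0 m) by (apply Hgood; simpl; auto).
  assert (G0 : nondeg_max p beta 0 0) by (apply Hgood; simpl; auto).
  assert (Hcm : 0 < well_weight p beta m) by (apply (well_weight_pos p beta 0); auto).
  assert (Hc0 : 0 < well_weight p beta 0) by (apply (well_weight_pos p beta 0); auto).
  apply converges_to_of_wells with (- m :: 0 :: m :: nil); auto. discriminate.
  intros g lm lp g1 g2 g3.
  destruct (zero_and_equal_wells p beta 0 (m ^ p) (pow_slope p m ^ 2 / curvature p beta m) _ g lm lp g1 g2 g3 HS) as [W0 Wm].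
  { simpl; auto. } { apply pow_lt; auto. }
  { intros x [<-|[<-|[<-|[]]]]; auto. right. split. apply pow_opp_even; auto.
    rewrite pow_slope_sqr_opp, curvature_opp; auto. lia. }
  { exists m. simpl. split; auto. lra. }
  exists (fun x => if Req_EM_T x 0 then gamma_p p * lm + (1 - gamma_p p) * g 0
     else / 2 * comp_int (HalfPos (sigma2 p beta 0 m)) g lm lp + / 2 * g 0). split.
  - intros x Hx. destruct (Req_EM_T x 0) as [->|k]; auto.
    replace (sigma2 p beta 0 m) with (sigma2 p beta 0 x). auto.
    destruct Hx as [<-|[<-|[<-|[]]]]; auto. apply sigma2_opp; auto. lia. destruct Gm; lra.
    contradiction.
  - unfold mix_int, sumR. cbn [map fold_right fst snd].
    destruct (Req_EM_T (- m) 0); [lra|]. destruct (Req_EM_T 0 0); [|lra]. destruct (Req_EM_T m 0); [lra|].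
    rewrite well_weight_opp by (auto; lia).
    change (comp_int (Dirac (Finite 0)) g lm lp) with (g 0).
    change (comp_int (Dirac m_infty) g lm lp) with lm.
    field. lra.
Qed.

(** For odd p gamma_p = 1/2, so each of the two wells sends half of its mass to 0, which adds up to
    1/2. *)
Lemma converges_zero_pos (p : nat) (beta h b : R) : Nat.Odd p -> setup p beta h (0 :: b :: nil) -> 0 < b ->
  converges_to p beta h
    ((well_weight p beta 0 / (well_weight p beta 0 + well_weight p beta b) / 2, Dirac m_infty) ::
     (well_weight p beta b / (well_weight p beta 0 + well_weight p beta b) / 2, HalfPos (sigma2 p beta h b)) ::
     (/ 2, Dirac (Finite 0)) :: nil).
Proof.
  intros Ho HS Hb. pose proof HS as [Hp [_ [_ Hgood]]].
  assert (Gb : nondeg_max p beta h b) by (apply Hgood; simpl; auto).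
  assert (G0 : nondeg_max p beta h 0) by (apply Hgood; simpl; auto).
  assert (Hcb : 0 < well_weight p beta b) by (apply (well_weight_pos p beta h); auto).
  assert (Hc0 : 0 < well_weight p beta 0) by (apply (well_weight_pos p beta h); auto).
  apply converges_to_of_wells with (0 :: b :: nil); auto. discriminate.
  intros g lm lp g1 g2 g3.
  destruct (zero_and_equal_wells p beta h (b ^ p) (pow_slope p b ^ 2 / curvature p beta b) _ g lm lp g1 g2 g3 HS) as [W0 Wm].
  { simpl; auto. } { apply pow_lt; auto. }
  { intros x [<-|[<-|[]]]; auto. }
  { exists b. simpl. split; auto. lra. }
  exists (fun x => if Req_EM_T x 0 then gamma_p p * lm + (1 - gamma_p p) * g 0
     else / 2 * comp_int (HalfPos (sigma2 p beta h b)) g lm lp + / 2 * g 0). split.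
  - intros x Hx. destruct (Req_EM_T x 0) as [->|k]; auto.
    destruct Hx as [<-|[<-|[]]]; [contradiction|]. apply Wm; simpl; auto.
  - unfold mix_int, sumR. cbn [map fold_right fst snd].
    destruct (Req_EM_T 0 0); [|lra]. destruct (Req_EM_T b 0); [lra|].
    rewrite gamma_odd by (auto; lia).
    change (comp_int (Dirac (Finite 0)) g lm lp) with (g 0).
    change (comp_int (Dirac m_infty) g lm lp) with lm.
    field. lra.
Qed.

Theorem mainTheorem8 (p : nat) (beta h : R) (ms : list R) :
  (3 <= p)%nat ->
  p_critical p beta h ->
  (* ms = [m_1; ...; m_K] lists the global maximizers of H in increasing order *)
  StronglySorted Rlt ms ->
  (forall x, In x ms <-> is_global_max p beta h x) ->
  let m1 := nth 0 ms 0 in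
  let m2 := nth 1 ms 0 in
  let p1 := pk p beta h ms 1 in
  let p2 := pk p beta h ms 2 in
  (length ms = 2%nat \/ length ms = 3%nat) /\
  (* (1) p odd *)
  (Nat.Odd p ->
     length ms = 2%nat /\
     (~ (beta = beta_tilde p /\ h = 0) ->
        converges_to p beta h
          ((p1 / 2, HalfNeg (sigma2 p beta h m1)) ::
           ((1 - p1) / 2, HalfPos (sigma2 p beta h m2)) ::
           (/ 2, Dirac (Finite 0)) :: nil)) /\
     (beta = beta_tilde p /\ h = 0 ->
        converges_to p beta h
          ((p1 / 2, Dirac m_infty) ::
           ((1 - p1) / 2, HalfPos (sigma2 p beta h m2)) ::
           (/ 2, Dirac (Finite 0)) :: nil))) /\
  (* (2) p >= 4 even *)
  (Nat.Even p ->
     (0 < h ->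
        converges_to p beta h
          ((p1 / 2, HalfNeg (sigma2 p beta h m1)) ::
           ((1 - p1) / 2, HalfPos (sigma2 p beta h m2)) ::
           (/ 2, Dirac (Finite 0)) :: nil)) /\
     (h < 0 ->
        converges_to p beta h
          ((p1 / 2, HalfPos (sigma2 p beta h m1)) ::
           ((1 - p1) / 2, HalfNeg (sigma2 p beta h m2)) ::
           (/ 2, Dirac (Finite 0)) :: nil)) /\
     (h = 0 -> beta > beta_tilde p ->
        exists mstar, 0 < mstar /\ ms = (- mstar) :: mstar :: nil /\
          converges_to p beta h ((1, Normal (sigma2 p beta h mstar)) :: nil)) /\
     (h = 0 -> beta = beta_tilde p ->
        exists mstar, 0 < mstar /\ ms = (- mstar) :: 0 :: mstar :: nil /\
          converges_to p beta h
            ((p2 * gamma_p p, Dirac m_infty) ::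
             (p1, HalfPos (sigma2 p beta h mstar)) ::
             (1 - p1 - p2 * gamma_p p, Dirac (Finite 0)) :: nil))).
Proof.
  intros Hp Hcrit HS Hin m1 m2 p1 p2.
  assert (Hsetup : forall l, ms = l -> (forall m, In m l -> nondeg_max p beta h m) -> setup p beta h l).
  { intros l <- Hg. apply setup_intro; auto. }
  assert (Hset2 : forall a b, ms = a :: b :: nil -> nondeg_max p beta h a -> nondeg_max p beta h b -> setup p beta h (a :: b :: nil)).
  { intros a b E Ga Gb. apply Hsetup; auto. intros m [<-|[<-|[]]]; auto. }
  assert (Hpk2 : forall a b, ms = a :: b :: nil -> nondeg_max p beta h a -> nondeg_max p beta h b ->
    p1 = well_weight p beta a / (well_weight p beta a + well_weight p beta b) /\
    1 - p1 = well_weight p beta b / (well_weight p beta a + well_weight p beta b)).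
  { intros a b E Ga Gb. pose proof (well_weight_pos _ _ _ _ Ga). pose proof (well_weight_pos _ _ _ _ Gb).
    unfold p1, pk. rewrite E. unfold sumR. cbn [map fold_right nth Nat.sub].
    rewrite !cst_well_weight by auto. split; field; lra. }
  destruct (Nat.Even_or_Odd p) as [He|Ho].
  - assert (Hno : ~ Nat.Odd p) by (intros Ho; apply (Nat.Even_Odd_False p); auto).
    destruct (total_order_T h 0) as [[hn|h0]|hp].
    + destruct (structure_even_neg p beta h ms Hp He hn Hcrit HS Hin) as [a [b [E [Hab [Ga Gb]]]]].
      destruct (Hpk2 a b E Ga Gb) as [E1 E2].
      split; [rewrite E; auto|]. split; [tauto|]. intros _.
      split; [intros; lra|]. split; [|split; intros; lra]. intros _.
      (* Both maximizers are negative and p is even, so the right one has the smaller p-th power. *)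
      pose proof (converges_two_ordered p beta h a b b a (Hset2 a b E Ga Gb) ltac:(lra) ltac:(auto)) as HC.
      assert (Hlt : b ^ p < a ^ p).
      { rewrite <- (pow_opp_even p a), <- (pow_opp_even p b) by auto. apply pow_lt_mono; lra || lia. }
      specialize (HC Hlt ltac:(lra) ltac:(lra)).
      unfold m1, m2. rewrite E. cbn [nth]. rewrite E2, E1.
      (* The components come ordered by p-th power instead of position, so the two mixtures are
         compared through their integrals. *)
      intros g lm lp g1 g2 g3. specialize (HC g lm lp g1 g2 g3).
      replace (mix_int _ g lm lp) with
       (mix_int ((well_weight p beta b / (well_weight p beta b + well_weight p beta a) / 2, HalfNeg (sigma2 p beta h b)) ::
         (well_weight p beta a / (well_weight p beta b + well_weight p beta a) / 2, HalfPos (sigma2 p beta h a)) ::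
         (/ 2, Dirac (Finite 0)) :: nil) g lm lp). exact HC.
      unfold mix_int, sumR. cbn [map fold_right fst snd]. rewrite (Rplus_comm (well_weight p beta b)). ring.
    + subst h.
      destruct (structure_even_zero p beta ms Hp He Hcrit HS Hin) as [m [Hm [Gn [Gm Hcases]]]].
      destruct (pcrit_lt _ _ _ Hcrit) as [Hb0 _].
      split; [destruct Hcases as [[E _]|[E _]]; rewrite E; auto|]. split; [tauto|]. intros _.
      split; [intros; lra|]. split; [intros; lra|]. split; intros _ Hb.
      * destruct Hcases as [[E _]|[_ G0]].
        -- exists m. split; auto. split; auto. apply converges_pair; auto.
        (* Above the threshold 0 is no longer a maximizer, which rules out the list of three. *)
        -- exfalso. pose proof (proj1 (beta_tilde_spec p ltac:(lia)) beta Hb0 (proj2 (proj2 (proj2 G0)))). lra.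
      * destruct Hcases as [[_ N0]|[E G0]].
        -- exfalso. apply N0. apply beta_tilde_max; auto; lia.
        -- exists m. split; auto. split; auto.
           pose proof (well_weight_pos _ _ _ _ Gm). pose proof (well_weight_pos _ _ _ _ G0).
           assert (EQ : forall x, x / (well_weight p beta m + well_weight p beta 0 + well_weight p beta m)
             = x / (well_weight p beta m + (well_weight p beta 0 + (well_weight p beta m + 0)))) by (intros; f_equal; ring).
           assert (E1 : p1 = well_weight p beta m / (well_weight p beta m + well_weight p beta 0 + well_weight p beta m)).
           { unfold p1, pk. rewrite E. unfold sumR. cbn [map fold_right nth Nat.sub].
             rewrite !cst_well_weight, well_weight_opp by (auto; lia). auto. }
           assert (E2 : p2 = well_weight p beta 0 / (well_weight p beta m + well_weight p beta 0 + well_weight p beta m)).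
           { unfold p2, pk. rewrite E. unfold sumR. cbn [map fold_right nth Nat.sub].
             rewrite !cst_well_weight, well_weight_opp by (auto; lia). auto. }
           rewrite E1, E2. apply converges_triple; auto. apply Hsetup; auto.
           intros x [<-|[<-|[<-|[]]]]; auto.
    + destruct (structure_even_pos p beta h ms Hp He hp Hcrit HS Hin) as [a [b [E [Hab [Ga Gb]]]]].
      destruct (Hpk2 a b E Ga Gb) as [E1 E2].
      split; [rewrite E; auto|]. split; [tauto|]. intros _.
      split; [|split; [intros; lra|split; intros; lra]]. intros _.
      unfold m1, m2. rewrite E. cbn [nth]. rewrite E2, E1.
      apply (converges_two_ordered p beta h a b); auto; try lra. apply pow_lt_mono; lra || lia.
  - assert (Hne : ~ Nat.Even p) by (intros He; apply (Nat.Even_Odd_False p); auto).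
    destruct (structure_odd p beta h ms Hp Ho Hcrit HS Hin) as [a [b [E [Hab [Ga [Gb [Hnz Hz]]]]]]].
    destruct (Hpk2 a b E Ga Gb) as [E1 E2].
    split; [rewrite E; auto|]. split; [|tauto]. intros _.
    split; [rewrite E; auto|].
    unfold m1, m2. rewrite E. cbn [nth]. rewrite E2, E1. split; intros Hb.
    + destruct (Hnz Hb) as [Na Nb].
      apply (converges_two_ordered p beta h a b); auto; try lra. apply odd_pow_lt; auto.
    + specialize (Hz Hb). subst a.
      apply converges_zero_pos; auto.
Qed.
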